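(* (Haff's law, local and global.) Let $q\ge3+\gamma$ and let $m>\frac32$ be an integer, and let $\mathfrak b_1>0$ be fixed with $\mathfrak b_1^{-1/(\gamma+1)}$ small enough that the well-posedness result recalled in the context holds. Let $\varepsilon_0,\alpha_0>0$ be sufficiently small and, for $\varepsilon\in(0,\varepsilon_0)$ and $\|h^\varepsilon_{\mathrm{in}}\|_{\mathcal E}\le\alpha_0$, let $f_\varepsilon=\mathcal M+\varepsilon h_\varepsilon$ where $h_\varepsilon\in\mathcal C([0,\infty);\mathcal E)\cap L^1_{\mathrm{loc}}((0,\infty);\mathcal E_1)$ is the unique solution of $$\partial_t h_\varepsilon+\tfrac1\varepsilon v\cdot\nabla_x h_\varepsilon+\xi(t)\,\mathrm{div}_v(vh_\varepsilon)=\tfrac1{\varepsilon^2}\mathscr L_{\varepsilon,t}h_\varepsilon+\tfrac1\varepsilon\mathcal Q_{\varepsilon,t}(h_\varepsilon,h_\varepsilon)+S_\varepsilon(t,v),\qquad h_\varepsilon(0)=h^\varepsilon_{\mathrm{in}}.$$ Let $F_\varepsilon(t,x,v)=V_\varepsilon(t)^3f_\varepsilon(\tau_\varepsilon(t),x,V_\varepsilon(t)v)$ and define the local and global temperatures $$T_\varepsilon(t,x)=\int_{\mathbb R^3}F_\varepsilon(t,x,v)|v|^2\,dv,\qquad\boldsymbol T_\varepsilon(t)=\int_{\mathbb T^3\times\mathbb R^3}F_\varepsilon(t,x,v)|v|^2\,dv\,dx.$$ Then, for all fixed $\varepsilon\in(0,\varepsilon_0)$, $$\varepsilon^{\frac4{\gamma+1}}\big(\varepsilon^{-\frac2\gamma}+t\big)^{-\frac2{\gamma+1}}\lesssim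 T_\varepsilon(t,x)\lesssim\varepsilon^{\frac4{\gamma+1}}\big(\varepsilon^{-\frac2\gamma}+t\big)^{-\frac2{\gamma+1}},\qquad\forall(x,t)\in\mathbb T^3\times\mathbb R^+.$$ In particular, $$\varepsilon^{\frac4{\gamma+1}}\big(\varepsilon^{-\frac2\gamma}+t\big)^{-\frac2{\gamma+1}}\lesssim\boldsymbol T_\varepsilon(t)\lesssim\varepsilon^{\frac4{\gamma+1}}\big(\varepsilon^{-\frac2\gamma}+t\big)^{-\frac2{\gamma+1}},\qquad\forall t\in\mathbb R^+.$$
   Context: $A\lesssim B$ means $A\le CB$ with $C>0$ depending only on fixed quantities (such as $\mathsf e$, $b$, $\theta_\star$, $\mathfrak b_1$, $m$, $q$, $\alpha_0$), never on $\varepsilon$, $t$ or $x$. **Restitution coefficient.** $\gamma>0$ is fixed and $\mathsf e:[0,\infty)\to(0,1]$ is a fixed function of class $\mathcal R_\gamma$: (1) $\mathsf e$ is differentiable for $r>0$ and non-increasing; (2) $\eta_{\mathsf e}(r):=r\,\mathsf e(r)$ is strictly increasing; (3) $\lim_{r\to\infty}\mathsf e(r)\in[0,1)$; (4) there are $\mathfrak a_0,\mathfrak b_0>0$ and $\overline\gamma>\frac32\gamma$ with $|\mathsf e(r)-1+\mathfrak a_0r^\gamma|\le\mathfrak b_0r^{\overline\gamma}$ for all $r\ge0$; (5) there are $\alpha>0$, $C>0$ with $\eta_{\mathsf e}'(r)\ge C^{-1}\mathsf e(r)^\alpha$ and $|\eta'_{\mathsf e}(r)-\mathsf e(r)|\le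 C|1-\mathsf e(r)|$; (6) there is $m_0>0$ with $\limsup_{z\to\infty}z^{-m_0}\eta_{\mathsf e}^{-1}(z)<\infty$. **Collision operator.** $b:(-1,1)\to[0,\infty)$ is in $\mathbb W^{1,1}((-1,1))$ with $\int_{\mathbb S^2}b(\widehat z\cdot\sigma)\,d\sigma=1$ for unit $\widehat z$. For a restitution coefficient $\tilde{\mathsf e}$, $$\int_{\mathbb R^3}\mathcal Q_{\tilde{\mathsf e}}(g,f)\psi\,dv=\int_{\mathbb R^3\times\mathbb R^3}f(v)g(v_* )|v-v_*|\int_{\mathbb S^2}b(\widehat u\cdot\sigma)(\psi(v')-\psi(v))\,d\sigma\,dv_*dv,$$ $u=v-v_*$, $\widehat u=u/|u|$, $v'=v+\frac14\big(1+\tilde{\mathsf e}(|u|\sqrt{(1-\widehat u\cdot\sigma)/2})\big)(|u|\sigma-u)$. Set $\boldsymbol\Psi_{\tilde{\mathsf e}}(r)=\frac{r^{3/2}}2\int_0^1(1-\tilde{\mathsf e}(\sqrt r\,y)^2)y^3\,dy$; standing assumption: $\int(\mathcal Q_{\tilde{\mathsf e}}(f,g)+\mathcal Q_{\tilde{\mathsf e}}(g,f))|v|^2dv=-2\int\int f(v)g(v_* )\boldsymbol\Psi_{\tilde{\mathsf e}}(|v-v_*|^2)dvdv_*$ (as for hard spheres, $b\equiv\frac1{4\pi}$). **Maxwellian and scaling.** $\mathcal M(v)=(2\pi\theta_\star)^{-3/2}\exp(-|v|^2/(2\theta_\star))$, $\theta_\star>0$; $M(v)=(2\pi)^{-3/2}e^{-|v|^2/2}$,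 $K_\gamma=\int M(v)|v|^{3+\gamma}dv$, $\mathfrak a_1=\frac{\mathfrak a_0K_\gamma}{3(4+\gamma)}(2\theta_\star)^{\frac{1+\gamma}2}$. With the fixed constant $\mathfrak b_1>0$: $V_\varepsilon(t)=\varepsilon^{-2/\gamma}\big(\mathfrak b_1+(1+\gamma)\mathfrak a_1\varepsilon^{2/\gamma}t\big)^{\frac1{\gamma+1}}$, $\tau_\varepsilon(t)=\int_0^t\frac{ds}{V_\varepsilon(s)}$, $z(t)=(\mathfrak b_1^{\gamma/(\gamma+1)}+\gamma\mathfrak a_1t)^{-1/\gamma}$, $\ell_\varepsilon(t)=\varepsilon^{2/\gamma}z(t)$, $\xi(t)=\mathfrak a_1z(t)^\gamma$, $\mathcal Q_{\varepsilon,t}=\mathcal Q_{\mathsf e_{\varepsilon,t}}$ with $\mathsf e_{\varepsilon,t}(r)=\mathsf e(\ell_\varepsilon(t)r)$, $\mathscr L_{\varepsilon,t}h=\mathcal Q_{\varepsilon,t}(\mathcal M,h)+\mathcal Q_{\varepsilon,t}(h,\mathcal M)$, $S_\varepsilon=\varepsilon^{-3}\mathcal Q_{\varepsilon,t}(\mathcal M,\mathcal M)-\varepsilon^{-1}\xi(t)\mathrm{div}_v(v\mathcal M)$. Then $F_\varepsilon$ solves $\varepsilon^2\partial_tF_\varepsilon+\varepsilon v\cdot\nabla_xF_\varepsilon=\mathcal Q_{\mathsf e}(F_\varepsilon,F_\varepsilon)$ with $F_\varepsilon(0)=F^\varepsilon_{\mathrm{in}}$ (up to the scaling by $V_\varepsilon$).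 **Initial data.** $\int F^\varepsilon_{\mathrm{in}}\,dvdx=1$, $\int vF^\varepsilon_{\mathrm{in}}\,dvdx=0$, $h_{\mathrm{in}}^\varepsilon=\varepsilon^{-1}(F^\varepsilon_{\mathrm{in}}-\mathcal M)$, and $\theta_\star$ is such that $\lim_{\varepsilon\to0}\int h_{\mathrm{in}}^\varepsilon|v|^2dvdx=0$. $\mathbb T^3$ carries the normalized measure. **Spaces.** $\varpi_s(v)=(1+|v|^2)^{s/2}$; $\|h\|_{L^1_v\mathbb W^{m,2}_x(\varpi_s)}=\sum_{j\le m}\big\|\,\|\nabla_x^jh(\cdot,v)\|_{L^2_x}\varpi_s(v)\big\|_{L^1_v}$; $\mathcal E=L^1_v\mathbb W^{m,2}_x(\varpi_q)$, $\mathcal E_1=L^1_v\mathbb W^{m,2}_x(\varpi_{q+1})$. **Well-posedness.** There are $\varepsilon_0,\alpha_0>0$ such that for $\varepsilon\in(0,\varepsilon_0)$ and $\|h_{\mathrm{in}}^\varepsilon\|_{\mathcal E}\le\alpha_0$ the equation $$\partial_t h_\varepsilon+\tfrac1\varepsilon v\cdot\nabla_x h_\varepsilon+\xi(t)\,\mathrm{div}_v(vh_\varepsilon)=\tfrac1{\varepsilon^2}\mathscr L_{\varepsilon,t}h_\varepsilon+\tfrac1\varepsilon\mathcal Q_{\varepsilon,t}(h_\varepsilon,h_\varepsilon)+S_\varepsilon(t,v),\qquad (t,x,v)\in(0,\infty)\times\mathbb T^3\times\mathbb R^3,$$ with initial condition $h_\varepsilon(0)=h^\varepsilon_{\mathrm{in}}$,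 has a unique solution $h_\varepsilon\in\mathcal C([0,\infty);\mathcal E)\cap L^1_{\mathrm{loc}}((0,\infty);\mathcal E_1)$, and $\|h_\varepsilon(t)\|_{\mathcal E}\le C(\alpha_0)(1+t)^{-1/2}$ with $C(\alpha_0)$ independent of $\varepsilon$. *)

(* Defs.v *)
From HB Require Import structures.
From mathcomp Require Import all_boot all_order all_algebra.
From mathcomp Require Import all_classical all_reals all_analysis.

Set Implicit Arguments.
Unset Strict Implicit.
Unset Printing Implicit Defensive.

Import Order.TTheory GRing.Theory Num.Theory.
Import numFieldNormedType.Exports.

Local Open Scope classical_set_scope.
Local Open Scope ring_scope.

(* The norm [`|v|] that the library puts on this product is the sup norm; the
   Euclidean norm is [enorm] below. *)
Notation vec3 R := (R * R * R)%type.

Section Euclid.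
Variable R : realType.
Implicit Types u v : vec3 R.

Definition coord (i : 'I_3) v : R := [:: v.1.1; v.1.2; v.2]`_i.

Definition basis (i : 'I_3) : vec3 R :=
  ((i == 0%N :> nat)%:R, (i == 1%N :> nat)%:R, (i == 2%N :> nat)%:R).

Definition dot u v : R := \sum_(i < 3) coord i u * coord i v.

Definition enorm v : R := Num.sqrt (dot v v).

Definition unit_vec v : vec3 R := (enorm v)^-1 *: v.

End Euclid.

(* The sigma-finite instance of [m1 \x m2] in the library is shadowed by the one
   for sub-probabilities, hence this lemma and the instance on [leb3]. *)
Lemma product_sigma_finite d1 d2 (T1 : measurableType d1)
    (T2 : measurableType d2) (R : realType)
    (m1 : {measure set T1 -> \bar R})
    (m2 : {sigma_finite_measure set T2 -> \bar R}) :
  sigma_finite setT m1 -> sigma_finite setT (m1 \x m2)%E.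
Proof.
move=> /sigma_finiteP[F [TF ndF Foo]].
have /sigma_finiteP[G [TG ndG Goo]] := sigma_finiteT m2.
exists (fun n => F n `*` G n).
  rewrite -setXTT TF TG predeqE => -[x y]; split.
    move=> [/= [n _ Fnx] [k _ Gky]]; exists (maxn n k) => //; split.
    - by move: x Fnx; exact/subsetPset/ndF/leq_maxl.
    - by move: y Gky; exact/subsetPset/ndG/leq_maxr.
  by move=> [n _ []/= ? ?]; split; exists n.
move=> k; have [? ?] := Foo k; have [? ?] := Goo k.
split; first exact: measurableX.
by rewrite product_measure1E// lte_mul_pinfty// ge0_fin_numE.
Qed.

Definition leb3 {R : realType} : set (vec3 (measurableTypeR R)) -> \bar R :=
  ((lebesgue_measure \x lebesgue_measure) \x lebesgue_measure)%E.

HB.instance Definition _ (R : realType) := Measure.on (@leb3 R).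

Lemma leb3_sigma_finite (R : realType) : sigma_finite setT (@leb3 R).
Proof.
apply: product_sigma_finite; apply: product_sigma_finite.
exact: sigma_finiteT.
Qed.

HB.instance Definition _ (R : realType) :=
  Measure_isSigmaFinite.Build _ _ _ (@leb3 R) (@leb3_sigma_finite R).

Definition leb6 {R : realType} :
    set (vec3 (measurableTypeR R) * vec3 (measurableTypeR R)) -> \bar R :=
  (leb3 \x leb3)%E.

HB.instance Definition _ (R : realType) := Measure.on (@leb6 R).

(* The torus is R^3/Z^3.  A function on it is only evaluated on the fundamental
   cell [torus_cell], whose Lebesgue measure is 1; the periodicity enters through
   the test functions and through the continuous functions on the torus. *)
Definition torus_cell {R : realType} : set (vec3 R) :=
  [set x | forall i : 'I_3, 0 <= coord i x < 1].

Definition phase {R : realType} : set (vec3 R * vec3 R) :=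
  torus_cell `*` setT.

Definition torus_periodic (R : realType) (f : vec3 R -> R) : Prop :=
  forall i : 'I_3, periodic f (basis R i).

(* Surface integral over the unit sphere, through the cone measure: in polar
   coordinates the integral of x |-> g (x / |x|) over the unit ball is one third
   of the integral of g over the sphere. *)
Definition sphere_int (R : realType) (g : vec3 R -> R) : R :=
  3%:R * \int[leb3]_(x in [set x : vec3 R | enorm x <= 1]) g (unit_vec x).

Fixpoint Ck (R : realType) (V : normedModType R) (k : nat) (f : V -> R) : Prop :=
  continuous f /\
  if k is k'.+1 then
    forall w : V, (forall x, derivable f x w) /\ Ck k' ('D_w f)
  else True.

Definition smooth (R : realType) (V : normedModType R) (f : V -> R) : Prop :=
  forall k, Ck k f.

Section Restitution.
Variable R : realType.
Implicit Types e b : R -> R.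

Definition eta e (r : R) : R := r * e r.

(* The class R_gamma.  [e] is only constrained on the nonnegative half-line;
   [a0] is the constant of the expansion of [e] at 0, which is needed later. In
   the last clause [einv] is the inverse of [eta e] on that half-line. *)
Definition restitution_class (gamma a0 : R) e : Prop :=
  (forall r, 0 <= r -> 0 < e r <= 1) /\
  (forall r, 0 < r -> derivable e r 1) /\
  (forall r s, 0 <= r -> r <= s -> e s <= e r) /\
  (forall r s, 0 <= r -> r < s -> eta e r < eta e s) /\
  (exists2 l : R, 0 <= l < 1 & e r @[r --> +oo] --> l) /\
  (0 < a0 /\ exists b0 gammabar : R, [/\ 0 < b0, 3%:R / 2%:R * gamma < gammabar &
    forall r, 0 <= r -> `|e r - 1 + a0 * r `^ gamma| <= b0 * r `^ gammabar]) /\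
  (exists alpha C : R, [/\ 0 < alpha, 0 < C &
    forall r, 0 < r ->
      C^-1 * e r `^ alpha <= derive1 (eta e) r /\
      `|derive1 (eta e) r - e r| <= C * `|1 - e r|]) /\
  (exists (m0 : R) (einv : R -> R), [/\ 0 < m0,
    (forall z, 0 <= z -> 0 <= einv z /\ eta e (einv z) = z) &
    (limf_esup (fun z => (z `^ (- m0) * einv z)%:E) (pinfty_nbhs R) < +oo)%E]).

Definition weak_derivative_interval b db : Prop :=
  forall phi : R -> R, smooth phi ->
    (exists2 c : R, c < 1 & forall s, c < `|s| -> phi s = 0) ->
  \int[lebesgue_measure]_(s in `]-1, 1[) (b s * derive1 phi s) =
  - \int[lebesgue_measure]_(s in `]-1, 1[) (db s * phi s).

(* Values of [b] outside ]-1, 1[ play no role. *)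
Definition angular_kernel b : Prop :=
  (forall s, -1 < s < 1 -> 0 <= b s) /\
  (exists db : R -> R,
    [/\ lebesgue_measure.-integrable `]-1, 1[ (EFin \o b),
        lebesgue_measure.-integrable `]-1, 1[ (EFin \o db) &
        weak_derivative_interval b db]) /\
  (forall z : vec3 R, enorm z = 1 -> sphere_int (fun sigma => b (dot z sigma)) = 1).

End Restitution.

Section Collision.
Variable R : realType.
Implicit Types (e b : R -> R) (f g psi : vec3 R -> R) (v w sigma : vec3 R).

Definition bracket (s : R) v : R := (1 + enorm v ^+ 2) `^ (s / 2%:R).

Definition post_velocity e v w sigma : vec3 R :=
  let u := v - w in
  v + ((1 + e (enorm u * Num.sqrt ((1 - dot (unit_vec u) sigma) / 2%:R))) / 4%:R)
      *: (enorm u *: sigma - u).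

(* The pairing of Q_e(g, f) with the test function psi: [f] is evaluated at v
   and [g] at v_* . *)
Definition Qweak b e g f psi : R :=
  \int[leb6]_p
    (f p.1 * g p.2 * enorm (p.1 - p.2) *
     sphere_int (fun sigma => b (dot (unit_vec (p.1 - p.2)) sigma) *
                              (psi (post_velocity e p.1 p.2 sigma) - psi p.1))).

Definition Psi e (r : R) : R :=
  r `^ (3%:R / 2%:R) / 2%:R *
  \int[lebesgue_measure]_(y in `[0, 1])
    ((1 - e (Num.sqrt r * y) ^+ 2) * y ^+ 3).

Definition weighted_integrable (s : R) f : Prop :=
  leb3.-integrable setT (fun v => (f v * bracket s v)%:E).

Definition energy_dissipation_identity (gamma : R) b : Prop :=
  forall (a0 : R) e, restitution_class gamma a0 e ->
  forall f g, weighted_integrable 3%:R f -> weighted_integrable 3%:R g ->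
  Qweak b e f g (fun v => enorm v ^+ 2) + Qweak b e g f (fun v => enorm v ^+ 2) =
  - 2%:R * \int[leb6]_p (f p.1 * g p.2 * Psi e (enorm (p.1 - p.2) ^+ 2)).

End Collision.

Section Sobolev.
Variable R : realType.
Implicit Types (h g : vec3 R * vec3 R -> R) (D : seq 'I_3 -> vec3 R * vec3 R -> R).

Definition partials (al : seq 'I_3) (phi : vec3 R -> R) : vec3 R -> R :=
  foldr (fun i psi => 'D_(basis R i) psi) phi al.

(* [g] is the weak derivative of [h] in x on the torus, in the directions [al];
   for [al = [::]] this says that [g = h] almost everywhere. *)
Definition weak_dx (al : seq 'I_3) h g : Prop :=
  {ae leb3, forall v,
    [/\ leb3.-integrable torus_cell (fun x => (h (x, v))%:E),
        leb3.-integrable torus_cell (fun x => (g (x, v))%:E) &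
        forall phi : vec3 R -> R, smooth phi -> torus_periodic phi ->
          \int[leb3]_(x in torus_cell) (h (x, v) * partials al phi x) =
          (-1) ^+ size al * \int[leb3]_(x in torus_cell) (g (x, v) * phi x)]}.

Definition gradients (m : nat) h D : Prop :=
  forall al : seq 'I_3, (size al <= m)%N ->
    measurable_fun phase (D al) /\ weak_dx al h (D al).

(* The norm of the j-th gradient tensor, in L^2_x, at velocity v. *)
Definition grad_L2 D (j : nat) (v : vec3 R) : \bar R :=
  sqrte (\int[leb3]_(x in torus_cell)
           (\sum_(al : j.-tuple 'I_3) D al (x, v) ^+ 2)%:E)%E.

(* The weighted norm of [h].  Weak derivatives being unique almost everywhere,
   the infimum is over a single value, or over the empty set (and then equals
   +oo) when [h] is not measurable or lacks weak derivatives. *)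
Definition sob_norm (m : nat) (s : R) h : \bar R :=
  ereal_inf [set N | measurable_fun phase h /\
    exists2 D, gradients m h D &
      N = (\sum_(j < m.+1) \int[leb3]_v (grad_L2 D j v * (bracket s v)%:E))%E].

Definition eq_ae h g : Prop := {ae leb6, forall p, phase p -> h p = g p}.

(* Membership in C([0, +oo); E) and in L^1_loc((0, +oo); E_1), where
   E = L^1_v W^{m,2}_x(bracket q) and E_1 carries the weight bracket (q + 1). *)
Definition solution_space (m : nat) (q : R) (h : R -> vec3 R * vec3 R -> R) :=
  [/\ forall t, 0 <= t -> (sob_norm m q (h t) < +oo)%E,
      forall t, 0 <= t ->
        sob_norm m q (fun p => h s p - h t p)
          @[s --> within [set s | 0 <= s] (nbhs t)] --> (0 : \bar R) &
      forall a c, 0 < a -> a < c ->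
        (\int[lebesgue_measure]_(t in `[a, c]) sob_norm m (q + 1) (h t)
           < +oo)%E].

End Sobolev.

Section Model.
Variable R : realType.
Variables (gamma a0 : R) (e b : R -> R) (theta b1 : R).

Definition maxwellian (th : R) (v : vec3 R) : R :=
  (2%:R * pi * th) `^ (- (3%:R / 2%:R)) * expR (- (enorm v ^+ 2 / (2%:R * th))).

Definition Kgamma : R :=
  \int[leb3]_v (maxwellian 1 v * enorm v `^ (3%:R + gamma)).

Definition a1 : R :=
  a0 * Kgamma / (3%:R * (4%:R + gamma)) *
  (2%:R * theta) `^ ((1 + gamma) / 2%:R).

Definition Vscale (eps t : R) : R :=
  eps `^ (- (2%:R / gamma)) *
  (b1 + (1 + gamma) * a1 * eps `^ (2%:R / gamma) * t) `^ (gamma + 1)^-1.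

Definition tau (eps t : R) : R :=
  \int[lebesgue_measure]_(s in `[0, t]) (Vscale eps s)^-1.

Definition zfun (t : R) : R :=
  (b1 `^ (gamma / (gamma + 1)) + gamma * a1 * t) `^ (- gamma^-1).

Definition ell (eps t : R) : R := eps `^ (2%:R / gamma) * zfun t.

Definition xi (t : R) : R := a1 * zfun t `^ gamma.

Definition resc_e (eps t : R) (r : R) : R := e (ell eps t * r).

Implicit Types k Phi : vec3 R * vec3 R -> R.

Definition Mx (p : vec3 R * vec3 R) : R := maxwellian theta p.2.

Definition pairing k Phi : R := \int[leb6]_(p in phase) (k p * Phi p).

Definition Qpairing (eps t : R) (g f : vec3 R * vec3 R -> R) Phi : R :=
  \int[leb3]_(x in torus_cell)
    Qweak b (resc_e eps t) (fun v => g (x, v)) (fun v => f (x, v))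
          (fun v => Phi (x, v)).

Definition Lpairing (eps t : R) k Phi : R :=
  Qpairing eps t Mx k Phi + Qpairing eps t k Mx Phi.

(* Test functions are written phi (t, (x, v)). *)
Implicit Types phi : R * (vec3 R * vec3 R) -> R.

Definition test_function phi : Prop :=
  [/\ smooth phi,
      forall t v, torus_periodic (fun x => phi (t, (x, v))) &
      exists t0 t1 r : R, [/\ 0 < t0, t0 < t1 &
        forall t x v, ~ (t0 <= t <= t1 /\ enorm v <= r) -> phi (t, (x, v)) = 0]].

Definition dt phi (t : R) (p : vec3 R * vec3 R) : R :=
  'D_((1, (0, 0)) : R * (vec3 R * vec3 R)) phi (t, p).

Definition v_gradx phi (t : R) (p : vec3 R * vec3 R) : R :=
  \sum_(i < 3) coord i p.2 *
    'D_((0, (basis R i, 0)) : R * (vec3 R * vec3 R)) phi (t, p).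

Definition v_gradv phi (t : R) (p : vec3 R * vec3 R) : R :=
  \sum_(i < 3) coord i p.2 *
    'D_((0, (0, basis R i)) : R * (vec3 R * vec3 R)) phi (t, p).

(* The pairing of the source term S_eps(t) with phi(t); the divergence in
   div_v(v M) is moved to phi. *)
Definition source_pairing (eps t : R) phi : R :=
  eps ^- 3 * Qpairing eps t Mx Mx (fun p => phi (t, p)) +
  eps^-1 * xi t * pairing Mx (v_gradv phi t).

(* The equation for h_eps in the sense of distributions on
   (0, +oo) x T^3 x R^3: all derivatives are moved to phi. *)
Definition perturbation_equation (eps : R) (h : R -> vec3 R * vec3 R -> R) :=
  forall phi, test_function phi ->
  \int[lebesgue_measure]_(t in `]0, +oo[)
    (pairing (h t) (dt phi t) +
     eps^-1 * pairing (h t) (v_gradx phi t) +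
     xi t * pairing (h t) (v_gradv phi t) +
     eps ^- 2 * Lpairing eps t (h t) (fun p => phi (t, p)) +
     eps^-1 * Qpairing eps t (h t) (h t) (fun p => phi (t, p)) +
     source_pairing eps t phi) = 0.

Definition is_solution (m : nat) (q eps : R) (hin : vec3 R * vec3 R -> R)
    (h : R -> vec3 R * vec3 R -> R) : Prop :=
  [/\ solution_space m q h, eq_ae (h 0) hin & perturbation_equation eps h].

Definition h_init (Fin : R -> vec3 R * vec3 R -> R) (eps : R)
    (p : vec3 R * vec3 R) : R := eps^-1 * (Fin eps p - Mx p).

Definition initial_data (eps0 : R) (Fin : R -> vec3 R * vec3 R -> R) : Prop :=
  (forall eps, 0 < eps < eps0 ->
    [/\ leb6.-integrable phase
          (fun p => (Fin eps p * (1 + enorm p.2 ^+ 2))%:E),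
        \int[leb6]_(p in phase) Fin eps p = 1 &
        forall i, \int[leb6]_(p in phase) (coord i p.2 * Fin eps p) = 0]) /\
  \int[leb6]_(p in phase) (h_init Fin eps p * enorm p.2 ^+ 2)
    @[eps --> 0^'+] --> (0 : R).

(* The well-posedness result, with thresholds eps0 and alpha0 and with the
   constant C0 = C(alpha0). *)
Definition well_posed (m : nat) (q eps0 alpha0 C0 : R)
    (Fin : R -> vec3 R * vec3 R -> R) : Prop :=
  forall eps, 0 < eps < eps0 ->
  (sob_norm m q (h_init Fin eps) <= alpha0%:E)%E ->
  exists h, [/\ is_solution m q eps (h_init Fin eps) h,
    forall h', is_solution m q eps (h_init Fin eps) h' ->
      forall t, 0 <= t -> eq_ae (h' t) (h t) &
    forall t, 0 <= t ->
      (sob_norm m q (h t) <= (C0 * (1 + t) `^ (- 2%:R^-1))%:E)%E].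

Definition f_eps (eps : R) (h : R -> vec3 R * vec3 R -> R) (t : R)
    (p : vec3 R * vec3 R) : R := Mx p + eps * h t p.

Definition F_eps (eps : R) (h : R -> vec3 R * vec3 R -> R) (t : R)
    (p : vec3 R * vec3 R) : R :=
  Vscale eps t ^+ 3 * f_eps eps h (tau eps t) (p.1, Vscale eps t *: p.2).

Definition local_temperature (eps : R) (h : R -> vec3 R * vec3 R -> R)
    (t : R) (x : vec3 R) : R :=
  \int[leb3]_v (F_eps eps h t (x, v) * enorm v ^+ 2).

Definition global_temperature (eps : R) (h : R -> vec3 R * vec3 R -> R)
    (t : R) : R :=
  \int[leb6]_(p in phase) (F_eps eps h t p * enorm p.2 ^+ 2).

Definition haff_rate (eps t : R) : R :=
  eps `^ (4%:R / (gamma + 1)) *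
  (eps `^ (- (2%:R / gamma)) + t) `^ (- (2%:R / (gamma + 1))).

End Model.

(* [T] is defined almost everywhere on the torus; [is_continuous_version T Tc]
   says that the continuous function [Tc] on the torus represents it. *)
Definition is_continuous_version (R : realType) (T Tc : vec3 R -> R) : Prop :=
  [/\ continuous Tc, torus_periodic Tc &
      {ae leb3, forall x, torus_cell x -> T x = Tc x}].

(* Main.v *)
(* The temperatures are those of the Maxwellian plus those of the perturbation
   [eps * h], divided by [V_eps ^ 2], which is comparable with the inverse of
   Haff's rate.  So it is enough to bound the energy x |-> int h |v|^2 dv
   uniformly in x, and to find a continuous representative of it.  By uniqueness
   [h] has the a priori bound of the well-posedness result, so this is an
   embedding L^1_v W^{2,2}_x(|v|^2) in C^0_x.

   It is proved with the kernels K_n = c_n cos(pi z) ^ (2 n) of mean 1 on the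
   circle.  They satisfy the exact discrete heat equation
   K_n - K_{n+1} = K_{n+1}'' / (4 pi^2 (n+1)^2).  Changing the index of the
   product kernel on T^3 one coordinate at a time and integrating by parts twice,
   two consecutive convolutions of a slice h(., v) differ by at most
   ||K_n||_2^3 / n^2 ~ n^(3/4 - 2) times the norm of its second derivatives.  This
   is summable, so the convolutions of the energy converge uniformly, and their
   limit is almost everywhere the energy. *)
Require Import Defs.
From HB Require Import structures.
From mathcomp Require Import all_boot all_order all_algebra.
From mathcomp Require Import all_classical all_reals all_analysis.
From mathcomp Require Import measurable_realfun.
From mathcomp Require Import zify ring lra.

Set Implicit Arguments.
Unset Strict Implicit.
Unset Printing Implicit Defensive.

Import Order.TTheory GRing.Theory Num.Theory.
Import numFieldNormedType.Exports.

Local Open Scope classical_set_scope.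
Local Open Scope ring_scope.

Local Notation coord := Defs.coord.
Local Notation basis := Defs.basis.

(** * Smooth periodic test functions *)

(** What is known of the weak derivatives of h shapes the proof: they are given slice by slice, for
    almost every v, and only through pairings with smooth periodic functions of x. So the kernel y
    |-> K_n(x - y) must itself be a test function, and K_n - K_{n+1} must be an exact second
    derivative of test functions. Powers of cosines achieve both by algebra alone, and changing one
    coordinate at a time leaves only the pure derivatives in the directions i, i.

    Two integrations by parts are needed: a single one would leave a derivative on the kernel, hence
    terms of order n^(1/2 + 3/4 - 2), which are not summable. This is where the integer m > 3/2,
    that is m >= 2, enters. The slice estimates are integrated in v against |v|^2 by Fubini only
    afterwards.

    Since K_0 = 1, the first convolution is the mean over the torus, bounded by the norm of order 0.
    The later steps add at most 48 = 3 * 16 times the norm of order 2: three coordinates, and 16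
    from the telescoping bound on the kernels. Hence the constant 49 = 1 + 48 in the bounds on the
    energy. *)

Lemma coordD (R : realType) (i : 'I_3) : {morph @coord R i : u v / u + v}.
Proof. by case: i => -[|[|[|]]]. Qed.

Lemma coordZ (R : realType) (i : 'I_3) (a : R) v :
  coord i (a *: v) = a * coord i v.
Proof. by case: i => -[|[|[|]]]. Qed.

Lemma coord_continuous (R : realType) (i : 'I_3) : continuous (@coord R i).
Proof.
case: i => -[|[|[|//]]] ? v /=; rewrite /coord /=.
- exact: (cvg_comp _ _ cvg_fst cvg_fst).
- exact: (cvg_comp _ _ cvg_fst cvg_snd).
- exact: cvg_snd.
Qed.

Lemma coord_basis (R : realType) (i j : 'I_3) : coord i (basis R j) = (i == j)%:R.
Proof. by case: i j => -[|[|[|//]]] ? [] [|[|[|//]]] ?. Qed.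

Lemma coord_lip (R : realType) (i : 'I_3) (u : vec3 R) : `|coord i u| <= `|u|.
Proof.
case: i => -[|[|[|//]]] ?; rewrite /coord /= !prod_normE /= !le_max ?lexx ?orbT //.
Qed.

(** Along the line [h *: w + y] the argument moves by [- coord i w] times [h], so the difference
    quotient is that of [f] alone. *)
Lemma is_derive_coord (R : realType) (f : R -> R) (a df : R) (i : 'I_3)
    (y w : vec3 R) :
  is_derive (a - coord i y) 1 f df ->
  is_derive y w (fun y => f (a - coord i y)) (- (coord i w * df)).
Proof.
move=> fd.
have [/derivable1_diffP fdiff fE] := fd.
have : is_derive (a - coord i y) (- coord i w) f (- (coord i w * df)).
  split; first exact: diff_derivable.
  rewrite deriveE // (_ : - coord i w = (- coord i w) *: 1); last first.
    by rewrite /GRing.scale /= mulr1.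
  by rewrite linearZ /= -deriveE // fE /GRing.scale /= mulNr.
have E h : h *: (- coord i w) + (a - coord i y) = a - coord i (h *: w + y).
  by rewrite coordD coordZ /GRing.scale /= mulrN addrCA -opprD.
move=> [df1 df2]; split.
  move: df1; rewrite /derivable; under eq_fun do rewrite /= E; exact.
move: df2; rewrite /derive; under eq_fun do rewrite /= E; exact.
Qed.

(* Closed under differentiation, hence consisting of smooth functions. *)
Inductive trigonometric (R : realType) : (vec3 R -> R) -> Prop :=
| trig_cst (k : R) : trigonometric (fun=> k)
| trig_cos (a : R) i : trigonometric (fun y => cos (pi * (a - coord i y)))
| trig_sin (a : R) i : trigonometric (fun y => sin (pi * (a - coord i y)))
| trig_add f g : trigonometric f -> trigonometric g -> trigonometric (f + g)
| trig_mul f g : trigonometric f -> trigonometric g -> trigonometric (f * g).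

Lemma is_derive_cospi (R : realType) (x : R) :
  is_derive x 1 (fun x => cos (pi * x)) (- (pi * sin (pi * x))).
Proof.
have -> : (fun x : R => cos (pi * x)) = cos \o (pi *: id).
  by apply/funext => z /=.
apply: is_derive_eq; rewrite /GRing.scale /= mulr1; ring.
Qed.

Lemma is_derive_sinpi (R : realType) (x : R) :
  is_derive x 1 (fun x => sin (pi * x)) (pi * cos (pi * x)).
Proof.
have -> : (fun x : R => sin (pi * x)) = sin \o (pi *: id).
  by apply/funext => z /=.
apply: is_derive_eq; rewrite /GRing.scale /= mulr1; ring.
Qed.

Lemma trigonometric_derive (R : realType) (f : vec3 R -> R) :
  trigonometric f -> forall w, exists2 df, trigonometric df &
    forall y, is_derive y w f (df y).
Proof.
have trig_scale k f' : trigonometric f' -> trigonometric (k *: f').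
  by move=> tf; exact: (trig_mul (trig_cst k) tf).
elim=> [k|a i|a i|{}f g tf IHf tg IHg|{}f g tf IHf tg IHg] w.
- by exists (cst 0); [exact: trig_cst|move=> y; exact: is_derive_cst].
- exists ((coord i w * pi) *: (fun y => sin (pi * (a - coord i y)))).
    exact/trig_scale/trig_sin.
  move=> y.
  rewrite (_ : _ y = - (coord i w * - (pi * sin (pi * (a - coord i y))))).
    exact: (is_derive_coord _ (is_derive_cospi _)).
  by rewrite fctE /GRing.scale /=; ring.
- exists ((- coord i w * pi) *: (fun y => cos (pi * (a - coord i y)))).
    exact/trig_scale/trig_cos.
  move=> y.
  rewrite (_ : _ y = - (coord i w * (pi * cos (pi * (a - coord i y))))).
    exact: (is_derive_coord _ (is_derive_sinpi _)).
  by rewrite fctE /GRing.scale /=; ring.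
- have [df tdf df'] := IHf w; have [dg tdg dg'] := IHg w.
  by exists (df + dg); [exact: trig_add|move=> y; exact: is_deriveD].
- have [df tdf df'] := IHf w; have [dg tdg dg'] := IHg w.
  exists (f * dg + g * df).
    by apply: trig_add; exact: trig_mul.
  by move=> y; exact: is_deriveM.
Qed.

Lemma trigonometric_continuous (R : realType) (f : vec3 R -> R) :
  trigonometric f -> continuous f.
Proof.
have c (a : R) (i : 'I_3) : continuous (fun y => pi * (a - coord i y)).
  move=> y; apply: cvgM; first exact: cvg_cst.
  by apply: cvgB; [exact: cvg_cst|exact: coord_continuous].
elim=> [k|a i|a i|{}f g tf IHf tg IHg|{}f g tf IHf tg IHg] y.
- exact: cvg_cst.
- by apply: (continuous_comp (c a i _)); exact: continuous_cos.
- by apply: (continuous_comp (c a i _)); exact: continuous_sin.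
- by apply: cvgD; [exact: IHf|exact: IHg].
- by apply: cvgM; [exact: IHf|exact: IHg].
Qed.

Lemma trigonometric_smooth (R : realType) (f : vec3 R -> R) :
  trigonometric f -> smooth f.
Proof.
move=> tf k; elim: k f tf => [|k IH] f tf; split=> //;
  first exact: trigonometric_continuous.
  exact: trigonometric_continuous.
move=> w; have [df tdf fdf] := trigonometric_derive tf w; split=> [x|].
  by have [] := fdf x.
suff -> : 'D_w f = df by exact: IH.
by apply/funext => y; apply: derive_val.
Qed.

(** The factors are left arbitrary so that a partial derivative of such a product is again one;
    second derivatives then come from applying [derive_tens] twice. *)
Definition tens (R : realType) (F : 'I_3 -> R -> R) (x y : vec3 R) : R :=
  \prod_(j < 3) F j (coord j x - coord j y).

Definition upd (R : realType) (F : 'I_3 -> R -> R) (i : 'I_3) (g : R -> R) :=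
  fun j => if j == i then g else F j.

(** The derivative is in [y] while the factors are functions of [x - y], hence the minus sign. In
    the product rule the terms of the other factors carry [coord j (basis R i) = 0]. *)
Lemma derive_tens (R : realType) (F : 'I_3 -> R -> R) (i : 'I_3) (dF : R -> R) (x : vec3 R) :
  (forall z : R, is_derive z 1 (F i) (dF z)) ->
  (forall j (z : R), j != i -> derivable (F j) z 1) ->
  'D_(basis R i) (tens F x) = tens (upd F i (fun z => - dF z)) x.
Proof.
move=> Fi Fj; apply/funext => y.
have d j : exists2 D, is_derive y (basis R i)
    (fun y => F j (coord j x - coord j y)) D & D = - ((i == j)%:R * upd F i dF j (coord j x - coord j y)).
  rewrite /upd eq_sym; have [->|ji] := eqVneq j i.
    eexists; last reflexivity.
    by have := is_derive_coord (basis R i) (Fi (coord i x - coord i y)); rewrite coord_basis eqxx.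
  eexists; last reflexivity.
  rewrite (_ : 0%:R * _ = (coord j (basis R i)) * 'D_1 (F j) (coord j x - coord j y)).
    exact: (is_derive_coord _ (derivableP (Fj _ _ ji))).
  by rewrite coord_basis (negbTE ji) !mul0r.
have -> : tens F x = (fun y => F ord0 (coord ord0 x - coord ord0 y)) *
   (fun y => F (lift ord0 ord0) (coord (lift ord0 ord0) x - coord (lift ord0 ord0) y)) *
   (fun y => F (lift ord0 (lift ord0 ord0)) (coord (lift ord0 (lift ord0 ord0)) x - coord (lift ord0 (lift ord0 ord0)) y)).
  by apply/funext => z; rewrite /tens !big_ord_recl big_ord0 mulr1 /= mulrA.
have [D0 h0 e0] := d ord0.
have [D1 h1 e1] := d (lift ord0 ord0).
have [D2 h2 e2] := d (lift ord0 (lift ord0 ord0)).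
rewrite (@derive_val _ _ _ _ _ _ _ (is_deriveM (is_deriveM h0 h1) h2)).
rewrite e0 e1 e2 {e0 e1 e2 D0 D1 D2 h0 h1 h2 d}.
rewrite /tens !big_ord_recl big_ord0 mulr1 /GRing.scale /= /upd.
have [->|->|->] : [\/ i = ord0, i = lift ord0 ord0 | i = lift ord0 (lift ord0 ord0)].
  case: {Fi Fj}i => -[|[|[|//]]] ?; [apply: Or31|apply: Or32|apply: Or33];
    exact: val_inj.
all: by rewrite fctE !eqE /=; ring.
Qed.

Lemma exprfctE (R : realType) (T : Type) (f : T -> R) k t :
  (f ^+ k) t = f t ^+ k.
Proof. by elim: k => // k IH; rewrite !exprS -IH. Qed.

(** * The kernels on the circle *)

Section vallee_poussin.
Variable R : realType.
Implicit Types (n : nat) (x y z : R).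

(* Wallis' constants: with them the kernels [vp n] have mean 1 on the circle. *)
Definition vpc n : R := \prod_(k < n) ((k.+1).*2%:R / (k.*2.+1)%:R).

(** The de la Vallee-Poussin kernel of R/Z: the exponent is even, which gives it period 1 and makes
    it nonnegative. *)
Definition vp n z : R := vpc n * cos (pi * z) ^+ n.*2.

(** At [n = 0] the exponent [.-1] is truncated, which is harmless as the factor [n.*2%:R]
    vanishes. *)
Definition dvp n z : R :=
  - (vpc n * n.*2%:R * pi * cos (pi * z) ^+ n.*2.-1 * sin (pi * z)).

Lemma vpcS n : vpc n.+1 = vpc n * ((n.+1).*2%:R / (n.*2.+1)%:R).
Proof. by rewrite /vpc big_ord_recr. Qed.

Lemma vpc_gt0 n : 0 < vpc n.
Proof. by apply: prodr_gt0 => k _; rewrite divr_gt0 ?ltr0n ?double_gt0. Qed.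

Lemma vpc_leS n : vpc n <= vpc n.+1.
Proof.
rewrite vpcS ler_peMr ?(ltW (vpc_gt0 n))// ler_pdivlMr ?ltr0n// mul1r ler_nat.
by rewrite doubleS.
Qed.

Lemma vpc_le m n : (m <= n)%N -> vpc m <= vpc n.
Proof.
move: m n; apply: (homo_leq (r := fun a b : R => a <= b)) => [a|a b c|k].
- exact: lexx.
- exact: le_trans.
- exact: vpc_leS.
Qed.

(** The explicit form of the growth c_n ~ sqrt(pi n) that is used below. The induction step amounts
    to 4 (n+1) (n+2) <= (2n+3)^2. *)
Lemma vpc_sqr n : vpc n.+1 ^+ 2 <= 4 * n.+1%:R.
Proof.
elim: n => [|n IH].
  by rewrite vpcS /vpc big_ord0 mul1r divr1 -natrX -natrM ler_nat.
rewrite vpcS exprMn; apply: le_trans (ler_wpM2r _ IH) _; first exact: sqr_ge0.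
rewrite expr_div_n mulrA ler_pdivrMr ?exprn_gt0 ?ltr0n//.
rewrite -!natrX -!natrM ler_nat -!muln2; nia.
Qed.

Lemma is_derive_vp n z : is_derive z 1 (vp n) (dvp n z).
Proof.
have -> : vp n = vpc n *: ((fun z => cos (pi * z)) ^+ n.*2).
  by apply/funext => t; rewrite -[RHS]/(_ * (_ ^+ _) _) exprfctE.
have h := is_derive_cospi z.
apply: is_derive_eq.
rewrite /dvp /GRing.scale /=; ring.
Qed.

(** The discrete heat equation. With N = n+1, the second derivative of cos(pi z)^(2N) is pi^2 times
    2N (2N-1) cos^(2N-2) - (2N)^2 cos^(2N). The recurrence c_N (2N-1) = 2N c_n of Wallis' constants
    turns the first coefficient into (2N)^2 c_n. *)
Lemma is_derive_dvp n z :
  is_derive z 1 (dvp n.+1) (4 * pi ^+ 2 * n.+1%:R ^+ 2 * (vp n z - vp n.+1 z)).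
Proof.
have -> : dvp n.+1 = (- (vpc n.+1 * (n.+1).*2%:R * pi)) *:
    ((fun z => cos (pi * z)) ^+ n.*2.+1 * (fun z => sin (pi * z))).
  apply/funext => t.
  rewrite -[RHS]/(- _ * (((fun z => cos (pi * z)) ^+ n.*2.+1) t * sin (pi * t))).
  by rewrite exprfctE /dvp mulNr mulrA.
have h := is_derive_cospi z; have h' := is_derive_sinpi z.
apply: is_derive_eq.
rewrite /vp vpcS doubleS /GRing.scale /=.
have : sin (pi * z) * sin (pi * z) = 1 - cos (pi * z) ^+ 2.
  by rewrite -expr2 -(cos2Dsin2 (pi * z)); ring.
rewrite exprfctE !exprS.
have -> : n.*2.+2%:R = 2 * n.+1%:R :> R by rewrite -doubleS -muln2 natrM mulrC.
have -> : n.*2.+1%:R = 2 * n.+1%:R - 1 :> R.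
  by rewrite -natr1 -muln2 natrM -natr1; ring.
have : 2 * n.+1%:R - 1 != 0 :> R.
  by rewrite subr_eq0 -natrM pnatr_eq1; lia.
move: (n.+1%:R) (cos _) (sin _) => N c s N0 s2.
rewrite (_ : s * _ = (2 * N - 1) * (c ^+ n.*2) * - pi * (s * s)); last by ring.
by rewrite s2; field.
Qed.

Lemma cos_piD1 z : cos (pi * (z + 1)) = - cos (pi * z).
Proof. by rewrite mulrDr mulr1 cosDpi. Qed.

Lemma sin_piD1 z : sin (pi * (z + 1)) = - sin (pi * z).
Proof. by rewrite mulrDr mulr1 sinDpi. Qed.

Lemma vpD1 n z : vp n (z + 1) = vp n z.
Proof. by rewrite /vp cos_piD1 exprNn -signr_odd odd_double mul1r. Qed.

Lemma dvpD1 n z : dvp n.+1 (z + 1) = dvp n.+1 z.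
Proof.
rewrite /dvp cos_piD1 sin_piD1 exprNn -signr_odd /= odd_double /= expr1; ring.
Qed.

Lemma vpN n z : vp n (- z) = vp n z.
Proof. by rewrite /vp mulrN cosN. Qed.

Lemma vp_ge0 n z : 0 <= vp n z.
Proof.
by rewrite /vp mulr_ge0 ?(ltW (vpc_gt0 n))// -mul2n exprM exprn_ge0 ?sqr_ge0.
Qed.

Lemma vp_le n z : vp n z <= vpc n.
Proof.
by rewrite /vp ler_piMr ?(ltW (vpc_gt0 n))// -mul2n exprM exprn_ile1 ?sqr_ge0//.
Qed.

Lemma continuous_vp n : continuous (vp n).
Proof.
by move=> z; apply/differentiable_continuous/derivable1_diffP; have [] := is_derive_vp n z.
Qed.

(** The square is again a kernel up to a constant, so that its L^2 norm is known from the mean of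
    [vp n.*2]. *)
Lemma vp_sqr n z : vp n z ^+ 2 = vpc n ^+ 2 / vpc n.*2 * vp n.*2 z.
Proof.
rewrite /vp exprMn mulrA divfK ?gt_eqF ?vpc_gt0// -exprM.
by congr (_ * _ ^+ _); rewrite -!muln2.
Qed.

(** Multiplying by cos^2 gives the next kernel up to a constant. As sin(pi z)^2 measures the
    distance of z to the integers, the mean of the left-hand side plays the part of a variance. *)
Lemma vp_sin2 n z :
  vp n z * sin (pi * z) ^+ 2 = vp n z - (n.*2.+1%:R / (n.+1).*2%:R) * vp n.+1 z.
Proof.
rewrite sin2cos2 /vp vpcS doubleS !exprS.
field.
by rewrite nat1r -(natrD _ 2) !pnatr_eq0.
Qed.

Local Notation mu := lebesgue_measure.

Lemma integrable_vp01 n x : mu.-integrable `[0, 1[ (fun y => (vp n (x - y))%:E).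
Proof.
apply: (@integrableS _ _ _ mu `[0, 1]) => //.
  by apply: subset_itv => //; rewrite bnd_simp.
apply: continuous_compact_integrable; first exact: segment_compact.
apply: continuous_subspaceT => y.
apply: (@continuous_comp _ _ _ (fun y => x - y) (vp n)).
  by apply: (@cvgB _ R); [exact: cvg_cst|exact: cvg_id].
exact: continuous_vp.
Qed.

(** By the discrete heat equation two consecutive kernels differ by the derivative of a function of
    period 1, so all of them have the mean of [vp 0], which is the constant 1. *)
Lemma integral_vp n x : (\int[mu]_(y in `[0%R, 1%R[) (vp n (x - y))%:E = 1)%E.
Proof.
elim: n => [|n IH].
  under eq_integral do rewrite /vp double0 expr0 mulr1 /vpc big_ord0.
  by rewrite integral_cst//= lebesgue_measure_itv/= lte_fin ltr01 mul1e oppr0 adde0.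
pose K : R := 4 * pi ^+ 2 * n.+1%:R ^+ 2.
have K0 : K != 0 by rewrite !mulf_neq0 ?expf_neq0 ?gt_eqF ?pi_gt0// pnatr_eq0.
suff : (\int[mu]_(y in `[0%R, 1%R[) (vp n (x - y) - vp n.+1 (x - y))%:E = 0)%E.
  under eq_integral do rewrite EFinB.
  rewrite integralB_EFin//; [|exact: integrable_vp01|exact: integrable_vp01].
  have : (\int[mu]_(y in `[0%R, 1%R[) (vp n.+1 (x - y))%:E)%E \is a fin_num.
    by apply: integrable_fin_num => //; exact: integrable_vp01.
  rewrite IH => /fineK <-; rewrite -EFinB => -[] /eqP.
  by rewrite subr_eq0 => /eqP <-.
have cxy : continuous (fun y : R => x - y).
  by move=> y; apply: (@cvgB _ R); [exact: cvg_cst|exact: cvg_id].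
pose F y := - (K^-1 * dvp n.+1 (x - y)).
have dF y : is_derive y 1 F (vp n (x - y) - vp n.+1 (x - y)).
  rewrite (_ : F = (- K^-1) *: (dvp n.+1 \o (fun y => x - y))); last first.
    by apply/funext => t; rewrite /F /= -mulNr.
  have h := is_derive_dvp n (x - y).
  have h2 : is_derive y 1 (fun y => x - y) (- 1 : R).
    by rewrite -[- 1]sub0r; exact: (is_deriveB (f := cst x) (g := id)).
  have h3 := @is_derive1_comp _ (dvp n.+1) (fun y => x - y) y _ _ h h2.
  by apply: is_derive_eq; rewrite -/K /GRing.scale /= mulrN1 mulrN mulNr opprK mulKf.
have cd : continuous (fun y => vp n (x - y) - vp n.+1 (x - y)).
  move=> y; apply: (@cvgB _ R).
    exact: (continuous_comp (cxy y) (@continuous_vp n _)).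
  exact: (continuous_comp (cxy y) (@continuous_vp n.+1 _)).
have cF : continuous F.
  by move=> y; apply/differentiable_continuous/derivable1_diffP; have [] := dF y.
rewrite integral_itv_bndo_bndc; last first.
  apply/measurable_EFinP; apply: measurable_funTS.
  exact: (continuous_measurable_fun cd).
apply: (etrans (continuous_FTC2 (F := F) ltr01 _ _ _)).
- exact: continuous_subspaceT.
- split=> [y _||]; first by have [] := dF y.
  + exact/cvg_at_right_filter/cF.
  + exact/cvg_at_left_filter/cF.
- by move=> y _; rewrite derive1E; apply: derive_val.
rewrite /F -EFinB subr0 (_ : dvp n.+1 x = dvp n.+1 (x - 1)) ?subrr//.
by rewrite -[in LHS](subrK 1 x) dvpD1.
Qed.

(** The integral is c_n^2 / c_{2n}, and c_n <= c_{2n}. *)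
Lemma integral_vp_sqr n x :
  (\int[mu]_(y in `[0%R, 1%R[) (vp n (x - y) ^+ 2)%:E <= (vpc n)%:E)%E.
Proof.
under eq_integral do rewrite vp_sqr EFinM.
rewrite integralZl//; last exact: integrable_vp01.
rewrite integral_vp mule1 lee_fin ler_pdivrMr ?vpc_gt0// expr2.
by rewrite ler_wpM2l ?(ltW (vpc_gt0 n))// vpc_le// -addnn leq_addr.
Qed.

Lemma integral_vp_sin2 n x :
  (\int[mu]_(y in `[0%R, 1%R[) (vp n (x - y) * sin (pi * (x - y)) ^+ 2)%:E =
   ((n.+1).*2%:R^-1)%:E)%E.
Proof.
under eq_integral do rewrite vp_sin2 EFinB.
have i2 : mu.-integrable `[0, 1[
    (fun y => ((n.*2.+1)%:R / (n.+1).*2%:R * vp n.+1 (x - y))%:E).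
  under [X in integrable _ _ X]eq_fun do rewrite EFinM.
  by apply: integrableZl => //; exact: integrable_vp01.
rewrite (integralB _ (integrable_vp01 n x) i2)//.
under [X in (_ - X)%E]eq_integral do rewrite EFinM.
rewrite integralZl//; last exact: integrable_vp01.
rewrite !integral_vp mule1 -EFinB; congr EFin.
have d0 : (n.+1).*2%:R != 0 :> R by rewrite pnatr_eq0.
apply: (mulfI d0); rewrite mulrBr mulr1 mulrCA divff// mulr1.
by rewrite doubleS -[X in X - _]natr1 addrC addKr.
Qed.

(* Chebyshev's inequality: the kernel concentrates at the integers. *)
Lemma vp_tail n x (S : set R) (s : R) : 0 < s -> measurable S ->
  S `<=` `[0, 1[ -> (forall y, S y -> s <= sin (pi * (x - y)) ^+ 2) ->
  (\int[mu]_(y in S) (vp n (x - y))%:E <= (s^-1 * (n.+1).*2%:R^-1)%:E)%E.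
Proof.
move=> s0 mS S01 sS.
have mv : measurable_fun setT (fun y : R => vp n (x - y)).
  apply: continuous_measurable_fun => y.
  apply: (@continuous_comp _ _ _ (fun y => x - y) (vp n)).
    by apply: (@cvgB _ R); [exact: cvg_cst|exact: cvg_id].
  exact: continuous_vp.
have ms : measurable_fun setT (fun y : R => sin (pi * (x - y)) ^+ 2).
  apply: measurable_funX; apply: continuous_measurable_fun => y.
  apply: (@continuous_comp _ _ _ (fun y => pi * (x - y)) sin).
    apply: cvgM; first exact: cvg_cst.
    by apply: (@cvgB _ R); [exact: cvg_cst|exact: cvg_id].
  exact: continuous_sin.
rewrite EFinM -(integral_vp_sin2 n x) -ge0_integralZl//=.
- apply: (@le_trans _ _ (\int[mu]_(y in S) (s^-1%:E * (vp n (x - y) * sin (pi * (x - y)) ^+ 2)%:E))%E).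
    apply: ge0_le_integral => //=.
    + by move=> y _; rewrite lee_fin vp_ge0.
    + exact/measurable_EFinP/measurable_funTS.
    + apply/measurable_EFinP/measurable_funTS.
      by apply: measurable_funM => //; exact: measurable_funM.
    + move=> y Sy; rewrite -EFinM lee_fin ler_pdivlMl// mulrC ler_wpM2l ?vp_ge0//.
      exact: sS.
  apply: ge0_subset_integral => //=.
  + apply/measurable_EFinP/measurable_funTS.
    by apply: measurable_funM => //; exact: measurable_funM.
  + move=> y _; apply: mule_ge0; rewrite lee_fin; first by rewrite invr_ge0 ltW.
    by rewrite mulr_ge0 ?vp_ge0 ?sqr_ge0.
- by apply/measurable_EFinP/measurable_funTS; exact: measurable_funM.
- by move=> y _; rewrite lee_fin mulr_ge0 ?vp_ge0 ?sqr_ge0.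
- by rewrite lee_fin invr_ge0 ltW.
Qed.

End vallee_poussin.

(** * Product and Lebesgue integrals *)

Section product_integrals.
Local Open Scope ereal_scope.
Context d1 d2 (T1 : measurableType d1) (T2 : measurableType d2) (R : realType).
Variable m1 : {sigma_finite_measure set T1 -> \bar R}.
Variable m2 : {sigma_finite_measure set T2 -> \bar R}.

Lemma integral_tensor (f1 : T1 -> \bar R) (f2 : T2 -> \bar R) :
  measurable_fun setT f1 -> measurable_fun setT f2 ->
  (forall x, 0 <= f1 x) -> (forall x, 0 <= f2 x) ->
  \int[m1 \x m2]_p (f1 p.1 * f2 p.2) = (\int[m1]_x f1 x) * \int[m2]_y f2 y.
Proof.
move=> mf1 mf2 f10 f20.
rewrite fubini_tonelli1//; last 2 first.
- apply: emeasurable_funM; exact: measurableT_comp.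
- by move=> p; rewrite mule_ge0.
rewrite /fubini_F /=.
under eq_integral do rewrite ge0_integralZl//.
by rewrite ge0_integralZr// integral_ge0.
Qed.

(** By Tonelli the Jacobians multiply. It serves to build the dilations of R^3 from those of R, and
    the dilations of the velocity alone with [s1 = id]. *)
Lemma integral_prod_map (s1 : T1 -> T1) (s2 : T2 -> T2) (c1 c2 : R) :
  (0 <= c1)%R -> (0 <= c2)%R ->
  measurable_fun setT s1 -> measurable_fun setT s2 ->
  (forall f : T1 -> \bar R, measurable_fun setT f -> (forall x, 0 <= f x) ->
    \int[m1]_x f (s1 x) = c1%:E * \int[m1]_x f x) ->
  (forall f : T2 -> \bar R, measurable_fun setT f -> (forall x, 0 <= f x) ->
    \int[m2]_x f (s2 x) = c2%:E * \int[m2]_x f x) ->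
  forall f : T1 * T2 -> \bar R, measurable_fun setT f -> (forall x, 0 <= f x) ->
    \int[m1 \x m2]_p f (s1 p.1, s2 p.2) = (c1 * c2)%:E * \int[m1 \x m2]_p f p.
Proof.
move=> c10 c20 ms1 ms2 H1 H2 f mf f0.
have mfs : measurable_fun setT (fun p : T1 * T2 => f (s1 p.1, s2 p.2)).
  apply: (measurableT_comp mf); apply: measurable_fun_pair => /=.
    exact: (measurableT_comp ms1).
  exact: (measurableT_comp ms2).
rewrite fubini_tonelli1// [in RHS]fubini_tonelli1// /fubini_F /=.
under eq_integral => x _.
  rewrite (H2 (fun y => f (s1 x, y)))//; last exact: measurableT_comp.
  over.
rewrite ge0_integralZl//; last 2 first.
- apply: (measurableT_comp (measurable_fun_fubini_tonelli_F _ mf f0)) => //.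
- by move=> x _; rewrite integral_ge0.
rewrite (H1 (fun x => \int[m2]_y f (x, y)))//.
- by rewrite muleA -EFinM mulrC.
- exact: measurable_fun_fubini_tonelli_F.
- by move=> x; rewrite integral_ge0.
Qed.

End product_integrals.

Section dynkin_integral.
Local Open Scope ereal_scope.
Context d d' (T : measurableType d) (T' : measurableType d') (R : realType).
Variable mu : {measure set T -> \bar R}.

(** The sets [A] with zero integral over the preimage form a Dynkin system: complements by the
    assumption on [D], disjoint unions by integrability of [w]. The map [f] will be a coordinate, so
    that the sides of a box are generalized one after the other. *)
Lemma integral_eq0_dynkin (G : set (set T')) (D : set T) (f : T -> T')
    (w : T -> \bar R) :
  @measurable _ T' = <<s G >> -> setI_closed G ->
  measurable D -> measurable_fun setT f -> mu.-integrable D w ->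
  \int[mu]_(x in D) w x = 0 ->
  (forall A, G A -> \int[mu]_(x in D `&` f @^-1` A) w x = 0) ->
  forall A, measurable A -> \int[mu]_(x in D `&` f @^-1` A) w x = 0.
Proof.
move=> GE GI mD mf iw D0 G0.
have mpre A : measurable A -> measurable (D `&` f @^-1` A).
  by move=> mA; apply: measurableI => //; rewrite -[X in measurable X]setTI; exact: mf.
suff H : forall A, <<s G >> A -> \int[mu]_(x in D `&` f @^-1` A) w x = 0.
  by move=> A; rewrite GE; exact: H.
apply: (dynkin_induction GE GI) => /=.
- by rewrite preimage_setT setIT.
- exact: G0.
- move=> S mS S0.
  have mC : measurable (D `&` f @^-1` (~` S)) by apply: mpre; exact: measurableC.
  have DE : D = (D `&` f @^-1` S) `|` (D `&` f @^-1` (~` S)).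
    by rewrite -setIUr -preimage_setU setUv preimage_setT setIT.
  move: D0; rewrite {1}DE integral_setU//; last 3 first.
  + exact: mpre.
  + by rewrite -DE; exact: measurable_int iw.
  + by apply/disj_setPS => x [[_ ?] [_]].
  by rewrite S0 add0e.
- move=> F mF tF F0.
  rewrite preimage_bigcup setI_bigcupr integral_bigcup//.
  + by rewrite eseries0// => i _ _; exact: F0.
  + apply/trivIsetP => i j _ _ ij; move/trivIsetP : tF => /(_ i j Logic.I Logic.I ij).
    by move=> FF; rewrite setIACA -(preimage_setI f) FF preimage_set0 setI0.
  + by move=> k; exact: mpre.
  + apply: integrableS iw => //; first by apply: bigcup_measurable => k _; exact: mpre.
    by move=> x [k _ []].
Qed.

End dynkin_integral.

(* Named, as [leb3] is, for its sigma-finite instance to be found. *)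
Definition leb2 {R : realType} :
    set (measurableTypeR R * measurableTypeR R) -> \bar R :=
  (lebesgue_measure \x lebesgue_measure)%E.

HB.instance Definition _ (R : realType) := Measure.on (@leb2 R).

Lemma leb2_sigma_finite (R : realType) : sigma_finite setT (@leb2 R).
Proof. by apply: product_sigma_finite; exact: sigma_finiteT. Qed.

HB.instance Definition _ (R : realType) :=
  Measure_isSigmaFinite.Build _ _ _ (@leb2 R) (@leb2_sigma_finite R).

Section lebesgue3.
Variable R : realType.
Local Notation mu := (@lebesgue_measure R).
Local Open Scope ereal_scope.

Lemma integral_leb3_tensor (f1 f2 f3 : R -> \bar R) :
  measurable_fun setT f1 -> measurable_fun setT f2 -> measurable_fun setT f3 ->
  (forall x, 0 <= f1 x) -> (forall x, 0 <= f2 x) -> (forall x, 0 <= f3 x) ->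
  \int[leb3]_v (f1 v.1.1 * f2 v.1.2 * f3 v.2) =
  (\int[mu]_x f1 x) * (\int[mu]_x f2 x) * \int[mu]_x f3 x.
Proof.
move=> m1 m2 m3 p1 p2 p3.
rewrite (integral_tensor leb2 mu
  (f1 := fun p => f1 p.1 * f2 p.2))//.
- by rewrite (integral_tensor mu mu).
- by apply: emeasurable_funM; exact: measurableT_comp.
- by move=> p; rewrite mule_ge0.
Qed.

(** Uniqueness of Lebesgue measure: [k] times its image under multiplication by [k] gives []a, b]]
    the mass k (b/k - a/k) = b - a. *)
Lemma integral_scale (k : R) (k0 : (0 < k)%R) (f : R -> \bar R) :
  measurable_fun setT f -> (forall x, 0 <= f x) ->
  \int[mu]_x f (k * x)%R = (k^-1)%:E * \int[mu]_x f x.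
Proof.
move=> mf f0.
have mk : measurable_fun setT ( *%R k : measurableTypeR R -> measurableTypeR R).
  exact: measurable_funM.
pose nu := mscale (NngNum (ltW k0))
  (pushforward mu ( *%R k : measurableTypeR R -> measurableTypeR R)).
have nuE A : measurable A -> mu A = nu mk A.
  move: A; apply: lebesgue_measure_unique => _ [[a b]] _ <-.
  rewrite /nu /mscale /pushforward /=.
  rewrite [X in _ = _ * mu X](_ : _ = `](a / k)%R, (b / k)%R]%classic); last first.
    apply/seteqP; split => x /=; rewrite !in_itv /=;
      by rewrite ltr_pdivrMr// ler_pdivlMr// ![(_ * k)%R]mulrC.
  rewrite !lebesgue_measure_itv /= !lte_fin ltr_pM2r ?invr_gt0//.
  case: ifPn => _; last by rewrite mule0.
  by rewrite -!EFinB -EFinM -mulrBl mulrCA divff ?mulr1// gt_eqF.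
have -> : \int[mu]_x f x = \int[nu mk]_x f x.
  by apply: eq_measure_integral => A mA _; exact: nuE.
rewrite ge0_integral_mscale// ge0_integral_pushforward//= preimage_setT.
by rewrite muleA -EFinM mulVf ?gt_eqF// mul1e.
Qed.

Lemma integral_leb3_scale (k : R) (k0 : (0 < k)%R) (f : vec3 R -> \bar R) :
  measurable_fun setT f -> (forall x, 0 <= f x) ->
  \int[leb3]_v f (k *: v)%R = (k ^- 3)%:E * \int[leb3]_v f v.
Proof.
move=> mf f0.
have k1 : (0 <= k^-1)%R by rewrite invr_ge0 ltW.
have mk : measurable_fun setT ( *%R k : measurableTypeR R -> measurableTypeR R).
  exact: measurable_funM.
have -> : (k ^- 3 = k^-1 * k^-1 * k^-1)%R by rewrite -!invfM !exprS expr0 mulr1 mulrA.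
rewrite -(integral_prod_map (m1 := leb2) (m2 := mu)
  (s1 := fun p => (k * p.1, k * p.2)%R) (s2 := *%R k))//.
- by rewrite mulr_ge0.
- apply: measurable_fun_pair; exact: (measurableT_comp mk).
- move=> g mg g0; exact: (integral_prod_map k1 k1 mk mk (integral_scale k0) (integral_scale k0)).
- exact: integral_scale.
Qed.

(** The three sides of the box become arbitrary Borel sets in turn, which gives measurable
    rectangles. Two further Dynkin arguments give the product sigma-algebras, first on the first two
    coordinates, then on R^3. *)
Lemma integral_leb3_box_eq0 (D : set (vec3 R)) (w : vec3 R -> \bar R) :
  measurable D -> D `<=` torus_cell -> leb3.-integrable D w ->
  (forall a b c : R * R, \int[leb3]_(x in D `&` (fun v => v.1.1) @^-1` `]a.1, a.2]
    `&` (fun v => v.1.2) @^-1` `]b.1, b.2] `&` snd @^-1` `]c.1, c.2]) w x = 0) ->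
  forall E, measurable E -> \int[leb3]_(x in D `&` E) w x = 0.
Proof.
move=> mD Dcell iw H.
pose X (v : vec3 (measurableTypeR R)) : measurableTypeR R := v.1.1.
pose Y (v : vec3 (measurableTypeR R)) : measurableTypeR R := v.1.2.
pose Z (v : vec3 (measurableTypeR R)) : measurableTypeR R := v.2.
have mX : measurable_fun setT X by exact: (measurableT_comp measurable_fst measurable_fst).
have mY : measurable_fun setT Y by exact: (measurableT_comp measurable_snd measurable_fst).
have mZ : measurable_fun setT Z by exact: measurable_snd.
have mpre (f : vec3 (measurableTypeR R) -> measurableTypeR R) A :
    measurable_fun setT f -> measurable A -> measurable (f @^-1` A).
  by move=> mf mA; rewrite -[X in measurable X]setTI; exact: mf.
(* Boxes are open on the left whereas the cell contains 0; with []-1, 1]] the whole of [D] is cut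
   out by a box, which gives the integral over [D] required by the Dynkin argument. *)
have cellX : D `<=` X @^-1` `](-1)%R, 1%R]%classic.
  move=> v /Dcell /(_ ord0) /andP[v0 v1] /=; rewrite in_itv /= (ltW v1) andbT.
  by rewrite (lt_le_trans _ v0)// ltrN10.
have cellY : D `<=` Y @^-1` `](-1)%R, 1%R]%classic.
  move=> v /Dcell /(_ (lift ord0 ord0)) /andP[v0 v1] /=; rewrite in_itv /= (ltW v1) andbT.
  by rewrite (lt_le_trans _ v0)// ltrN10.
have cellZ : D `<=` Z @^-1` `](-1)%R, 1%R]%classic.
  move=> v /Dcell /(_ (lift ord0 (lift ord0 ord0))) /andP[v0 v1] /=; rewrite in_itv /= (ltW v1) andbT.
  by rewrite (lt_le_trans _ v0)// ltrN10.
have oGE : @measurable _ (measurableTypeR R) = <<s (@measurable _ (ocitv_type R)) >> by [].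
have step (f : vec3 (measurableTypeR R) -> measurableTypeR R) (D' : set _) :
    measurable D' -> D' `<=` D -> measurable_fun setT f ->
    D `<=` f @^-1` `](-1)%R, 1%R]%classic ->
    (forall a : R * R, \int[leb3]_(x in D' `&` f @^-1` `]a.1, a.2]) w x = 0) ->
    forall A, measurable A -> \int[leb3]_(x in D' `&` f @^-1` A) w x = 0.
  move=> mD' D'D mf Df H'; apply: (integral_eq0_dynkin oGE) => //.
  - exact: ocitvI.
  - exact: integrableS iw.
  - have := H' (-1, 1)%R; rewrite setIidl//.
    by apply: (subset_trans D'D).
  - by move=> _ [a _ <-]; exact: H'.
have S1 A b c : measurable A -> \int[leb3]_(x in D `&` X @^-1` A `&`
    Y @^-1` `]b.1, b.2] `&` Z @^-1` `]c.1, c.2]) w x = 0.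
  move=> mA; rewrite (_ : _ `&` _ =
      (D `&` Y @^-1` `]b.1, b.2] `&` Z @^-1` `]c.1, c.2]) `&` X @^-1` A); last first.
    by apply/seteqP; split => v /=; tauto.
  apply: step => //.
  - by apply: measurableI; [apply: measurableI => //|]; exact: mpre.
  - by move=> v [[]].
  - move=> a; rewrite -[RHS](H a b c); congr integral.
    by apply/seteqP; split => v /=; tauto.
have S2 A B c : measurable A -> measurable B -> \int[leb3]_(x in D `&` X @^-1` A `&`
    Y @^-1` B `&` Z @^-1` `]c.1, c.2]) w x = 0.
  move=> mA mB; rewrite (_ : _ `&` _ =
      (D `&` X @^-1` A `&` Z @^-1` `]c.1, c.2]) `&` Y @^-1` B); last first.
    by apply/seteqP; split => v /=; tauto.
  apply: step => //.
  - by apply: measurableI; [apply: measurableI => //|]; exact: mpre.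
  - by move=> v [[]].
  - move=> b; rewrite -[RHS](S1 A b c mA); congr integral.
    by apply/seteqP; split => v /=; tauto.
have S3 A B C : measurable A -> measurable B -> measurable C ->
    \int[leb3]_(x in D `&` X @^-1` A `&` Y @^-1` B `&` Z @^-1` C) w x = 0.
  move=> mA mB mC; apply: step => //.
  - by apply: measurableI; [apply: measurableI => //|]; exact: mpre.
  - by move=> v [[]].
  - by move=> c; exact: S2.
have RGI d1 d2 (T1 : measurableType d1) (T2 : measurableType d2) :
    setI_closed [set A `*` B | A in @measurable _ T1 & B in @measurable _ T2].
  move=> _ _ [A mA [B mB <-]] [A' mA' [B' mB' <-]]; rewrite -setXI.
  by exists (A `&` A'); [exact: measurableI|exists (B `&` B'); [exact: measurableI|]].
have S4 E C : measurable E -> measurable C ->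
    \int[leb3]_(x in D `&` Z @^-1` C `&` fst @^-1` E) w x = 0.
  move=> mE mC.
  have mDC : measurable (D `&` Z @^-1` C) by apply: measurableI => //; exact: mpre.
  apply: (integral_eq0_dynkin (f := fst : vec3 (measurableTypeR R) -> _)
    (@measurable_prod_measurableType _ _ (measurableTypeR R) (measurableTypeR R))) => //.
  - exact: RGI.
  - by apply: (integrableS _ _ _ iw) => // v [].
  - rewrite -[RHS](S3 setT setT C)//; congr integral.
    by rewrite !preimage_setT !setIT.
  - move=> _ [A mA [B mB <-]]; rewrite -[RHS](S3 A B C)//; congr integral.
    by apply/seteqP; split => v /=; tauto.
move=> E mE; rewrite -[E](preimage_id).
apply: (integral_eq0_dynkin (f := idfun : vec3 (measurableTypeR R) -> _)
  (@measurable_prod_measurableType _ _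
    (measurableTypeR R * measurableTypeR R)%type (measurableTypeR R))) => //.
- exact: RGI.
- exact: measurable_id.
- rewrite -[RHS](S4 setT setT)//; congr integral.
  by rewrite !preimage_setT !setIT.
- move=> _ [A mA [B mB <-]]; rewrite -[RHS](S4 A B)//; congr integral.
  by apply/seteqP; split => v /=; tauto.
Qed.

Lemma torus_cell_itv : torus_cell =
  ((`[0%R, 1%R[ `*` `[0%R, 1%R[) `*` `[0%R, 1%R[ : set (vec3 R))%classic.
Proof.
apply/seteqP; split => [v c|v [[c0 c1] c2] i].
  have := c ord0; have := c (lift ord0 ord0); have := c (lift ord0 (lift ord0 ord0)).
  by rewrite /= !in_itv.
by case: i => -[|[|[|//]]] ?; move: c0 c1 c2; rewrite /= !in_itv.
Qed.

Lemma measurable_torus_cell : measurable (torus_cell : set (vec3 (measurableTypeR R))).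
Proof. by rewrite torus_cell_itv; apply: measurableX => //; apply: measurableX. Qed.

Lemma integral_cell_tensor (f : 'I_3 -> R -> \bar R) :
  (forall j, measurable_fun setT (f j)) -> (forall j x, 0 <= f j x) ->
  \int[leb3]_(v in torus_cell) (\prod_(j < 3) f j (coord j v)) =
  \prod_(j < 3) \int[mu]_(x in `[0%R, 1%R[) f j x.
Proof.
move=> mf f0; rewrite integral_mkcond.
under eq_integral => v _.
  rewrite (_ : _ v = (f ord0 \_ `[0%R, 1%R[) v.1.1 *
    (f (lift ord0 ord0) \_ `[0%R, 1%R[) v.1.2 *
    (f (lift ord0 (lift ord0 ord0)) \_ `[0%R, 1%R[) v.2); first over.
  rewrite !patchE torus_cell_itv !in_setX.
  rewrite !big_ord_recl big_ord0 mule1 /=.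
  case: (v.1.1 \in _); case: (v.1.2 \in _); case: (v.2 \in _);
    by rewrite /= ?(mul0e, mule0) ?muleA.
have mI (g : R -> \bar R) : measurable_fun setT g ->
    measurable_fun setT (g \_ (`[0%R, 1%R[%classic : set R)).
  by move=> mg; apply/(measurable_restrictT _ _).1 => //; exact: measurable_funTS.
have rI (g : R -> \bar R) : (forall x, 0 <= g x) ->
    forall x, 0 <= (g \_ (`[0%R, 1%R[%classic : set R)) x.
  by move=> g0; exact: erestrict_ge0.
apply: etrans (integral_leb3_tensor _ _ _ _ _ _) _; try exact: mI; try exact: rI.
by rewrite !big_ord_recl big_ord0 mule1 muleA -!integral_mkcond.
Qed.

Lemma leb3_torus_cell : leb3 (torus_cell : set (vec3 R)) = 1.
Proof.
have := @integral_cell_tensor (fun _ => cst 1) (fun _ => measurable_cst _) (fun _ _ => lee01).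
under eq_integral do rewrite big1//.
rewrite integral_cst ?mul1e; last exact: measurable_torus_cell.
move=> ->; rewrite big1// => j _.
by rewrite integral_cst//= lebesgue_measure_itv/= lte_fin ltr01 mul1e oppr0 adde0.
Qed.

End lebesgue3.

Lemma integral_cauchy_schwarz d (T : measurableType d) (R : realType)
    (mu : {measure set T -> \bar R}) (D : set T) (f g : T -> R) :
  measurable D -> measurable_fun D f -> measurable_fun D g ->
  (\int[mu]_(x in D) (`|f x * g x|)%:E <=
   sqrte (\int[mu]_(x in D) (f x ^+ 2)%:E) *
   sqrte (\int[mu]_(x in D) (g x ^+ 2)%:E))%E.
Proof.
move=> mD mf mg.
have mr (k : T -> R) : measurable_fun D k -> measurable_fun setT (k \_ D).
  by move=> mk; apply/(measurable_restrictT _ _).1.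
have two : (2^-1 + 2^-1 = 1 :> R) by lra.
have := @hoelder _ _ _ mu (f \_ D) (g \_ D) 2 2 (mr _ mf) (mr _ mg) (ltr0n _ 2) (ltr0n _ 2) two.
have sq (k : T -> R) : Lnorm mu 2%:E (EFin \o (k \_ D)) = sqrte (\int[mu]_(x in D) (k x ^+ 2)%:E).
  rewrite unlock /Lnorm /= poweR12_sqrt; last first.
    by apply: integral_ge0 => x _; rewrite lee_fin powR_ge0.
  congr sqrte; rewrite [RHS]integral_mkcond; apply: eq_integral => x _.
  rewrite /= !patchE; case: ifP => _.
    by rewrite powR_mulrn// real_normK ?num_real.
  by rewrite normr0 powR0.
rewrite Lnorm1 !sq; apply: le_trans.
rewrite integral_mkcond le_eqVlt; apply/orP; left; apply/eqP.
apply: eq_integral => x _.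
by rewrite /= !patchE; case: ifP => _; rewrite ?mul0r ?normr0.
Qed.

(** * The kernels on the torus *)

Section kernel_bounds.
Variable R : realType.
Implicit Types (n : nat) (x y z : R).

(** In terms of cosines the claim is |cos(pi |z|)| <= cos(pi d). Both signs follow from the
    monotonicity of cos on [0, pi], as - cos(pi d) = cos(pi (1 - d)). *)
Lemma sin_pi_ge (d z : R) : 0 < d -> d <= `|z| -> `|z| <= 1 - d ->
  sin (pi * d) ^+ 2 <= sin (pi * z) ^+ 2.
Proof.
move=> d0 dz z1.
have pi0 := pi_gt0 R.
have -> : sin (pi * z) ^+ 2 = sin (pi * `|z|) ^+ 2.
  by case: (ger0P z) => // _; rewrite mulrN sinN sqrrN.
rewrite !sin2cos2 lerD2l lerN2 -(real_normK (num_real (cos _))).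
rewrite -[leRHS]real_normK ?num_real// ler_pXn2r ?nnegrE//.
have I t : d <= t <= 1 - d -> pi * t \in `[0, pi].
  move=> /andP[t0 t1]; rewrite in_itv /= mulr_ge0 ?(ltW pi0) ?(le_trans (ltW d0))//=.
  by rewrite ler_piMr ?(ltW pi0)// (le_trans t1)// lerBlDr lerDl ltW.
have cosle (a b : R) : a \in `[0, pi] -> b \in `[0, pi] -> a <= b -> cos b <= cos a.
  by move=> aI bI; rewrite le_eqVlt => /predU1P[->//|]; rewrite -ltr_cos// => /ltW.
have dd : d <= 1 - d by exact: le_trans z1.
have c1 : cos (pi * `|z|) <= cos (pi * d).
  by apply: cosle; rewrite ?I ?lexx ?dz ?dd// ler_pM2l.
have c2 : - cos (pi * d) <= cos (pi * `|z|).
  have -> : - cos (pi * d) = cos (pi * (1 - d)).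
    by rewrite mulrBr mulr1 cosB cospi sinpi mul0r addr0 mulN1r.
  by apply: cosle; rewrite ?I ?lexx ?dz ?dd// ler_pM2l.
rewrite [leRHS]ger0_norm; last by move: c1 c2; lra.
by rewrite ler_norml c1 c2.
Qed.

Lemma vp_lip n : exists2 L : R, 0 <= L & forall z z', `|vp n z - vp n z'| <= L * `|z - z'|.
Proof.
exists (vpc R n * n.*2%:R * pi).
  by rewrite !mulr_ge0 ?(ltW (vpc_gt0 _ _)) ?pi_ge0.
suff H z z' : z <= z' -> `|vp n z' - vp n z| <= vpc R n * n.*2%:R * pi * `|z' - z|.
  by move=> z z'; case/orP: (le_total z z') => /H//; rewrite distrC (distrC z').
move=> zz'; have [c _ ->] : exists2 c, c \in `[z, z']%R & vp n z' - vp n z = dvp n c * (z' - z).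
  apply: (MVT_segment zz') => [x _|]; first exact: is_derive_vp.
  by apply: continuous_subspaceT; exact: continuous_vp.
rewrite normrM ler_wpM2r// /dvp normrN !normrM ger0_norm ?(ltW (vpc_gt0 _ _))//.
rewrite (ger0_norm (pi_ge0 _)) ger0_norm// -[leRHS]mulr1 -[X in _ <= X * _]mulr1 ler_pM//.
- by rewrite !mulr_ge0 ?(ltW (vpc_gt0 _ _)) ?pi_ge0.
- rewrite ler_wpM2l ?mulr_ge0 ?(ltW (vpc_gt0 _ _)) ?pi_ge0//.
  by rewrite normrX exprn_ile1// ler_norml cos_geN1 cos_le1.
- by rewrite ler_norml sin_geN1 sin_le1.
Qed.

(* The left-hand side is, up to a constant, the L^2 norm of the kernel on the
   torus divided by [n ^ 2]; the right-hand side telescopes. *)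
Lemma vp_step n : vpc R n.+1 * Num.sqrt (vpc R n.+1) / n.+1%:R ^+ 2 <=
  16 * ((Num.sqrt (vpc R n))^-1 - (Num.sqrt (vpc R n.+1))^-1).
Proof.
have a0 := vpc_gt0 R n; have b0 := vpc_gt0 R n.+1.
have b2 := vpc_sqr R n; have ab := vpcS R n.
have m1 : 1 <= n.+1%:R :> R by rewrite ler1n.
have mE : (n.*2.+1)%:R = 2 * n.+1%:R - 1 :> R by rewrite -natr1 -muln2 natrM -natr1; ring.
have mE2 : ((n.+1).*2)%:R = 2 * n.+1%:R :> R by rewrite -muln2 natrM mulrC.
rewrite mE mE2 in ab.
have s0 : 0 < Num.sqrt (vpc R n) by rewrite sqrtr_gt0.
have t0 : 0 < Num.sqrt (vpc R n.+1) by rewrite sqrtr_gt0.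
have sE : Num.sqrt (vpc R n) ^+ 2 = vpc R n by rewrite sqr_sqrtr ?ltW.
have tE : Num.sqrt (vpc R n.+1) ^+ 2 = vpc R n.+1 by rewrite sqr_sqrtr ?ltW.
have st : Num.sqrt (vpc R n) <= Num.sqrt (vpc R n.+1) by rewrite ler_wsqrtr// vpc_leS.
rewrite -{1}tE.
move: (vpc R n) (vpc R n.+1) (Num.sqrt (vpc R n)) (Num.sqrt (vpc R n.+1)) (n.+1%:R : R)
  a0 b0 b2 ab m1 s0 t0 sE tE st {mE mE2} => a b s t m a0 b0 b2 ab m1 s0 t0 sE tE st.
have m0 : 0 < m by lra.
(* Wallis' recurrence says b - a = b / (2m), and b - a = (t - s) (t + s). *)
have e1 : (t - s) * (t + s) * (2 * m) = t ^+ 2.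
  have -> : (t - s) * (t + s) = b - a by rewrite -sE -tE; ring.
  rewrite tE ab; field; lra.
have h1 : t <= (t - s) * (4 * m).
  rewrite -(ler_pM2l t0) -[t * t]expr2 -e1.
  have : (t - s) * (t + s) * (2 * m) <= (t - s) * (2 * t) * (2 * m).
    rewrite ler_pM2r; last by lra.
    by rewrite ler_wpM2l; lra.
  by move/le_trans; apply; rewrite le_eqVlt; apply/orP; left; apply/eqP; ring.
have -> : s^-1 - t^-1 = (t - s) / (s * t) by field; rewrite !gt_eqF.
(* The intermediate value is 4 / (m t). It bounds the left-hand side because t^4 <= 4m, which is
   [vpc_sqr], and it is bounded by the right-hand side by [h1] and s <= t. *)
apply: (@le_trans _ _ (16 * (t / (4 * m) / (t * t)))).
  rewrite (_ : 16 * _ = 4 / (m * t)); last by field; rewrite !gt_eqF.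
  rewrite ler_pdivrMr ?exprn_gt0// [leRHS]mulrAC ler_pdivlMr ?mulr_gt0//.
  rewrite (_ : t ^+ 2 * t * (m * t) = m * (t ^+ 2) ^+ 2); last by ring.
  rewrite tE (_ : 4 * m ^+ 2 = m * (4 * m)); last by ring.
  by rewrite ler_pM2l.
rewrite ler_pM2l//; apply: ler_pM.
- by rewrite divr_ge0 ?mulr_ge0 ?ltW.
- by rewrite invr_ge0 mulr_ge0 ?ltW.
- by rewrite ler_pdivrMr ?mulr_gt0.
- by rewrite lef_pV2 ?posrE ?mulr_gt0// ler_pM2r.
Qed.
End kernel_bounds.

Section torus_kernel.
Variable R : realType.
Implicit Types (n : nat) (k : 'I_3 -> nat) (x y : vec3 R).

(** One order per coordinate, since the passage from [n] to [n.+1] goes through kernels of mixed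
    orders. *)
Definition kern k x y : R := tens (fun j => vp (k j)) x y.

Lemma big3 (T : Type) (idx : T) (op : Monoid.law idx) (F : 'I_3 -> T) :
  \big[op/idx]_(j < 3) F j =
  op (F ord0) (op (F (lift ord0 ord0)) (F (lift ord0 (lift ord0 ord0)))).
Proof. by rewrite !big_ord_recl big_ord0 Monoid.mulm1. Qed.

Lemma vp_trigonometric n (a : R) (i : 'I_3) :
  trigonometric (fun y => vp n (a - coord i y)).
Proof.
have -> : (fun y => vp n (a - coord i y)) =
    cst (vpc R n) * (fun y => cos (pi * (a - coord i y))) ^+ n.*2.
  by apply/funext => y; rewrite -[RHS]/(_ * (_ ^+ _) _) exprfctE.
apply: trig_mul; first exact: trig_cst.
elim: n.*2 => [|k IH]; first exact: trig_cst.
by rewrite exprS; apply: trig_mul => //; exact: trig_cos.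
Qed.

Lemma kern_smooth k x : smooth (kern k x).
Proof.
apply: trigonometric_smooth.
have -> : kern k x = (fun y => vp (k ord0) (coord ord0 x - coord ord0 y)) *
    ((fun y => vp (k (lift ord0 ord0)) (coord (lift ord0 ord0) x - coord (lift ord0 ord0) y)) *
    (fun y => vp (k (lift ord0 (lift ord0 ord0)))
       (coord (lift ord0 (lift ord0 ord0)) x - coord (lift ord0 (lift ord0 ord0)) y))).
  by apply/funext => y; rewrite /kern /tens big3.
by apply: trig_mul; [|apply: trig_mul]; exact: vp_trigonometric.
Qed.

Lemma kernC k x y : kern k x y = kern k y x.
Proof. by apply: eq_bigr => j _; rewrite -vpN opprB. Qed.

Lemma kern_periodic k x : torus_periodic (kern k x).
Proof.
move=> i y; apply: eq_bigr => j _; rewrite coordD coord_basis opprD addrA.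
case: (j == i); last by rewrite subr0.
by rewrite -[LHS]vpD1 subrK.
Qed.

Lemma kern_ge0 k x y : 0 <= kern k x y.
Proof. by apply: prodr_ge0 => j _; exact: vp_ge0. Qed.

Lemma kern_le k x y : kern k x y <= \prod_(j < 3) vpc R (k j).
Proof. by apply: ler_prod => j _; rewrite vp_ge0 vp_le. Qed.

Lemma measurable_coord (i : 'I_3) :
  measurable_fun setT (coord i : vec3 (measurableTypeR R) -> measurableTypeR R).
Proof.
case: i => -[|[|[|//]]] ?.
- exact: (measurableT_comp measurable_fst measurable_fst).
- exact: (measurableT_comp measurable_snd measurable_fst).
- exact: measurable_snd.
Qed.

Lemma measurable_kern k : measurable_fun setT
  (fun p : vec3 (measurableTypeR R) * vec3 (measurableTypeR R) => kern k p.1 p.2 : measurableTypeR R).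
Proof.
rewrite /kern /tens; under eq_fun do rewrite big3.
have mj (j : 'I_3) : measurable_fun setT
    (fun p : vec3 (measurableTypeR R) * vec3 (measurableTypeR R) =>
    vp (k j) (coord j p.1 - coord j p.2) : measurableTypeR R).
  apply: (measurableT_comp (continuous_measurable_fun (@continuous_vp R (k j)))).
  apply: measurable_funB.
    exact: (measurableT_comp (measurable_coord j) measurable_fst).
  exact: (measurableT_comp (measurable_coord j) measurable_snd).
apply: measurable_funM; first exact: (mj ord0).
by apply: measurable_funM; exact: mj.
Qed.

Lemma measurable_kern2 k x : measurable_fun setT (kern k x : vec3 (measurableTypeR R) -> measurableTypeR R).
Proof. exact: (measurableT_comp (measurable_kern k) (measurable_pair1 x)). Qed.

(** The integral factors over the coordinates, and each factor is at most c_{k j} <= c_n. The mixed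
    orders are covered by a single [n]. *)
Lemma kern_L2 k x n : (forall j, (k j <= n)%N) ->
  (\int[leb3]_(y in torus_cell) (kern k x y ^+ 2)%:E <= (vpc R n ^+ 3)%:E)%E.
Proof.
move=> kn.
have -> : (\int[leb3]_(y in torus_cell) (kern k x y ^+ 2)%:E)%E =
    (\int[leb3]_(y in torus_cell) \prod_(j < 3) (fun t => (vp (k j) (coord j x - t) ^+ 2)%:E) (coord j y))%E.
  by apply: eq_integral => y _; rewrite /kern /tens -prodrXl prodEFin.
have mv (j : 'I_3) : measurable_fun setT (fun t : R => (vp (k j) (coord j x - t) ^+ 2)%:E).
  apply/measurable_EFinP; apply: measurable_funX.
  apply: (measurableT_comp (continuous_measurable_fun (@continuous_vp R (k j)))).
  exact: measurable_funB.
rewrite (@integral_cell_tensor R (fun j t => (vp (k j) (coord j x - t) ^+ 2)%:E)) //; last by move=> j t; rewrite lee_fin sqr_ge0.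
apply: (@le_trans _ _ (\prod_(j < 3) (vpc R n)%:E)%E).
  rewrite !big3.
  have h (j : 'I_3) : (0 <= \int[lebesgue_measure]_(t in `[0%R, 1%R[) (vp (k j) (coord j x - t) ^+ 2)%:E <= (vpc R n)%:E)%E.
    rewrite integral_ge0 /=; last by move=> t _; rewrite lee_fin sqr_ge0.
    apply: le_trans (integral_vp_sqr _ _) _; rewrite lee_fin; exact: vpc_le.
  have h0 j : (0 <= \int[lebesgue_measure]_(t in `[0%R, 1%R[) (vp (k j) (coord j x - t) ^+ 2)%:E)%E.
    by case/andP: (h j).
  have h1 j : (\int[lebesgue_measure]_(t in `[0%R, 1%R[) (vp (k j) (coord j x - t) ^+ 2)%:E <= (vpc R n)%:E)%E.
    by case/andP: (h j).
  by apply: lee_pmul => //; [exact: mule_ge0|exact: lee_pmul].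
by rewrite !big3 /= !exprS expr0 mulr1.
Qed.

(* Passing from [n] to [n.+1] one coordinate at a time, [hyb' n i] and [hyb n i]
   are the indices of the kernel before and after coordinate [i] is changed. *)
Definition hyb n (i j : 'I_3) : nat := if (j <= i)%N then n.+1 else n.

Definition hyb' n (i j : 'I_3) : nat := if (j < i)%N then n.+1 else n.

(** The two minus signs of [derive_tens] cancel, and the discrete heat equation is applied to the
    factor [i], whose order is [n.+1]. *)
Lemma partials_kern n (i : 'I_3) x y : partials [:: i; i] (kern (hyb n i) x) y =
  4 * pi ^+ 2 * n.+1%:R ^+ 2 * (kern (hyb' n i) x y - kern (hyb n i) x y).
Proof.
pose K : R := 4 * pi ^+ 2 * n.+1%:R ^+ 2.
have K0 : K != 0 by rewrite !mulf_neq0 ?expf_neq0 ?gt_eqF ?pi_gt0// pnatr_eq0.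
have -> : partials [:: i; i] (kern (hyb n i) x) y =
    tens (upd (fun j => vp (hyb n i j)) i (fun z => K * (vp n z - vp n.+1 z))) x y.
  have hi : hyb n i i = n.+1 by rewrite /hyb leqnn.
  have d1 (z : R) : is_derive z 1 (vp (hyb n i i)) (dvp n.+1 z).
    by rewrite hi; exact: is_derive_vp.
  have d2 j (z : R) : j != i -> derivable (vp (hyb n i j)) z 1.
    by have [] := is_derive_vp (hyb n i j) z.
  rewrite /partials /= (@derive_tens R (fun j => vp (hyb n i j)) i _ x d1 d2).
  pose G : 'I_3 -> R -> R := upd (fun j => vp (hyb n i j)) i (fun z => - dvp n.+1 z).
  have d3 (z : R) : is_derive z 1 (G i) (- (K * (vp n z - vp n.+1 z))).
    by rewrite /G /upd eqxx; apply: is_deriveN; exact: is_derive_dvp.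
  have d4 j (z : R) : j != i -> derivable (G j) z 1.
    by move=> ji; rewrite /G /upd (negbTE ji); exact: d2.
  apply: (etrans (congr1 (fun f => f y) (@derive_tens R G i _ x d3 d4))).
  congr tens.
  apply/funext => j; rewrite /upd; case: eqP => // /eqP ji.
    by apply/funext => z; rewrite opprK.
  by rewrite /G /upd (negbTE ji).
rewrite -/K /kern /tens !big3 /upd /hyb /hyb'.
have [->|->|->] : [\/ i = ord0, i = lift ord0 ord0 | i = lift ord0 (lift ord0 ord0)].
- case: i => -[|[|[|//]]] ?; [apply: Or31|apply: Or32|apply: Or33]; exact: val_inj.
- by rewrite !eqE /=; ring.
- by rewrite !eqE /=; ring.
- by rewrite !eqE /=; ring.
Qed.

(** A telescoping sum: [hyb n i] agrees with [hyb' n] at the next coordinate, and the two ends are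
    the constant orders [n] and [n.+1]. *)
Lemma kern_diff n x y : kern (fun=> n) x y - kern (fun=> n.+1) x y =
  (4 * pi ^+ 2 * n.+1%:R ^+ 2)^-1 *
  \sum_(i < 3) partials [:: i; i] (kern (hyb n i) x) y.
Proof.
have K0 : 4 * pi ^+ 2 * n.+1%:R ^+ 2 != 0 :> R.
  by rewrite !mulf_neq0 ?expf_neq0 ?gt_eqF ?pi_gt0// pnatr_eq0.
under eq_bigr do rewrite partials_kern.
rewrite -mulr_sumr mulKf// !big3 /= /kern /tens !big3 /hyb /hyb' /=; ring.
Qed.
End torus_kernel.

(** * Fubini's theorem with a bounded kernel *)

Section bounded_kernel.
Context d1 d2 (T1 : measurableType d1) (T2 : measurableType d2) (R : realType).
Variable m1 : {sigma_finite_measure set T1 -> \bar R}.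
Variable m2 : {sigma_finite_measure set T2 -> \bar R}.

Lemma integrable_tensor (f : T1 -> R) (g : T2 -> R) :
  m1.-integrable setT (EFin \o f) -> m2.-integrable setT (EFin \o g) ->
  (m1 \x m2)%E.-integrable setT (fun p => (f p.1 * g p.2)%:E).
Proof.
move=> /integrableP[mf fi] /integrableP[mg gi].
have mf' : measurable_fun setT f by apply/measurable_EFinP.
have mg' : measurable_fun setT g by apply/measurable_EFinP.
apply/integrableP; split.
  apply/measurable_EFinP; apply: measurable_funM.
    exact: (measurableT_comp mf').
  exact: (measurableT_comp mg').
under eq_integral do rewrite /= normrM EFinM.
rewrite (integral_tensor m1 m2 (f1 := fun x => `|f x|%:E) (f2 := fun x => `|g x|%:E))//.
- apply: lte_mul_pinfty => //; first exact: integral_ge0.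
  by rewrite ge0_fin_numE// integral_ge0.
- by apply/measurable_EFinP; exact: measurableT_comp.
- by apply/measurable_EFinP; exact: measurableT_comp.
Qed.

Lemma integrable_bounded_mul d (T : measurableType d) (mu : {measure set T -> \bar R})
    (D : set T) (f k : T -> R) (M : R) :
  measurable D -> mu.-integrable D (EFin \o f) -> measurable_fun D k ->
  (forall x, D x -> `|k x| <= M) -> mu.-integrable D (fun x => (f x * k x)%:E).
Proof.
move=> mD fi mk kM.
have mf : measurable_fun D f by apply/measurable_EFinP; exact: measurable_int fi.
apply: (@le_integrable _ _ _ mu D mD _ (fun x => (M * f x)%:E)).
- by apply/measurable_EFinP; exact: measurable_funM.
- move=> x Dx; rewrite lee_fin !normrM mulrC ler_wpM2r// (le_trans (kM _ Dx))//.
  exact: ler_norm.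
- under [X in integrable _ _ X]eq_fun do rewrite EFinM.
  exact: integrableZl.
Qed.

(** Boundedness of [k] makes [f p.1 * g p.2 * k p] integrable on the product and every inner
    integral finite, so that real and extended integrals can be exchanged for one another. *)
Lemma Rintegral_kernel_swap (f : T1 -> R) (g : T2 -> R) (k : T1 * T2 -> R) (M : R) :
  m1.-integrable setT (EFin \o f) -> m2.-integrable setT (EFin \o g) ->
  measurable_fun setT k -> (forall p, `|k p| <= M) ->
  \int[m1]_x (f x * \int[m2]_y (g y * k (x, y))) =
  \int[m2]_y (g y * \int[m1]_x (f x * k (x, y))).
Proof.
move=> fi gi mk kM.
have Phi : (m1 \x m2)%E.-integrable setT (fun p => (f p.1 * g p.2 * k p)%:E).
  by apply: (integrable_bounded_mul _ (integrable_tensor fi gi) mk (M := M)).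
have kx x : measurable_fun setT (fun y => k (x, y)) by exact: (measurableT_comp mk).
have ky y : measurable_fun setT (fun x => k (x, y)) by exact: (measurableT_comp mk).
have := Fubini Phi; rewrite /fubini_F /fubini_G /= => H.
rewrite /Rintegral; congr fine.
transitivity (\int[m1]_x \int[m2]_y (f x * g y * k (x, y))%:E)%E.
  apply: eq_integral => x _.
  have gk : m2.-integrable setT (fun y => (g y * k (x, y))%:E).
    by apply: (integrable_bounded_mul _ gi (kx x) (M := M)).
  rewrite EFinM fineK; last exact: integrable_fin_num.
  rewrite -integralZl//; apply: eq_integral => y _.
  by rewrite -EFinM mulrA.
rewrite H; apply: eq_integral => y _.
have fk : m1.-integrable setT (fun x => (f x * k (x, y))%:E).
  by apply: (integrable_bounded_mul _ fi (ky y) (M := M)).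
rewrite [RHS]EFinM fineK; last exact: integrable_fin_num.
rewrite -integralZl//; apply: eq_integral => x _.
by rewrite -EFinM mulrA (mulrC (g y)).
Qed.

End bounded_kernel.

(** * The kernels as an approximation of the identity *)

Section approximate_identity.
Variable R : realType.
Local Notation mu := (@lebesgue_measure R).

Lemma vp_tail_cvg (x : R) (S : set R) (d : R) : 0 < d -> measurable S ->
  S `<=` `[0, 1[ -> (forall y, S y -> d <= `|x - y| <= 1 - d) ->
  \int[mu]_(y in S) vp n (x - y) @[n --> \oo] --> (0 : R).
Proof.
move=> d0 mS S01 Sd.
(* A point of [S] is needed to know d <= 1/2, and with it that sin(pi d) > 0. *)
have [->|/set0P[y0 Sy0]] := eqVneq S set0.
  by under eq_fun do rewrite Rintegral_set0; exact: cvg_cst.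
have d2 : d <= 2^-1 by have /andP[] := Sd _ Sy0; lra.
have s0 : 0 < sin (pi * d) ^+ 2.
  rewrite exprn_gt0// sin_gt0_pi// mulr_gt0 ?pi_gt0//=.
  by rewrite gtr_pMr ?pi_gt0//; lra.
have tail n : \int[mu]_(y in S) vp n (x - y) <= (sin (pi * d) ^+ 2)^-1 * (n.+1).*2%:R^-1.
  have := @vp_tail R n x S _ s0 mS S01.
  have h y : S y -> sin (pi * d) ^+ 2 <= sin (pi * (x - y)) ^+ 2.
    by move=> /Sd /andP[y1 y2]; exact: sin_pi_ge.
  move=> /(_ h) H; rewrite -lee_fin fineK//.
  rewrite ge0_fin_numE; first exact: le_lt_trans H (ltry _).
  by apply: integral_ge0 => y _; rewrite lee_fin vp_ge0.
apply: (@squeeze_cvgr _ _ _ _ (cst 0) (fun n => (sin (pi * d) ^+ 2)^-1 * (n.+1).*2%:R^-1)).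
- apply: nearW => n; rewrite tail andbT Rintegral_ge0// => y _; exact: vp_ge0.
- exact: cvg_cst.
- rewrite -[X in _ --> X](mulr0 (sin (pi * d) ^+ 2)^-1); apply: cvgMr.
  have -> : (fun n : nat => (n.+1).*2%:R^-1 : R) = (fun n => 2^-1 * n.+1%:R^-1).
    by apply/funext => n; rewrite -muln2 natrM invfM mulrC.
  rewrite -[X in _ --> X](mulr0 2^-1); apply: cvgMr.
  exact: cvg_harmonic.
Qed.

(** The kernel has mean 1 and its mass away from [x] vanishes in the limit. If [x] lies in the
    interval, this is applied to the complement; the endpoints are at positive distance from [x] by
    assumption. *)
Lemma vp_itv_cvg (x a b : R) : 0 < x < 1 -> x != a -> x != b ->
  \int[mu]_(y in `[0, 1[) (vp n (x - y) * \1_(`]a, b]%classic) y) @[n --> \oo]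
    --> (\1_(`]a, b]%classic) x : R).
Proof.
move=> /andP[x0 x1] xa xb.
have mI : measurable (`]a, b]%classic : set R) by [].
have E (A : set R) : measurable A -> forall n, \int[mu]_(y in `[0, 1[) (vp n (x - y) * \1_A y) =
    \int[mu]_(y in `[0, 1[ `&` A) vp n (x - y).
  move=> mA n; rewrite [RHS]Rintegral_mkcondr; apply: eq_Rintegral => y _.
  by rewrite patchE indicE; case: ifP => _; rewrite ?mulr1 ?mulr0.
have tail (A : set R) d : measurable A -> 0 < d -> (forall y, A y -> d <= `|x - y|) ->
    \int[mu]_(y in `[0, 1[ `&` A) vp n (x - y) @[n --> \oo] --> (0 : R).
  move=> mA d0 Ad.
  (* The kernel is periodic, so it also concentrates where |x - y| is close to 1. On the cell |x -
     y| is at most 1 minus the distance of [x] to the endpoints 0 and 1. *)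
  apply: (@vp_tail_cvg x _ (Num.min d (Num.min x (1 - x)))).
  - by rewrite !lt_min d0 x0/= subr_gt0.
  - exact: measurableI.
  - by move=> y [].
  - move=> y [/=]; rewrite in_itv /= => /andP[y0 y1] /Ad dy.
    have m1 : Num.min d (Num.min x (1 - x)) <= d by rewrite ge_min lexx.
    have m2 : Num.min d (Num.min x (1 - x)) <= x by rewrite !ge_min lexx !orbT.
    have m3 : Num.min d (Num.min x (1 - x)) <= 1 - x by rewrite !ge_min lexx !orbT.
    rewrite (le_trans m1 dy) /=.
    have [xy|xy] := lerP y x.
      by lra.
    by lra.
rewrite (_ : (fun n => _) = (fun n => \int[mu]_(y in `[0, 1[ `&` `]a, b]) vp n (x - y))); last first.
  by apply/funext => n; exact: E.
rewrite indicE; have [xI|xI] := boolP (x \in _).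
  have /andP[ax bx] : a < x < b.
    by move: xI; rewrite inE /= in_itv /= le_eqVlt (negbTE xb).
  have H n : \int[mu]_(y in `[0, 1[ `&` `]a, b]) vp n (x - y) =
      1 - \int[mu]_(y in `[0, 1[ `&` ~` `]a, b]) vp n (x - y).
    have I1 : \int[mu]_(y in `[0, 1[) vp n (x - y) = 1 by rewrite /Rintegral integral_vp.
    apply/eqP; rewrite -subr_eq opprK -[X in _ == X]I1; apply/eqP.
    rewrite -Rintegral_setU//.
    - by rewrite -setIUr setUv setIT.
    - exact: measurableI.
    - by apply: measurableI => //; exact: measurableC.
    - by rewrite -setIUr setUv setIT; exact: integrable_vp01.
    - by apply/disj_setPS => y [[_ ?] [_]].
  rewrite (_ : (fun n => _) = (fun n => 1 - \int[mu]_(y in `[0, 1[ `&` ~` `]a, b]) vp n (x - y))); last first.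
    by apply/funext => n; exact: H.
  rewrite -[X in _ --> X]subr0; apply: cvgB; first exact: cvg_cst.
  apply: (@tail _ (Num.min (x - a) (b - x))); first exact: measurableC.
    by rewrite lt_min !subr_gt0 ax.
  move=> y /=; rewrite in_itv /= => /negP; rewrite negb_and -leNgt -ltNge => /orP[ya|yb].
    by rewrite ge_min ger0_norm ?lerD2l ?lerN2 ?ya// subr_ge0 (le_trans ya)// ltW.
  rewrite ge_min ler0_norm ?opprB ?lerD2r ?(ltW yb) ?orbT// subr_le0.
  by rewrite (le_trans (ltW bx))// ltW.
have : ~~ (a < x <= b) by apply: contra xI; rewrite inE /= in_itv.
rewrite negb_and -leNgt -ltNge => xab.
case/orP: xab => [xa'|xb'].
  apply: (@tail _ (a - x)) => //.
    by rewrite subr_gt0 lt_neqAle xa.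
  move=> y /=; rewrite in_itv /= => /andP[ay yb].
  by rewrite ler0_norm ?opprB ?lerD2r ?(ltW ay)// subr_le0 (le_trans xa')// ltW.
apply: (@tail _ (x - b)) => //; first by rewrite subr_gt0.
move=> y /=; rewrite in_itv /= => /andP[ay yb].
by rewrite ger0_norm ?lerD2l ?lerN2// subr_ge0 (le_trans yb)// ltW.
Qed.

End approximate_identity.

Lemma dominated_Rintegral d (T : measurableType d) (R : realType)
    (mu : {measure set T -> \bar R}) (D : set T) (f_ : nat -> T -> R) (f g : T -> R) :
  measurable D -> (forall n, measurable_fun D (f_ n)) -> measurable_fun D f ->
  {ae mu, forall x, D x -> f_ n x @[n --> \oo] --> f x} ->
  mu.-integrable D (EFin \o g) ->
  (forall n x, D x -> `|f_ n x| <= g x) ->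
  \int[mu]_(x in D) f_ n x @[n --> \oo] --> \int[mu]_(x in D) f x.
Proof.
move=> mD mf_ mf ff gi fg.
have [|||||fi _ lim] := @dominated_convergence _ _ _ mu D mD (fun n => EFin \o f_ n) (EFin \o f) (EFin \o g).
- by move=> n; exact/measurable_EFinP.
- exact/measurable_EFinP.
- apply: filterS ff => x ffx Dx; apply: cvg_comp (ffx Dx) _.
  by apply: cvg_EFin; [exact: nearW|exact: cvg_id].
- exact: gi.
- by apply: aeW => x n Dx; rewrite /= lee_fin fg.
apply: fine_cvg; rewrite fineK; last exact: integrable_fin_num.
exact: lim.
Qed.

(** * Convolutions on the torus *)

Section convolution.
Variable R : realType.
Local Notation mu := (@lebesgue_measure R).
Implicit Types (g U : vec3 R -> R).

Definition conv n g (x : vec3 R) : R :=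
  \int[leb3]_(y in torus_cell) (g y * kern (fun=> n) x y).

Lemma ae_coord_neq (j : 'I_3) (c : R) : {ae leb3, forall y : vec3 (measurableTypeR R), coord j y != c}.
Proof.
have Ej : [\/ j = ord0, j = lift ord0 ord0 | j = lift ord0 (lift ord0 ord0)].
  by case: j => -[|[|[|//]]] ?; [apply: Or31|apply: Or32|apply: Or33]; exact: val_inj.
pose A : set (vec3 (measurableTypeR R)) := coord j @^-1` [set c].
have mA : measurable A.
  by rewrite -[X in measurable X]setTI; exact: measurable_coord.
suff A0 : leb3 A = 0%E.
  by exists A; split => // y /= /negP; rewrite negbK => /eqP.
pose f (i : 'I_3) (t : R) : \bar R := (if i == j then \1_[set c] t else 1)%:E.
have mf i : measurable_fun setT (f i).
  rewrite /f; apply/measurable_EFinP; case: (i == j); last exact: measurable_cst.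
  exact: measurable_indic.
have f0 i t : (0 <= f i t)%E by rewrite /f; case: (i == j); rewrite lee_fin // indicE ler0n.
have f1 : (\int[mu]_t f j t = 0)%E.
  rewrite /f eqxx integral_indic// setIT.
  exact: lebesgue_measure_set1.
rewrite -[A]setIT -integral_indic//.
transitivity (\int[leb3]_v (f ord0 v.1.1 * f (lift ord0 ord0) v.1.2 * f (lift ord0 (lift ord0 ord0)) v.2))%E.
  apply: eq_integral => v _.
  have -> : (\1_A v : R) = \1_[set c] (coord j v) by [].
  rewrite /f.
  by case: Ej => ->; rewrite !eqE /= ?mule1 ?mul1e.
rewrite integral_leb3_tensor//.
(* The integrals of the other two factors are infinite; the product is 0 by the convention 0 * +oo =
   0. *)
by case: Ej => E; rewrite -E f1 ?mul0e ?mule0 ?mul0e.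
Qed.

Lemma kern_bounded (k : 'I_3 -> nat) (p : vec3 R * vec3 R) :
  `|kern k p.1 p.2| <= \prod_(j < 3) vpc R (k j).
Proof. by rewrite ger0_norm ?kern_ge0// kern_le. Qed.

(** Convolution is self-adjoint since the kernel is symmetric. Both functions are extended by zero
    outside the cell, so that Fubini's theorem applies on all of R^3. *)
Lemma conv_swap n g (f : vec3 R -> R) :
  leb3.-integrable torus_cell (EFin \o g) -> leb3.-integrable torus_cell (EFin \o f) ->
  leb3.-integrable torus_cell (fun x => (f x * conv n g x)%:E) /\
  \int[leb3]_(x in torus_cell) (f x * conv n g x) =
  \int[leb3]_(y in torus_cell) (g y * conv n f y).
Proof.
move=> gi fi; have mc := @measurable_torus_cell R.
pose G := g \_ (torus_cell : set (vec3 R)); pose F := f \_ (torus_cell : set (vec3 R)).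
have Gi : leb3.-integrable setT (EFin \o G).
  by have := (integrable_mkcond _ mc).1 gi; rewrite restrict_EFin.
have Fi : leb3.-integrable setT (EFin \o F).
  by have := (integrable_mkcond _ mc).1 fi; rewrite restrict_EFin.
have cE (h : vec3 R -> R) x : conv n h x = \int[leb3]_y ((h \_ torus_cell) y * kern (fun=> n) x y).
  rewrite /conv Rintegral_mkcond; apply: eq_Rintegral => y _.
  by rewrite !patchE; case: ifP; rewrite ?mul0r.
have mk := @measurable_kern R (fun=> n).
have bk := @kern_bounded (fun=> n).
split.
  have Phi : (leb3 \x leb3)%E.-integrable setT (fun p => (F p.1 * G p.2 * kern (fun=> n) p.1 p.2)%:E).
    by apply: (integrable_bounded_mul _ (integrable_tensor Fi Gi) mk).
  have := integrable_fubini_F Phi.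
  rewrite /fubini_F (integrable_mkcond _ mc); apply: eq_integrable => // x _.
  have Gk : leb3.-integrable setT (fun y => (G y * kern (fun=> n) x y)%:E).
    by apply: (integrable_bounded_mul _ Gi (measurable_kern2 _ x)) => // y _; exact: bk (x, y).
  rewrite patchE /=; case: ifPn => xc.
    rewrite cE EFinM fineK; last exact: integrable_fin_num.
    rewrite -integralZl//; apply: eq_integral => y _.
    by rewrite -EFinM mulrA /F patchE xc.
  by apply: integral0_eq => y _; rewrite /F patchE (negbTE xc) !mul0r.
rewrite Rintegral_mkcond [RHS]Rintegral_mkcond.
transitivity (\int[leb3]_x (F x * \int[leb3]_y (G y * kern (fun=> n) x y))).
  by apply: eq_Rintegral => x _; rewrite -cE /F !patchE; case: ifP; rewrite ?mul0r.
rewrite (Rintegral_kernel_swap Fi Gi mk bk); apply: eq_Rintegral => y _.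
rewrite /G !patchE; case: ifP; rewrite ?mul0r// => _.
by rewrite cE; congr (_ * _); apply: eq_Rintegral => x _; rewrite /= kernC.
Qed.

Lemma integrable_cell1 : leb3.-integrable torus_cell (EFin \o (fun _ : vec3 R => 1)).
Proof.
apply/integrableP; split; first exact: measurable_cst.
under eq_integral do rewrite /= normr1.
rewrite integral_cst; last exact: measurable_torus_cell.
by rewrite mul1e [X in (X < _)%E](leb3_torus_cell R) ltry.
Qed.

(** The integrability half of [conv_swap] with [f = 1], as integrability contains measurability. *)
Lemma measurable_conv n g : leb3.-integrable torus_cell (EFin \o g) ->
  measurable_fun torus_cell (conv n g).
Proof.
move=> gi.
have i1 := integrable_cell1.
have [/measurable_int + _] := conv_swap n gi i1.
by under [X in measurable_fun _ X]eq_fun do rewrite mul1r; move/measurable_EFinP.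
Qed.

Definition box_indic (a b : 'I_3 -> R) (x : vec3 R) : R :=
  \prod_(j < 3) \1_(`]a j, b j]%classic) (coord j x).

Lemma box_indic01 a b x : 0 <= box_indic a b x <= 1.
Proof.
rewrite prodr_ge0 => [|j _]; last by rewrite indicE ler0n.
by apply: prodr_ile1 => j; rewrite indicE ler0n /=; case: (_ \in _).
Qed.

Lemma measurable_box_indic a b : measurable_fun setT (box_indic a b : vec3 (measurableTypeR R) -> measurableTypeR R).
Proof.
have mj (j : 'I_3) : measurable_fun setT
    (fun x : vec3 (measurableTypeR R) => \1_(`]a j, b j]%classic) (coord j x) : measurableTypeR R).
  apply: (measurableT_comp _ (measurable_coord j)).
  by apply: measurable_indic.
rewrite /box_indic; under eq_fun do rewrite big3.
apply: measurable_funM; first exact: (mj ord0).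
by apply: measurable_funM; exact: mj.
Qed.

Lemma integrable_box_indic a b : leb3.-integrable torus_cell (EFin \o box_indic a b).
Proof.
have mc := @measurable_torus_cell R.
have i1 := integrable_cell1.
have := @integrable_bounded_mul _ _ _ leb3 _ _ (box_indic a b) 1 mc i1.
under [X in _ -> _ -> is_true (integrable _ _ X)]eq_fun do rewrite mul1r.
apply; first exact: measurable_funTS (measurable_box_indic _ _).
by move=> x _; have /andP[x0 x1] := box_indic01 a b x; rewrite ger0_norm.
Qed.

Lemma conv_box a b n y : conv n (box_indic a b) y =
  \prod_(j < 3) \int[mu]_(t in `[0, 1[) (vp n (coord j y - t) * \1_(`]a j, b j]%classic) t).
Proof.
pose f (j : 'I_3) (t : R) : \bar R := (vp n (coord j y - t) * \1_(`]a j, b j]%classic) t)%:E.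
have mI j : measurable_fun setT (\1_(`]a j, b j]%classic) : R -> R) by exact: measurable_indic.
have fi j : mu.-integrable `[0, 1[ (f j).
  apply: (integrable_bounded_mul _ (integrable_vp01 n (coord j y)) _ (M := 1)) => //.
  by move=> t _; rewrite indicE; case: (_ \in _); rewrite ?normr1 ?normr0.
have mf j : measurable_fun setT (f j).
  apply/measurable_EFinP; apply: measurable_funM => //.
  apply: (measurableT_comp (continuous_measurable_fun (@continuous_vp R n))).
  exact: measurable_funB.
have f0 j t : (0 <= f j t)%E by rewrite lee_fin mulr_ge0 ?vp_ge0// indicE ler0n.
rewrite /conv {1}/Rintegral.
have -> : (\int[leb3]_(x in torus_cell) (box_indic a b x * kern (fun=> n) y x)%:E =
    \int[leb3]_(x in torus_cell) \prod_(j < 3) f j (coord j x))%E.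
  apply: eq_integral => x _; rewrite /f prodEFin; congr EFin.
  by rewrite /box_indic /kern /tens -big_split /=; apply: eq_bigr => j _; rewrite mulrC.
rewrite integral_cell_tensor//.
have -> : (\prod_(j < 3) \int[mu]_(t in `[0%R, 1%R[) f j t =
   \prod_(j < 3) (\int[mu]_(t in `[0%R, 1%R[) (vp n (coord j y - t) * \1_(`]a j, b j]%classic) t)%R)%:E)%E.
  by apply: eq_bigr => j _; apply/esym/fineK; apply: integrable_fin_num => //; exact: fi.
by rewrite prodEFin.
Qed.

Lemma conv_box_cvg a b : {ae leb3, forall y : vec3 (measurableTypeR R), torus_cell y ->
  conv n (box_indic a b) y @[n --> \oo] --> box_indic a b y}.
Proof.
have H c : {ae leb3, forall y : vec3 (measurableTypeR R), forall j : 'I_3, coord j y != c j}.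
  by apply: filter_forall => j; exact: ae_coord_neq.
(* The points left out have a coordinate equal to 0 or lie in the plane of a face of the box; the
   others are in the open unit cube, where the one-dimensional limit holds. *)
apply: filterS3 (H (fun=> 0)) (H a) (H b) => y y0 ya yb cy.
have -> : (fun n => conv n (box_indic a b) y) = (fun n => \prod_(j < 3)
    \int[mu]_(t in `[0, 1[) (vp n (coord j y - t) * \1_(`]a j, b j]%classic) t)).
  by apply/funext => n; exact: conv_box.
have Hj (j : 'I_3) : \int[mu]_(t in `[0, 1[) (vp n (coord j y - t) * \1_(`]a j, b j]%classic) t)
    @[n --> \oo] --> (\1_(`]a j, b j]%classic) (coord j y) : R).
  apply: vp_itv_cvg => //; have /andP[c0 c1] := cy j.
  by rewrite c1 andbT lt_neqAle eq_sym y0.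
rewrite /box_indic big3; under eq_fun do rewrite big3.
by apply: cvgM; [exact: Hj|apply: cvgM; exact: Hj].
Qed.

(** The kernel is nonnegative of mean 1, so bounds by constants are preserved. This provides the
    domination needed to pass to the limit against an integrable function. *)
Lemma conv_box01 a b n y : 0 <= conv n (box_indic a b) y <= 1.
Proof.
have mc := @measurable_torus_cell R.
have b0 x := box_indic01 a b x.
have k0 := kern_ge0 (fun=> n) y.
rewrite Rintegral_ge0 => [|x _]; last first.
  by have /andP[? _] := b0 x; rewrite mulr_ge0.
have bk x : `|kern (fun=> n) y x| <= \prod_(j < 3) vpc R n.
  exact: kern_bounded (y, x).
have i1 := integrable_cell1.
have mk : measurable_fun torus_cell (kern (fun=> n) y).
  by apply: measurable_funTS; exact: measurable_kern2.
have one : \int[leb3]_(x in torus_cell) (1 * kern (fun=> n) y x) = 1.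
  pose f (j : 'I_3) (t : R) : \bar R := (vp n (coord j y - t))%:E.
  rewrite /Rintegral; have -> : (\int[leb3]_(x in torus_cell) (1 * kern (fun=> n) y x)%:E =
    \int[leb3]_(x in torus_cell) \prod_(j < 3) f j (coord j x))%E.
    by apply: eq_integral => x _; rewrite mul1r /f prodEFin.
  rewrite integral_cell_tensor.
  - by rewrite big1// => j _; exact: integral_vp.
  - move=> j; apply/measurable_EFinP.
    apply: (measurableT_comp (continuous_measurable_fun (@continuous_vp R n))).
    exact: measurable_funB.
  - by move=> j t; rewrite lee_fin vp_ge0.
rewrite /= -[leRHS]one; apply: le_Rintegral => //.
- apply: (integrable_bounded_mul _ (integrable_box_indic a b) mk) => // x _; exact: bk.
- apply: (integrable_bounded_mul _ i1 mk) => // x _; exact: bk.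
- by move=> x _; have /andP[? ?] := b0 x; rewrite ler_wpM2r.
Qed.

End convolution.

Section sobolev.
Variable R : realType.
Implicit Types (g U : vec3 R -> R).

Lemma integrable_cell_bounded U M : measurable_fun torus_cell U ->
  (forall x, torus_cell x -> `|U x| <= M) ->
  leb3.-integrable torus_cell (EFin \o U).
Proof.
move=> mU UM; have mc := @measurable_torus_cell R.
have := integrable_bounded_mul mc (@integrable_cell1 R) mU UM.
by under [X in is_true (integrable _ _ X) -> _]eq_fun do rewrite mul1r.
Qed.

(* By symmetry of the kernel the convolutions are moved onto indicators of boxes,
   on which they converge almost everywhere. *)
Lemma conv_limit_ae g U M : leb3.-integrable torus_cell (EFin \o g) ->
  measurable_fun torus_cell U ->
  (forall x, torus_cell x -> conv n g x @[n --> \oo] --> U x) ->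
  (forall n x, torus_cell x -> `|conv n g x| <= M) ->
  {ae leb3, forall x : vec3 (measurableTypeR R), torus_cell x -> g x = U x}.
Proof.
move=> gi mU gU gM; have mc := @measurable_torus_cell R.
have UM x : torus_cell x -> `|U x| <= M.
  move=> cx; apply: (cvgr_to_le (cvg_norm (gU x cx))).
  by apply: nearW => n; exact: gM.
have Ui := integrable_cell_bounded mU UM.
have gm : measurable_fun torus_cell g by apply/measurable_EFinP; exact: measurable_int gi.
have gUi : leb3.-integrable torus_cell (EFin \o (g \- U)).
  by have := integrableB mc gi Ui.
have mbox al be : measurable_fun (torus_cell : set (vec3 (measurableTypeR R))) (box_indic al be).
  by apply: measurable_funTS; exact: measurable_box_indic.
have box_int (f : vec3 R -> R) al be : leb3.-integrable torus_cell (EFin \o f) ->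
    leb3.-integrable torus_cell (EFin \o (fun x => f x * box_indic al be x)).
  move=> fi; apply: (integrable_bounded_mul mc fi (mbox al be) (M := 1)).
  by move=> x _; have /andP[x0 x1] := box_indic01 al be x; rewrite ger0_norm.
(* One and the same sequence is read on the two sides of [conv_swap]. Dominated convergence, with
   bounds |g| on one side and M on the other, gives it the limits of integral g 1_box and integral U
   1_box. *)
have box0 al be : \int[leb3]_(x in torus_cell) ((g x - U x) * box_indic al be x) = 0.
  have lim1 : \int[leb3]_(y in torus_cell) (g y * conv n (box_indic al be) y) @[n --> \oo]
      --> \int[leb3]_(y in torus_cell) (g y * box_indic al be y).
    apply: (@dominated_Rintegral _ _ R leb3 torus_cell
      (fun n y => g y * conv n (box_indic al be) y) (fun y => g y * box_indic al be y)
      (fun y => `|g y|) mc).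
    - move=> n; apply: measurable_funM => //.
      by apply: measurable_conv; exact: integrable_box_indic.
    - exact: measurable_funM.
    - apply: filterS (conv_box_cvg al be) => y /= + cy => /(_ cy) h.
      by apply: cvgMr; exact: h.
    - exact: integrable_norm.
    - move=> n y _; rewrite normrM ler_piMr//.
      by have /andP[c0 c1] := conv_box01 al be n y; rewrite ger0_norm.
  have lim2 : \int[leb3]_(x in torus_cell) (box_indic al be x * conv n g x) @[n --> \oo]
      --> \int[leb3]_(x in torus_cell) (box_indic al be x * U x).
    apply: (@dominated_Rintegral _ _ R leb3 torus_cell
      (fun n x => box_indic al be x * conv n g x) (fun x => box_indic al be x * U x)
      (fun=> M) mc).
    - move=> n; apply: measurable_funM => //; exact: measurable_conv.
    - exact: measurable_funM.
    - by apply: aeW => x cx; apply: cvgMr; exact: gU.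
    - exact: (integrable_cell_bounded (M := `|M|)).
    - move=> n x cx; rewrite normrM (le_trans _ (gM n x cx))// ler_piMl//.
      by have /andP[c0 c1] := box_indic01 al be x; rewrite ger0_norm.
  have swap n := (conv_swap n gi (integrable_box_indic al be)).2.
  have E : \int[leb3]_(y in torus_cell) (g y * box_indic al be y) =
      \int[leb3]_(x in torus_cell) (box_indic al be x * U x).
    rewrite -(funext swap) in lim1.
    have e1 := cvg_lim (@Rhausdorff R) lim1; have e2 := cvg_lim (@Rhausdorff R) lim2.
    exact: (etrans (esym (e1 _)) (e2 _)).
  under eq_Rintegral do rewrite mulrBl.
  rewrite RintegralB//; [|exact: box_int|exact: box_int].
  apply/eqP; rewrite subr_eq0 E; apply/eqP.
  by apply: eq_Rintegral => x _; rewrite mulrC.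
have int0 E : measurable E -> (\int[leb3]_(x in torus_cell `&` E) (g x - U x)%:E = 0)%E.
  move: E; apply: integral_leb3_box_eq0 => // a b c.
  pose al (j : 'I_3) := [:: a.1; b.1; c.1]`_j.
  pose be (j : 'I_3) := [:: a.2; b.2; c.2]`_j.
  rewrite -!setIA integral_mkcondr.
  have bi := box_int _ al be gUi.
  have H0 := congr1 EFin (box0 al be).
  rewrite /Rintegral fineK in H0; last exact: (integrable_fin_num mc bi).
  rewrite -[RHS]H0; apply: eq_integral => x _.
  rewrite patchE /box_indic big3 /= !indicE !in_setI.
  rewrite -[x \in (fun v => v.1.1) @^-1` _]/(x.1.1 \in `]a.1, a.2]%classic).
  rewrite -[x \in (fun v => v.1.2) @^-1` _]/(x.1.2 \in `]b.1, b.2]%classic).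
  rewrite -[x \in snd @^-1` _]/(x.2 \in `]c.1, c.2]%classic).
  rewrite /al /be /=.
  case: (_ \in _); case: (_ \in _); case: (_ \in _); by rewrite /= ?mulr0 ?mul0r ?mulr0 ?mulr1.
have mgU : measurable_fun (torus_cell : set (vec3 (measurableTypeR R))) (EFin \o (g \- U)).
  exact: measurable_int gUi.
have := @integral_ae_eq _ _ _ leb3 _ mc (cst 0%E) _ gUi (measurable_cst _).
move=> H; apply: filterS (H _) => [x /= h /h|E Ecell mE].
  by move=> -[] /eqP; rewrite subr_eq0 => /eqP.
rewrite integral0 -[RHS](int0 E mE); congr integral.
by rewrite setIidr.
Qed.
End sobolev.

Section sobolev_limit.
Variable R : realType.
Implicit Types (g U : vec3 R -> R).

Lemma kern_lip n : exists2 L : R, 0 <= L &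
  forall x x' y : vec3 R, `|kern (fun=> n) x y - kern (fun=> n) x' y| <= L * `|x - x'|.
Proof.
have [L L0 HL] := @vp_lip R n.
pose C := vpc R n; have C0 : 0 < C := vpc_gt0 R n.
exists (3 * (L * C ^+ 2)); first by rewrite !mulr_ge0 ?exprn_ge0 ?(ltW C0).
move=> x x' y; rewrite /kern /tens !big3 /=.
have d (j : 'I_3) : `|vp n (coord j x - coord j y) - vp n (coord j x' - coord j y)| <= L * `|x - x'|.
  apply: le_trans (HL _ _) _; rewrite ler_wpM2l// (_ : _ - _ = coord j (x - x')) ?coord_lip//.
  by rewrite -[x - x']/(x + (- x')) -[- x']scaleN1r coordD coordZ; ring.
have b (j : 'I_3) z : `|vp n (coord j z - coord j y)| <= C.
  by rewrite ger0_norm ?vp_ge0// vp_le.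
move: (d ord0) (d (lift ord0 ord0)) (d (lift ord0 (lift ord0 ord0))).
move: (b ord0 x') (b (lift ord0 ord0) x) (b (lift ord0 ord0) x') (b (lift ord0 (lift ord0 ord0)) x).
move: (vp n _) (vp n _) (vp n _) (vp n _) (vp n _) (vp n _) => a1 b1 a2 a3 b2 b3.
move=> hb3 hb2 ha3 ha2 d1 d2 d3.
have -> : b1 * (b2 * a2) - b3 * (a3 * a1) =
    (b1 - b3) * (b2 * a2) + b3 * ((b2 - a3) * a2) + b3 * (a3 * (a2 - a1)) by ring.
have -> : 3 * (L * C ^+ 2) * `|x - x'| =
    (L * `|x - x'|) * (C * C) + C * ((L * `|x - x'|) * C) + C * (C * (L * `|x - x'|)) by ring.
rewrite (le_trans (ler_normD _ _))// lerD// ?(le_trans (ler_normD _ _))// ?lerD// !normrM;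
  by rewrite !ler_pM// mulr_ge0.
Qed.

(** The Lipschitz constant of the kernel in [x] is uniform in [y], hence survives integration
    against [g]. *)
Lemma conv_continuous n g : leb3.-integrable torus_cell (EFin \o g) -> continuous (conv n g).
Proof.
move=> gi; have mc := @measurable_torus_cell R.
have [L L0 HL] := kern_lip n.
have gk x : leb3.-integrable torus_cell (fun y => (g y * kern (fun=> n) x y)%:E).
  apply: (integrable_bounded_mul mc gi (M := \prod_(j < 3) vpc R n)).
    by apply: measurable_funTS; exact: measurable_kern2.
  by move=> y _; exact: (kern_bounded (fun=> n) (x, y)).
pose I := \int[leb3]_(y in torus_cell) `|g y|.
have I0 : 0 <= I by exact: Rintegral_ge0.
have lip x x' : `|conv n g x - conv n g x'| <= L * `|x - x'| * I.
  have nrm : leb3.-integrable torus_cell (EFin \o (fun y => `|g y|)) by exact: integrable_norm.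
  rewrite /conv -RintegralB//; [|exact: gk|exact: gk].
  have dk : leb3.-integrable torus_cell
     (EFin \o (fun y => g y * kern (fun=> n) x y - g y * kern (fun=> n) x' y)).
    by have := integrableB mc (gk x) (gk x').
  apply: le_trans (le_normr_Rintegral mc dk) _.
  rewrite -RintegralZl//; apply: le_Rintegral => //.
  - exact: integrable_norm.
  - by under [X in integrable _ _ X]eq_fun do rewrite /= EFinM; exact: integrableZl.
  - by move=> y _; rewrite -mulrBr normrM mulrC ler_wpM2r.
move=> x; apply/cvgrPdist_lt => e e0.
have LI : 0 < L * I + 1 by rewrite ltr_wpDl// mulr_ge0.
near=> x'.
apply: le_lt_trans (lip _ _) _.
rewrite mulrAC; apply: (@le_lt_trans _ _ ((L * I + 1) * `|x - x'|)).
  by rewrite ler_wpM2r// lerDl.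
rewrite -ltr_pdivlMl// mulrC.
near: x'; have d0 : 0 < e / (L * I + 1) by rewrite divr_gt0.
by apply: cvgr_dist_lt.
Unshelve. all: by end_near. Qed.

Lemma conv_periodic n g : torus_periodic (conv n g).
Proof.
move=> i x; rewrite /conv; apply: eq_Rintegral => y _.
by rewrite !(kernC _ _ y) kern_periodic.
Qed.

(** The steps are summable in telescoped form, uniformly in [x]. So the limit is uniform, which
    gives its continuity, and the distance to [conv 0 g] never exceeds [A * t 0]. *)
Lemma conv_cauchy_limit g (A : R) (t : nat -> R) :
  0 <= A -> leb3.-integrable torus_cell (EFin \o g) -> (forall n, 0 <= t n) ->
  (forall n, t n.+1 <= t n) ->
  (forall x, `|conv 0 g x| <= A) ->
  (forall n x, `|conv n g x - conv n.+1 g x| <= A * (t n - t n.+1)) ->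
  exists U : vec3 R -> R, [/\ continuous U, torus_periodic U,
    forall x, `|U x| <= A * (1 + t 0%N) & {ae leb3, forall x : vec3 (measurableTypeR R), torus_cell x -> g x = U x}].
Proof.
move=> A0 gi t0 tS g0 gS; have mc := @measurable_torus_cell R.
have gnm x n k : `|conv n g x - conv (n + k) g x| <= A * (t n - t (n + k)%N).
  elim: k => [|k IH]; first by rewrite addn0 !subrr normr0 mulr0.
  rewrite addnS (le_trans (ler_distD (conv (n + k) g x) _ _))//.
  apply: le_trans (lerD IH (gS _ _)) _.
  by rewrite -mulrDr addrA subrK.
have tcvg : cvgn t.
  apply: nonincreasing_is_cvgn; first exact/nonincreasing_seqP.
  by exists 0 => _ [n _ <-].
pose l := limn t.
have tl n : l <= t n by apply: nonincreasing_cvgn_ge => //; exact/nonincreasing_seqP.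
have l0 : 0 <= l by apply: limr_ge => //; exact: nearW.
(* Adding [A * t n] makes the sequence nonincreasing, since the assumed bound on a step is the
   decrease of [A * t]. Convergence is then that of a bounded monotone sequence. *)
have scvg x : cvgn (fun n => conv n g x + A * t n).
  apply: nonincreasing_is_cvgn.
    apply/nonincreasing_seqP => n; have := gS n x; rewrite mulrBr ler_norml => /andP[+ _].
    move: (conv n g x) (conv n.+1 g x) (A * t n) (A * t n.+1) => p q r s; lra.
  exists (conv 0 g x - A * t 0%N) => _ [n _ <-].
  have := gnm x 0%N n; rewrite add0n mulrBr ler_norml => /andP[_].
  have := mulr_ge0 A0 (t0 n).
  move: (conv n g x) (conv 0 g x) (A * t n) (A * t 0%N) => p q r s; lra.
pose U x := limn (fun n => conv n g x + A * t n) - A * l.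
have gU x : conv n g x @[n --> \oo] --> U x.
  have -> : (fun n => conv n g x) = (fun n => (conv n g x + A * t n) - A * t n).
    by apply/funext => n; rewrite addrK.
  apply: cvgB; first exact: scvg.
  by apply: cvgMr; exact: tcvg.
have gUn n x : `|conv n g x - U x| <= A * (t n - l).
  apply: (cvgr_to_le (cvg_norm (cvgB (cvg_cst (conv n g x)) (gU x)))).
  near=> k; have nk : (n <= k)%N by near: k; exact: nbhs_infty_ge.
  by rewrite -(subnKC nk) (le_trans (gnm _ _ _))// ler_wpM2l// lerD2l lerN2.
have gM n x : `|conv n g x| <= A * (1 + t 0%N).
  have := gnm x 0%N n; rewrite add0n => h.
  have := ler_normB (conv 0 g x) (conv 0 g x - conv n g x); rewrite subKr.
  have := g0 x; have := mulr_ge0 A0 (t0 n).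
  rewrite mulrBr in h; rewrite mulrDr mulr1; move: h.
  move: `|conv n g x| `|conv 0 g x| `|_ - _| (A * t n) (A * t 0%N) => p q r s u; lra.
have cU : continuous U.
  move=> x; apply/cvgrPdist_lt => e e0.
  have e3 : 0 < e / 3 by rewrite divr_gt0.
  have [n nE] : exists n, A * (t n - l) < e / 3.
    have : A * (t n - l) @[n --> \oo] --> A * (l - l).
      by apply: cvgMr; apply: cvgB; [exact: tcvg|exact: cvg_cst].
    rewrite subrr mulr0 => /cvgr_lt /(_ _ e3) [N _ HN].
    by exists N; apply: HN => /=.
  near=> x'.
  have h : `|conv n g x - conv n g x'| < e / 3.
    by near: x'; apply: cvgr_dist_lt => //; exact: conv_continuous.
  have h1 := le_lt_trans (gUn n x) nE; have h2 := le_lt_trans (gUn n x') nE.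
  move: (conv n g x) (conv n g x') (U x) (U x') h h1 h2 => p q r s.
  rewrite !ltr_norml => /andP[? ?] /andP[? ?] /andP[? ?].
  by apply/andP; split; lra.
exists U; split; first exact: cU.
- move=> i x; rewrite /U.
  have -> : (fun n => conv n g (x + basis R i) + A * t n) = (fun n => conv n g x + A * t n).
    by apply/funext => n; rewrite conv_periodic.
  by [].
- move=> x; apply: (cvgr_to_le (cvg_norm (gU x))).
  by apply: nearW => n; exact: gM.
- apply: (conv_limit_ae gi _ (fun x _ => gU x) (fun n x _ => gM n x)).
  apply: (measurable_fun_cvg (h := fun n => conv n g)) => [n|x _]; last exact: gU.
  exact: measurable_conv.
Unshelve. all: by end_near. Qed.
End sobolev_limit.

(** * Continuity of velocity moments *)

Section slice.
Variable R : realType.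
Implicit Types (u : vec3 R -> R).

Lemma integrable_mul_kern u k x : leb3.-integrable torus_cell (EFin \o u) ->
  leb3.-integrable torus_cell (fun y => (u y * kern k x y)%:E).
Proof.
move=> ui; apply: (integrable_bounded_mul (@measurable_torus_cell R) ui (M := \prod_(j < 3) vpc R (k j))).
  by apply: measurable_funTS; exact: measurable_kern2.
by move=> y _; exact: (kern_bounded k (x, y)).
Qed.

(** Kernels are test functions, so all convolutions of [u \- d] vanish, and their limit 0 is almost
    everywhere [u \- d]. It identifies a slice of [h] with its weak derivative of order zero, which
    is given only through pairings. *)
Lemma slice_ae u d : leb3.-integrable torus_cell (EFin \o u) ->
  leb3.-integrable torus_cell (EFin \o d) ->
  (forall phi : vec3 R -> R, smooth phi -> torus_periodic phi ->
    \int[leb3]_(x in torus_cell) (u x * phi x) = \int[leb3]_(x in torus_cell) (d x * phi x)) ->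
  {ae leb3, forall x : vec3 (measurableTypeR R), torus_cell x -> u x = d x}.
Proof.
move=> ui di H; have mc := @measurable_torus_cell R.
have c0 n x : conv n (u \- d) x = 0.
  rewrite /conv; under eq_Rintegral do rewrite /= mulrBl.
  rewrite RintegralB//; [|exact: integrable_mul_kern|exact: integrable_mul_kern].
  by rewrite H ?subrr//; [exact: kern_smooth|exact: kern_periodic].
have wi : leb3.-integrable torus_cell (EFin \o (u \- d)).
  by have := integrableB mc ui di.
have lim0 x : torus_cell x -> conv n (u \- d) x @[n --> \oo] --> (0 : R).
  by move=> _; under eq_fun do rewrite c0; exact: cvg_cst.
have bd n x : torus_cell x -> `|conv n (u \- d) x| <= 0 by rewrite c0 normr0.
have W := conv_limit_ae wi (measurable_cst _) lim0 bd.
by apply: filterS W => x /= h /h /eqP; rewrite subr_eq0 => /eqP.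
Qed.

Lemma Rintegral_lincomb3 u (p : 'I_3 -> vec3 R -> R) (a : R) :
  (forall i, leb3.-integrable torus_cell (EFin \o (fun y => u y * p i y))) ->
  \int[leb3]_(y in torus_cell) (u y * (a * \sum_(i < 3) p i y)) =
  a * \sum_(i < 3) \int[leb3]_(y in torus_cell) (u y * p i y).
Proof.
move=> iP; have mc := @measurable_torus_cell R.
pose f i y := u y * p i y.
have i2 : leb3.-integrable torus_cell
    (EFin \o (fun y => f (lift ord0 ord0) y + f (lift ord0 (lift ord0 ord0)) y)).
  exact: (integrableD mc (iP _) (iP _)).
have i1 : leb3.-integrable torus_cell
    (EFin \o (fun y => f ord0 y + (f (lift ord0 ord0) y + f (lift ord0 (lift ord0 ord0)) y))).
  exact: (integrableD mc (iP ord0) i2).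
rewrite !big_ord_recl big_ord0 addr0 -(RintegralD mc (iP _) (iP _)) -(RintegralD mc (iP ord0) i2).
rewrite -(RintegralZl a mc i1); apply: eq_Rintegral => y _.
by rewrite !big_ord_recl big_ord0 addr0 /f; ring.
Qed.

(** The difference of kernels is a sum of three second derivatives, which move onto [u];
    Cauchy-Schwarz and [kern_L2] bound each term by c_{n+1}^(3/2) times [B]. The constant is 48 = 3
    * 16, with the 16 of [vp_step]. The bound [B] may be +oo, as the norm of a slice can be. *)
Lemma slice_step u (d : 'I_3 -> vec3 R -> R) (B : \bar R) n x :
  leb3.-integrable torus_cell (EFin \o u) ->
  (forall i, leb3.-integrable torus_cell (EFin \o d i)) ->
  (forall i (phi : vec3 R -> R), smooth phi -> torus_periodic phi ->
    \int[leb3]_(x in torus_cell) (u x * partials [:: i; i] phi x) =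
    \int[leb3]_(x in torus_cell) (d i x * phi x)) ->
  (forall i, (sqrte (\int[leb3]_(x in torus_cell) (d i x ^+ 2)%:E) <= B)%E) ->
  (`|\int[leb3]_(y in torus_cell) (u y * (kern (fun=> n) x y - kern (fun=> n.+1) x y))|%:E <=
    (48 * ((Num.sqrt (vpc R n))^-1 - (Num.sqrt (vpc R n.+1))^-1))%:E * B)%E.
Proof.
move=> ui di H dB; have mc := @measurable_torus_cell R.
pose K : R := 4 * pi ^+ 2 * n.+1%:R ^+ 2.
have K0 : 0 < K by rewrite !mulr_gt0 ?exprn_gt0 ?pi_gt0.
pose G i := \int[leb3]_(y in torus_cell) (d i y * kern (hyb n i) x y).
(* By the discrete heat equation the second derivative of the kernel is a combination of bounded
   kernels. *)
have iP i : leb3.-integrable torus_cell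
    (EFin \o (fun y => u y * partials [:: i; i] (kern (hyb n i) x) y)).
  rewrite (_ : _ \o _ = (fun y => (K * (u y * kern (hyb' n i) x y - u y * kern (hyb n i) x y))%:E)).
    under [X in integrable _ _ X]eq_fun do rewrite EFinM.
    apply: integrableZl => //.
    under [X in integrable _ _ X]eq_fun do rewrite EFinB.
    by apply: integrableB => //; exact: integrable_mul_kern.
  apply/funext => y.
  rewrite -[LHS]/((u y * partials [:: i; i] (kern (hyb n i) x) y)%:E) partials_kern -/K.
  by congr EFin; ring.
have -> : \int[leb3]_(y in torus_cell) (u y * (kern (fun=> n) x y - kern (fun=> n.+1) x y)) =
    K^-1 * \sum_(i < 3) G i.
  rewrite (_ : \sum_(i < 3) G i = \sum_(i < 3) \int[leb3]_(y in torus_cell)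
      (u y * partials [:: i; i] (kern (hyb n i) x) y)); last first.
    apply: eq_bigr => i _; apply/esym; apply: H; first exact: kern_smooth.
    exact: kern_periodic.
  rewrite -(Rintegral_lincomb3 K^-1 iP); apply: eq_Rintegral => y _.
  by rewrite kern_diff.
have B0 : (0 <= B)%E by exact: le_trans (sqrte_ge0 _) (dB ord0).
have GB i : (`|G i|%:E <= (vpc R n.+1 * Num.sqrt (vpc R n.+1))%:E * B)%E.
  have dk := integrable_mul_kern (hyb n i) x (di i).
  rewrite EFin_normr_Rintegral//.
  apply: le_trans (le_abse_integral _ mc _) _; first exact: measurable_int dk.
  have md : measurable_fun torus_cell (d i).
    by apply/measurable_EFinP; exact: measurable_int (di i).
  have mk : measurable_fun torus_cell (kern (hyb n i) x).
    by apply: measurable_funTS; exact: measurable_kern2.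
  have hcs := integral_cauchy_schwarz leb3 mc md mk.
  apply: (le_trans hcs).
  rewrite muleC; apply: lee_pmul => //; first exact: sqrte_ge0.
    exact: sqrte_ge0.
  have v0 := vpc_gt0 R n.+1.
  have -> : (vpc R n.+1 * Num.sqrt (vpc R n.+1))%:E = sqrte (vpc R n.+1 ^+ 3)%:E.
    by rewrite /sqrte exprSr sqrtrM ?exprn_ge0 ?ltW// sqrtr_sqr ger0_norm ?ltW.
  rewrite lee_sqrt; last by rewrite lee_fin exprn_ge0 ?ltW.
  by apply: kern_L2 => j; rewrite /hyb; case: ifP.
rewrite normrM gtr0_norm ?invr_gt0// EFinM.
apply: (@le_trans _ _ (K^-1%:E * ((3 * (vpc R n.+1 * Num.sqrt (vpc R n.+1)))%:E * B))%E).
  rewrite lee_pmul2l ?lte_fin ?invr_gt0//.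
  apply: (@le_trans _ _ (\sum_(i < 3) `|G i|%:E)%E); first by rewrite sumEFin lee_fin ler_norm_sum.
  apply: le_trans (lee_sum _ (fun i _ => GB i)) _.
  rewrite big_const card_ord /= adde0.
  set z := (_ * B)%E.
  have r0 : (0%R <= (vpc R n.+1 * Num.sqrt (vpc R n.+1))%:E)%E.
    by rewrite lee_fin mulr_ge0 ?(ltW (vpc_gt0 _ _))// sqrtr_ge0.
  rewrite /z -ge0_muleDl// -ge0_muleDl ?adde_ge0// -!EFinD.
  by rewrite le_eqVlt; apply/orP; left; apply/eqP; congr (_%:E * _)%E; ring.
rewrite muleA -EFinM lee_wpmul2r// lee_fin.
have r0 : 0 <= vpc R n.+1 * Num.sqrt (vpc R n.+1).
  by rewrite mulr_ge0 ?(ltW (vpc_gt0 _ _))// sqrtr_ge0.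
have step := vp_step R n.
rewrite [leRHS](_ : _ = 3 * (16 * ((Num.sqrt (vpc R n))^-1 - (Num.sqrt (vpc R n.+1))^-1))); last by ring.
apply: (@le_trans _ _ (3 * (vpc R n.+1 * Num.sqrt (vpc R n.+1) / n.+1%:R ^+ 2))); last first.
  by rewrite ler_pM2l.
rewrite [leLHS](_ : _ = 3 * (vpc R n.+1 * Num.sqrt (vpc R n.+1) / K)); last by ring.
rewrite ler_pM2l// ler_wpM2l//.
(* The factor 4 pi^2 >= 1 of [K] is given up. *)
rewrite lef_pV2 ?posrE ?exprn_gt0// ler_peMl ?exprn_ge0//.
have p2 := pi_ge2 R; have : (2 : R) ^+ 2 <= pi ^+ 2 by rewrite ler_pXn2r ?nnegrE ?pi_ge0.
lra.
Qed.
End slice.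

Section moment.
Variable R : realType.
Local Notation V := (vec3 (measurableTypeR R)).
Variables (h : vec3 R * vec3 R -> R) (W : vec3 R -> R).
Hypothesis mh : measurable_fun (phase : set (V * V)) h.
Hypothesis mW : measurable_fun (setT : set V) W.
Hypothesis W0 : forall v, 0 <= W v.

(** Extended by zero outside [phase], so that Fubini's theorem is applied on the whole product and
    the torus appears only in the slices. *)
Let H (p : V * V) : R := ((fun p => h p * W p.2) \_ phase) p.

Lemma measurable_phase : measurable (phase : set (V * V)).
Proof. by apply: measurableX => //; exact: measurable_torus_cell. Qed.

Lemma phaseE (x v : vec3 R) : ((x, v) \in phase) = (x \in torus_cell).
Proof. by rewrite in_setX in_setT andbT. Qed.

Lemma phase_mulE x v : H (x, v) = ((fun x => h (x, v)) \_ torus_cell) x * W v.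
Proof. by rewrite /H !patchE phaseE; case: ifP; rewrite ?mul0r. Qed.

Lemma measurable_phase_mul : measurable_fun setT H.
Proof.
have m1 : measurable_fun (phase : set (V * V)) (fun p => h p * W p.2).
  apply: measurable_funM => //; apply: measurable_funTS.
  exact: (measurableT_comp mW measurable_snd).
exact: (measurable_restrictT _ measurable_phase).1.
Qed.

Lemma measurable_slice v : measurable_fun (torus_cell : set V) (fun x => h (x, v)).
Proof.
have m2 : measurable_fun (setT : set V) (fun x : V => (x, v) : V * V) by exact: measurable_pair2.
have m1 := (measurable_restrictT _ measurable_phase).1 mh.
apply: (measurable_restrictT _ (@measurable_torus_cell R)).2.
have -> : (fun x : V => h (x, v)) \_ torus_cell = (h \_ phase) \o (fun x : V => (x, v)).
  by apply/funext => x /=; rewrite !patchE phaseE.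
exact: (measurableT_comp m1 m2).
Qed.

Definition moment (x : vec3 R) : R := \int[leb3]_v (h (x, v) * W v).

Lemma moment_cellE x : torus_cell x -> moment x = \int[leb3]_v H (x, v).
Proof.
move=> cx; apply: eq_Rintegral => v _; rewrite phase_mulE patchE.
by rewrite mem_set.
Qed.

(** Tonelli, integrating first in x: almost every slice has L^1 norm at most [G v], and [G] is
    integrable against the weight. *)
Lemma integrable_phase_mul (G : V -> \bar R) (N : R) :
  measurable_fun setT G -> (forall v, 0 <= G v)%E ->
  {ae leb3, forall v : V, (\int[leb3]_(x in torus_cell) `|h (x, v)|%:E <= G v)%E} ->
  (\int[leb3]_v (G v * (W v)%:E) <= N%:E)%E ->
  (leb3 \x leb3)%E.-integrable setT (EFin \o H).
Proof.
move=> mG G0 hG GN; apply/integrableP; split.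
  by apply/measurable_EFinP; exact: measurable_phase_mul.
have mnH : measurable_fun setT (fun p => (`|H p|%:E)%E).
  by apply/measurable_EFinP; apply: measurableT_comp => //; exact: measurable_phase_mul.
rewrite (fubini_tonelli2 (m1 := leb3) (m2 := leb3) (fun p => (`|H p|%:E)%E))//.
apply: le_lt_trans (ltry N); apply: le_trans GN.
apply: ae_ge0_le_integral => //.
- by move=> v _; exact: integral_ge0.
- exact: (measurable_fun_fubini_tonelli_G (m1 := leb3) (fun p => (`|H p|%:E)%E)).
- by move=> v _; apply: mule_ge0 => //; rewrite lee_fin.
- by apply: emeasurable_funM => //; exact/measurable_EFinP.
apply: filterS hG => v hv _; rewrite /fubini_G.
have mhn : measurable_fun (torus_cell : set V) (fun x => (`|h (x, v)|%:E)%E).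
  by apply/measurable_EFinP; apply: measurableT_comp => //; exact: measurable_slice.
have -> : (\int[leb3]_x `|H (x, v)|%:E = (\int[leb3]_(x in torus_cell) `|h (x, v)|%:E) * (W v)%:E)%E.
  rewrite [in RHS]integral_mkcond -ge0_integralZr//.
  - apply: eq_integral => x _; rewrite phase_mulE !patchE; case: ifP => _.
      by rewrite normrM (ger0_norm (W0 v)).
    by rewrite mul0r normr0 mul0e.
  - exact: ((measurable_restrictT _ (@measurable_torus_cell R)).1 mhn).
  - by move=> x _; apply: erestrict_ge0.
  - by rewrite lee_fin.
by apply: lee_wpmul2r; rewrite ?lee_fin.
Qed.

Hypothesis iH : (leb3 \x leb3)%E.-integrable setT (EFin \o H).

Lemma integrable_moment : leb3.-integrable torus_cell (EFin \o moment).
Proof.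
have mc := @measurable_torus_cell R.
have iF := integrable_fubini_F iH.
have mF : measurable_fun setT (fubini_F leb3 (EFin \o H)) := measurable_int _ iF.
have E : {in (torus_cell : set V), (fun x => (fine (fubini_F leb3 (EFin \o H) x))%:E) =1 EFin \o moment}.
  by move=> x /set_mem cx; rewrite /= (moment_cellE cx).
suff : leb3.-integrable torus_cell (fun x => (fine (fubini_F leb3 (EFin \o H) x))%:E).
  exact: (@eq_integrable _ _ _ leb3 _ mc _ _ E).
apply: (@le_integrable _ _ _ leb3 _ mc _ (fubini_F leb3 (EFin \o H))).
- apply/measurable_EFinP; apply: measurable_funTS.
  have mf : measurable_fun setT (@fine R) by apply: fine_measurable.
  exact: (measurableT_comp mf mF).
(* Infinite values are sent to 0 by [fine], which therefore never increases the absolute value. *)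
- by move=> x _; case: (fubini_F _ _ _) => [r| |] //=; rewrite normr0 leey.
- exact: integrableS iF.
Qed.

(* By Fubini the left-hand side is an integral over v of pairings of slices. *)
Lemma moment_pairing_le (G : V -> \bar R) (N M s : R) (k : V -> R) :
  measurable_fun setT G -> (forall v, 0 <= G v)%E ->
  (\int[leb3]_v (G v * (W v)%:E) <= N%:E)%E -> 0 <= s ->
  measurable_fun setT k -> (forall x, `|k x| <= M) ->
  {ae leb3, forall v : V,
    leb3.-integrable torus_cell (fun x => (h (x, v) * k x)%:E) /\
    (`|\int[leb3]_(x in torus_cell) (h (x, v) * k x)|%:E <= s%:E * G v)%E} ->
  `|\int[leb3]_(x in torus_cell) (moment x * k x)| <= s * N.
Proof.
move=> mG G0 GN s0 mk kM hk; have mc := @measurable_torus_cell R.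
have iHk : (leb3 \x leb3)%E.-integrable setT (fun p => (H p * k p.1)%:E).
  apply: (integrable_bounded_mul _ iH (M := M)) => //.
  exact: (measurableT_comp mk measurable_fst).
have mik : leb3.-integrable torus_cell (fun x => (moment x * k x)%:E).
  apply: (integrable_bounded_mul mc integrable_moment (M := M)) => //.
  exact: measurable_funTS.
(* The moment is a real integral; it is compared with the extended one at the points x where the
   slice in v is integrable, hence almost everywhere. *)
have E1 : (\int[leb3]_(x in torus_cell) (moment x * k x)%:E =
    \int[leb3]_x \int[leb3]_v (H (x, v) * k x)%:E)%E.
  rewrite integral_mkcond; apply: ae_eq_integral => //.
  - exact: ((measurable_restrictT _ mc).1 (measurable_int _ mik)).
  - exact: measurable_fubini_F iHk.
  apply: filterS (ae_integrable1 iH) => x ix _ /=.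
  rewrite patchE; case: ifPn => [/set_mem cx|cx]; last first.
    by rewrite integral0_eq// => v _; rewrite phase_mulE patchE (negbTE cx) !mul0r.
  rewrite (moment_cellE cx) mulrC EFinM fineK; last exact: integrable_fin_num ix.
  rewrite -integralZl//; apply: eq_integral => v _.
  by rewrite -EFinM mulrC.
have E2 := Fubini iHk; rewrite /fubini_F /fubini_G /= in E2.
rewrite -lee_fin EFin_normr_Rintegral// E1 E2.
have mGk := measurable_fubini_G iHk.
apply: le_trans (le_abse_integral _ measurableT _) _; first exact: mGk.
rewrite EFinM; apply: (@le_trans _ _ (s%:E * \int[leb3]_v (G v * (W v)%:E))%E); last first.
  by rewrite lee_wpmul2l ?lee_fin.
have mGW : measurable_fun setT (fun v => G v * (W v)%:E)%E.
  by apply: emeasurable_funM => //; exact/measurable_EFinP.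
have GW0 v : (0 <= G v * (W v)%:E)%E by apply: mule_ge0 => //; rewrite lee_fin.
rewrite -ge0_integralZl//.
apply: ae_ge0_le_integral => //.
- by apply: measurableT_comp => //; exact: mGk.
- by move=> v _; apply: mule_ge0; [rewrite lee_fin|exact: GW0].
- exact: measurable_funeM.
apply: filterS hk => v [hi hv] _; rewrite /fubini_G /=.
have -> : (\int[leb3]_x (H (x, v) * k x)%:E =
    \int[leb3]_(x in torus_cell) (W v * (h (x, v) * k x))%:E)%E.
  rewrite [RHS]integral_mkcond; apply: eq_integral => x _.
  rewrite phase_mulE !patchE; case: ifP; rewrite ?mul0r// => _.
  by congr EFin; ring.
under [X in (`|X| <= _)%E]eq_integral do rewrite EFinM.
rewrite integralZl// -(fineK (integrable_fin_num mc hi)) -EFinM /=.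
rewrite normrM (ger0_norm (W0 v)) EFinM muleC muleA; apply: lee_wpmul2r => //.
by rewrite lee_fin.
Qed.
End moment.

Section velocity_weight.
Variable R : realType.
Local Notation V := (vec3 (measurableTypeR R)).

Lemma enorm_ge0 (v : vec3 R) : 0 <= enorm v.
Proof. exact: sqrtr_ge0. Qed.

Lemma enorm_sqr (v : vec3 R) : enorm v ^+ 2 = dot v v.
Proof. by rewrite sqr_sqrtr// sumr_ge0// => i _; rewrite -expr2 sqr_ge0. Qed.

Lemma measurable_enorm_sqr : measurable_fun (setT : set V) (fun v => enorm v ^+ 2).
Proof.
under eq_fun do rewrite enorm_sqr /dot.
apply: measurable_sum => i; apply: measurable_funM; exact: measurable_coord.
Qed.

Lemma measurable_enorm : measurable_fun (setT : set V) (@enorm R).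
Proof.
have -> : @enorm R = Num.sqrt \o (fun v => enorm v ^+ 2).
  by apply/funext => v; rewrite /= sqrtr_sqr ger0_norm// enorm_ge0.
apply: measurableT_comp measurable_enorm_sqr.
exact: (continuous_measurable_fun (@sqrt_continuous R)).
Qed.

Lemma measurable_bracket q : measurable_fun (setT : set V) (bracket q).
Proof.
apply: (measurableT_comp (measurable_powR _)).
by apply: measurable_funD => //; exact: measurable_enorm_sqr.
Qed.

Lemma enorm_sqr_le_bracket q (v : vec3 R) : 2 <= q -> enorm v ^+ 2 <= bracket q v.
Proof.
move=> q2; have v0 : 0 <= enorm v ^+ 2 by exact: sqr_ge0.
apply: (@le_trans _ _ ((1 + enorm v ^+ 2) `^ 1)).
  by rewrite powRr1 ?addr_ge0// lerDr.
by rewrite ler_powR ?lerDl// ler_pdivlMr// mul1r.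
Qed.

Lemma bracket_ge0 q (v : vec3 R) : 0 <= bracket q v.
Proof. exact: powR_ge0. Qed.

End velocity_weight.

Section sobolev_moment.
Variable R : realType.
Local Notation V := (vec3 (measurableTypeR R)).
Implicit Types (D : seq 'I_3 -> vec3 R * vec3 R -> R).

(** The integrand is extended by zero so that its partial integral is measurable by Tonelli; the
    square root is then the power 1/2. *)
Lemma measurable_grad_L2 D j :
  (forall al : j.-tuple 'I_3, measurable_fun (phase : set (V * V)) (D al)) ->
  measurable_fun (setT : set V) (grad_L2 D j).
Proof.
move=> mD; pose S (p : V * V) := \sum_(al : j.-tuple 'I_3) D al p ^+ 2.
have mS : measurable_fun (phase : set (V * V)) S.
  by apply: measurable_sum => al; exact: measurable_funX.
have S0 p : 0 <= S p by apply: sumr_ge0 => al _; exact: sqr_ge0.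
pose Sr : V * V -> \bar R := EFin \o (S \_ phase).
have mSr : measurable_fun setT Sr.
  by apply/measurable_EFinP; exact: ((measurable_restrictT _ (@measurable_phase R)).1 mS).
have Sr0 p : (0 <= Sr p)%E by rewrite lee_fin patchE; case: ifP.
have -> : grad_L2 D j = (fun x => poweR x 2^-1) \o fubini_G leb3 Sr.
  apply/funext => v; rewrite /= /grad_L2 poweR12_sqrt; last first.
    by apply: integral_ge0 => x _; exact: Sr0.
  congr sqrte; rewrite /fubini_G [LHS]integral_mkcond; apply: eq_integral => x _.
  by rewrite /Sr /= !patchE phaseE; case: ifP.
apply: (measurableT_comp (measurable_poweR _)).
exact: (measurable_fun_fubini_tonelli_G (m1 := leb3) Sr).
Qed.

Lemma grad_L2_ge0 D j (v : vec3 R) : (0 <= grad_L2 D j v)%E.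
Proof. exact: sqrte_ge0. Qed.

Lemma grad_L2_ge D j (al : j.-tuple 'I_3) (v : vec3 R) :
  (forall be : j.-tuple 'I_3, measurable_fun (phase : set (V * V)) (D be)) ->
  (sqrte (\int[leb3]_(x in torus_cell) (D al (x, v) ^+ 2)%:E) <= grad_L2 D j v)%E.
Proof.
move=> mD; rewrite /grad_L2 lee_sqrt; last first.
  by apply: integral_ge0 => x _; rewrite lee_fin sumr_ge0// => be _; exact: sqr_ge0.
have mDv (be : j.-tuple 'I_3) : measurable_fun (torus_cell : set V) (fun x => D be (x, v)).
  exact: (measurable_slice (mD be)).
apply: ge0_le_integral => //.
- exact: measurable_torus_cell.
- by move=> x _; rewrite lee_fin sqr_ge0.
- by apply/measurable_EFinP; exact: measurable_funX.
- apply/measurable_EFinP; apply: measurable_sum => be.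
  by apply: measurable_funX; exact: mDv.
- move=> x _; rewrite lee_fin (bigD1 al)//= lerDl sumr_ge0// => be _; exact: sqr_ge0.
Qed.

Local Notation W := (fun v : vec3 R => enorm v ^+ 2).

(** The embedding in continuous functions for the energy. Two orders of the norm are used: order 0
    for integrability and for the convolution with the constant kernel, order 2 for the steps from
    [n] to [n.+1]. *)
Lemma sobolev_moment (m : nat) (q N : R) (h : vec3 R * vec3 R -> R) :
  (2 <= m)%N -> 2 <= q -> 0 <= N -> (sob_norm m q h < N%:E)%E ->
  (leb3 \x leb3)%E.-integrable setT (EFin \o ((fun p : V * V => h p * W p.2) \_ phase)) /\
  exists U : vec3 R -> R, [/\ continuous U, torus_periodic U,
    forall x, `|U x| <= 49 * N &
    {ae leb3, forall x : V, torus_cell x -> moment h W x = U x}].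
Proof.
(* The norm is an infimum, so the strict inequality is what produces a family [D] of weak
   derivatives whose weighted norms sum to less than [N]. *)
move=> m2 q2 N0 /ereal_inf_lt[_ [mh [D gD ->]] sumN].
have mc := @measurable_torus_cell R.
have mh' : measurable_fun (phase : set (V * V)) h by exact: mh.
have mW := @measurable_enorm_sqr R.
have W0 (v : vec3 R) : 0 <= W v by exact: sqr_ge0.
have mD j : (j <= m)%N -> forall al : j.-tuple 'I_3, measurable_fun (phase : set (V * V)) (D al).
  by move=> jm al; have [] := gD al _; rewrite ?size_tuple.
pose G j v := grad_L2 D j v.
have G0 j v : (0 <= G j v)%E by exact: grad_L2_ge0.
have mG j : (j <= m)%N -> measurable_fun (setT : set V) (G j).
  by move=> jm; apply: measurable_grad_L2; exact: mD.
have GN j : (j <= m)%N -> (\int[leb3]_v (G j v * (W v)%:E) <= N%:E)%E.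
  move=> jm; apply: (@le_trans _ _ (\int[leb3]_v (G j v * (bracket q v)%:E))%E).
    apply: ge0_le_integral => //.
    - by move=> v _; apply: mule_ge0 => //; rewrite lee_fin.
    - by apply: emeasurable_funM; [exact: mG|exact/measurable_EFinP].
    - by apply: emeasurable_funM; [exact: mG|apply/measurable_EFinP; exact: measurable_bracket].
    - by move=> v _; apply: lee_wpmul2l => //; rewrite lee_fin enorm_sqr_le_bracket.
  apply: le_trans (ltW sumN); rewrite (bigD1 (Ordinal (jm : j < m.+1)%N))//=.
  rewrite leeDl// sume_ge0// => i _; apply: integral_ge0 => v _.
  by apply: mule_ge0; [exact: grad_L2_ge0|rewrite lee_fin bracket_ge0].
have wdx al : (size al <= m)%N -> {ae leb3, forall v : V,
    [/\ leb3.-integrable torus_cell (fun x => (h (x, v))%:E),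
        leb3.-integrable torus_cell (fun x => (D al (x, v))%:E) &
        forall phi : vec3 R -> R, smooth phi -> torus_periodic phi ->
          \int[leb3]_(x in torus_cell) (h (x, v) * partials al phi x) =
          (-1) ^+ size al * \int[leb3]_(x in torus_cell) (D al (x, v) * phi x)]}.
  by move=> /gD[].
have w0 := wdx [::] isT.
have w2 : {ae leb3, forall (v : V) (i : 'I_3),
    [/\ leb3.-integrable torus_cell (fun x => (h (x, v))%:E),
        leb3.-integrable torus_cell (fun x => (D [:: i; i] (x, v))%:E) &
        forall phi : vec3 R -> R, smooth phi -> torus_periodic phi ->
          \int[leb3]_(x in torus_cell) (h (x, v) * partials [:: i; i] phi x) =
          (-1) ^+ 2 * \int[leb3]_(x in torus_cell) (D [:: i; i] (x, v) * phi x)]}.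
  by apply: filter_forall => i; exact: wdx.
have habs : {ae leb3, forall v : V, leb3.-integrable torus_cell (fun x => (h (x, v))%:E) /\
    (\int[leb3]_(x in torus_cell) `|h (x, v)|%:E <= G 0%N v)%E}.
  (* The slice of [h] is almost everywhere that of [D [::]], and Cauchy-Schwarz against 1 on the
     cell, of measure 1, bounds its L^1 norm by its L^2 norm. *)
  apply: filterS w0 => v [hi di Hphi]; split=> //.
  have hd := slice_ae hi di.
  have {}hd : {ae leb3, forall x : V, torus_cell x -> h (x, v) = D [::] (x, v)}.
    by apply: hd => phi sphi pphi; have := Hphi phi sphi pphi; rewrite /= expr0 mul1r.
  have mDv : measurable_fun (torus_cell : set V) (fun x => D [::] (x, v)).
    by apply/measurable_EFinP; exact: (measurable_int _ di).
  have mhv : measurable_fun (torus_cell : set V) (fun x => h (x, v)).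
    by apply/measurable_EFinP; exact: (measurable_int _ hi).
  have -> : (\int[leb3]_(x in torus_cell) `|h (x, v)|%:E =
      \int[leb3]_(x in torus_cell) `|D [::] (x, v) * 1|%:E)%E.
    apply: ae_eq_integral => //.
    - by apply/measurable_EFinP; exact: measurableT_comp.
    - by apply/measurable_EFinP; apply: measurableT_comp => //; exact: measurable_funM.
    - by apply: filterS hd => x hx cx; rewrite mulr1 hx.
  apply: le_trans (integral_cauchy_schwarz leb3 mc mDv (measurable_cst _)) _.
  have -> : (\int[leb3]_(x in torus_cell) (1 ^+ 2)%:E = 1 :> \bar R)%E.
    by rewrite expr1n integral_cst// mul1e; exact: leb3_torus_cell.
  rewrite [sqrte 1](_ : _ = 1%E) ?mule1; last by rewrite /sqrte sqrtr1.
  exact: (@grad_L2_ge D 0%N [tuple] v (mD 0%N isT)).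
have habs' : {ae leb3, forall v : V,
    (\int[leb3]_(x in torus_cell) `|h (x, v)|%:E <= G 0%N v)%E}.
  by apply: filterS habs => v [].
have iH := integrable_phase_mul mh' mW W0 (mG 0%N isT) (G0 0%N) habs' (GN 0%N isT).
split=> //.
have im := @integrable_moment R h W iH.
(* Chosen so that [t n - t n.+1] is the constant of [slice_step]; as c_0 = 1, [t 0] is 48. *)
pose t n : R := 48 / Num.sqrt (vpc R n).
have st0 n : 0 < Num.sqrt (vpc R n) by rewrite sqrtr_gt0 vpc_gt0.
have vpc0 : vpc R 0 = 1 by rewrite /vpc big_ord0.
have mk n x : measurable_fun (setT : set V) (kern (fun=> n) x) by exact: measurable_kern2.
have bk n (x y : vec3 R) : `|kern (fun=> n) x y| <= \prod_(j < 3) vpc R n.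
  exact: (kern_bounded (fun=> n) (x, y)).
have kern0 (x y : vec3 R) : kern (fun=> 0%N) x y = 1.
  by apply: big1 => j _; rewrite /vp vpc0 double0 expr0 mulr1.
have [||||U [cU pU bU aeU]] := @conv_cauchy_limit R (moment h W) N t N0 im.
- by move=> n; rewrite /t divr_ge0// ltW.
- move=> n; rewrite /t ler_pM2l// lef_pV2 ?posrE//.
  by rewrite ler_wsqrtr// vpc_leS.
- move=> x; rewrite -[leRHS]mul1r /conv.
  apply: (@moment_pairing_le R h W mW W0 iH (G 0%N) N _ 1 _ (mG 0%N isT) (G0 0%N) (GN 0%N isT) _ (mk 0%N x) (bk 0%N x)) => //.
  apply: filterS habs => v [hi hG]; split.
    by have := integrable_mul_kern (fun=> 0%N) x hi.
  rewrite mul1e; apply: le_trans hG.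
  under [X in `|X|]eq_Rintegral do rewrite kern0 mulr1.
  rewrite EFin_normr_Rintegral//.
  by apply: le_abse_integral => //; exact: (measurable_int _ hi).
- move=> n x; rewrite /t -mulrBr mulrC.
  have -> : conv n (moment h W) x - conv n.+1 (moment h W) x =
      \int[leb3]_(y in torus_cell) (moment h W y * (kern (fun=> n) x y - kern (fun=> n.+1) x y)).
    rewrite /conv -RintegralB//; [|exact: integrable_mul_kern|exact: integrable_mul_kern].
    by apply: eq_Rintegral => y _; rewrite mulrBr.
  have s0 : 0 <= 48 * ((Num.sqrt (vpc R n))^-1 - (Num.sqrt (vpc R n.+1))^-1).
    by rewrite mulr_ge0// subr_ge0 lef_pV2 ?posrE// ler_wsqrtr// vpc_leS.
  have md : measurable_fun (setT : set V) (fun y => kern (fun=> n) x y - kern (fun=> n.+1) x y).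
    by apply: measurable_funB.
  have bd (y : V) : `|kern (fun=> n) x y - kern (fun=> n.+1) x y| <=
      \prod_(j < 3) vpc R n + \prod_(j < 3) vpc R n.+1.
    by apply: le_trans (ler_normB _ _) _; exact: lerD.
  apply: (@moment_pairing_le R h W mW W0 iH (G 2%N) N _ _ _ (mG 2%N m2) (G0 2%N) (GN 2%N m2) s0 md bd).
  apply: filterS w2 => v w2v; have [hi _ _] := w2v ord0; split.
    have := integrableB mc (integrable_mul_kern (fun=> n) x hi) (integrable_mul_kern (fun=> n.+1) x hi).
    by under [X in is_true (integrable _ _ X) -> _]eq_fun do rewrite /= -EFinB -mulrBr.
  apply: (slice_step (d := fun i x => D [:: i; i] (x, v))) => //.
  + by move=> i; have [] := w2v i.
  + by move=> i phi sphi pphi; have [_ _ ->] := w2v i; rewrite // sqrrN expr1n mul1r.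
  + by move=> i; exact: (@grad_L2_ge D 2%N [tuple i; i] v (mD 2%N m2)).
exists U; split => // x; apply: le_trans (bU x) _.
by rewrite /t vpc0 sqrtr1 divr1 mulrC; apply: ler_wpM2r => //; lra.
Qed.

End sobolev_moment.

(** * Energies and temperatures *)

Section gaussian.
Variable R : realType.
Local Notation V := (vec3 (measurableTypeR R)).
Local Notation mu := (@lebesgue_measure R).

(** With an integer k = n+1 >= p, e^y = (e^(y/k))^k >= (1 + y/k)^k >= (1 + y/k)^p, and y <= k (1 +
    y/k), which gives the constant k^p. *)
Lemma powR_le_expR (p : R) : 0 <= p -> exists2 C, 0 <= C &
  forall y : R, 0 <= y -> y `^ p <= C * expR y.
Proof.
move=> p0; have [n np] : exists n : nat, p <= n.+1%:R.
  exists (Num.truncn p); rewrite ltW//.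
  by have /andP[] := truncn_itv p0.
exists (n.+1%:R `^ p); first exact: powR_ge0.
move=> y y0; have n0 : 0 < n.+1%:R :> R by [].
have e1 : 1 + y / n.+1%:R <= expR (y / n.+1%:R) by exact: expR_ge1Dx.
have e2 : 1 <= 1 + y / n.+1%:R by rewrite lerDl divr_ge0.
have -> : expR y = expR (y / n.+1%:R) ^+ n.+1 by rewrite -expRM_natr -mulrA mulVf ?mulr1// gt_eqF.
apply: (@le_trans _ _ ((n.+1%:R * (1 + y / n.+1%:R)) `^ p)).
  apply: ge0_ler_powR => //.
  - by rewrite nnegrE mulr_ge0// (le_trans ler01).
  - by rewrite mulrDr mulr1 mulrCA divff ?gt_eqF// mulr1 lerDr.
rewrite powRM ?(le_trans ler01 e2)//; apply: ler_wpM2l; first exact: powR_ge0.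
apply: (@le_trans _ _ ((1 + y / n.+1%:R) `^ n.+1%:R)); first exact: ler_powR.
rewrite powR_mulrn ?(le_trans ler01 e2)//.
by rewrite lerXn2r ?nnegrE ?expR_ge0 ?(le_trans ler01 e2).
Qed.

(** Up to its peak value the integrand is the centred normal density of variance a/2. *)
Lemma gaussian_integral_lty (a : R) : 0 < a ->
  (\int[mu]_x (expR (- (x ^+ 2 / a)))%:E < +oo)%E.
Proof.
move=> a0; pose s := Num.sqrt (a / 2).
have s0 : s != 0 by rewrite gt_eqF// sqrtr_gt0 divr_gt0.
have sE : s ^+ 2 *+ 2 = a.
  by rewrite sqr_sqrtr ?divr_ge0 ?ltW// -mulr_natr divfK.
have /integrableP[_] := @integrable_normal_pdf R 0 s.
rewrite normal_pdfE//.
have pk := normal_peak_gt0 s0.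
have mf : measurable_fun setT (fun x : R => (expR (- (x ^+ 2 / a)))%:E).
  apply/measurable_EFinP; apply: measurableT_comp => //.
  apply: measurable_funN; apply: measurable_funM => //; exact: measurable_funX.
have -> : (\int[mu]_x `|(normal_peak s * normal_fun 0 s x)%:E| =
    (normal_peak s)%:E * \int[mu]_x (expR (- (x ^+ 2 / a)))%:E)%E.
  rewrite -ge0_integralZl//.
  - apply: eq_integral => x _ /=.
    rewrite ger0_norm; last by rewrite mulr_ge0 ?expR_ge0 ?ltW.
    by rewrite /normal_fun subr0 sE mulNr EFinM.
  - by rewrite lee_fin ltW.
case: (\int[mu]_x _)%E => [r| |]; rewrite ?ltry ?ltNyr// gt0_muley ?lte_fin//.
Qed.

Lemma maxwellian_gt0 (th : R) (v : vec3 R) : 0 < th -> 0 < maxwellian th v.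
Proof. by move=> th0; rewrite mulr_gt0 ?expR_gt0// powR_gt0// !mulr_gt0 ?pi_gt0. Qed.

Lemma measurable_maxwellian (th : R) : measurable_fun (setT : set V) (maxwellian th).
Proof.
apply: measurable_funM => //; apply: measurableT_comp => //.
apply: measurable_funN; apply: measurable_funM => //; exact: measurable_enorm_sqr.
Qed.

Lemma measurable_maxwellian_moment (th p : R) :
  measurable_fun (setT : set V) (fun v => maxwellian th v * enorm v `^ p).
Proof.
apply: measurable_funM; first exact: measurable_maxwellian.
by apply: (measurableT_comp (measurable_powR p)); exact: measurable_enorm.
Qed.

Lemma integrable_maxwellian_moment (th p : R) : 0 < th -> 0 <= p ->
  leb3.-integrable setT (fun v : V => (maxwellian th v * enorm v `^ p)%:E).
Proof.
move=> th0 p0; have [C C0 HC] := @powR_le_expR (p / 2) (divr_ge0 p0 (ler0n _ 2)).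
(* Half of the Gaussian exponent: |v|^2 / (2 th) is twice y = |v|^2 / a. One factor e^(-y) absorbs
   the power of |v|, the other is a product of three integrable Gaussians. *)
pose a := 4 * th; have a0 : 0 < a by rewrite mulr_gt0.
pose B := (2 * pi * th) `^ (- (3 / 2)) * a `^ (p / 2) * C.
have B0 : 0 <= B by rewrite !mulr_ge0 ?powR_ge0.
pose f (x : R) := (expR (- (x ^+ 2 / a)))%:E.
have mf : measurable_fun setT f.
  apply/measurable_EFinP; apply: measurableT_comp => //.
  apply: measurable_funN; apply: measurable_funM => //; exact: measurable_funX.
have f0 x : (0 <= f x)%E by rewrite lee_fin expR_ge0.
have bnd (v : V) : maxwellian th v * enorm v `^ p <=
    B * (expR (- (v.1.1 ^+ 2 / a)) * expR (- (v.1.2 ^+ 2 / a)) * expR (- (v.2 ^+ 2 / a))).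
  have -> : expR (- (v.1.1 ^+ 2 / a)) * expR (- (v.1.2 ^+ 2 / a)) * expR (- (v.2 ^+ 2 / a)) =
      expR (- (enorm v ^+ 2 / a)).
    by rewrite -!expRD enorm_sqr /dot !big_ord_recl big_ord0; congr expR; rewrite /coord /=; ring.
  pose y := enorm v ^+ 2 / a.
  have y0 : 0 <= y by rewrite divr_ge0 ?sqr_ge0// ltW.
  have -> : enorm v `^ p = a `^ (p / 2) * y `^ (p / 2).
    have yE : a * y = enorm v ^+ 2 by rewrite /y mulrC divfK// gt_eqF.
    rewrite -(powRM _ (ltW a0) y0) yE -powR_mulrn ?enorm_ge0// -powRrM.
    by congr (_ `^ _); field.
  rewrite /maxwellian (_ : enorm v ^+ 2 / (2 * th) = y + y); last first.
    by rewrite /y /a; field; rewrite gt_eqF.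
  rewrite -/y opprD expRD.
  have ey : expR y * expR (- y) = 1 by rewrite expRN divff// gt_eqF// expR_gt0.
  have h : y `^ (p / 2) * expR (- y) <= C.
    by have := HC y y0; rewrite -(ler_pM2r (expR_gt0 (- y))) -(mulrA C) ey mulr1.
  rewrite /B; set K := _ `^ (- _); set A := a `^ _.
  rewrite (_ : K * (_ * _) * _ = K * A * (y `^ (p / 2) * expR (- y)) * expR (- y)); last by ring.
  by rewrite ler_wpM2r ?expR_ge0// ler_wpM2l// ?mulr_ge0 ?powR_ge0.
apply/integrableP; split; first by apply/measurable_EFinP; exact: measurable_maxwellian_moment.
apply: (@le_lt_trans _ _ (\int[leb3]_v (B%:E * (f v.1.1 * f v.1.2 * f v.2)))%E).
  apply: ge0_le_integral => //.
  - apply: measurableT_comp => //.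
    by apply/measurable_EFinP; exact: measurable_maxwellian_moment.
  - apply: measurable_funeM; apply: emeasurable_funM.
      apply: emeasurable_funM.
        exact: (measurableT_comp mf (measurable_coord ord0)).
      exact: (measurableT_comp mf (measurable_coord (lift ord0 ord0))).
    exact: (measurableT_comp mf (measurable_coord (lift ord0 (lift ord0 ord0)))).
  - move=> v _; rewrite /= ger0_norm; last by rewrite mulr_ge0 ?powR_ge0 ?ltW ?maxwellian_gt0.
    by rewrite -!EFinM lee_fin.
rewrite ge0_integralZl//.
- rewrite integral_leb3_tensor//.
  have fl : (\int[mu]_x f x < +oo)%E by exact: gaussian_integral_lty.
  have fg : (0 <= \int[mu]_x f x)%E by exact: integral_ge0.
  have ffin : (\int[mu]_x f x \is a fin_num)%E by rewrite ge0_fin_numE.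
  by rewrite -(fineK ffin) -!EFinM ltry.
- apply: emeasurable_funM.
    apply: emeasurable_funM.
      exact: (measurableT_comp mf (measurable_coord ord0)).
    exact: (measurableT_comp mf (measurable_coord (lift ord0 ord0))).
  exact: (measurableT_comp mf (measurable_coord (lift ord0 (lift ord0 ord0)))).
- by move=> v _; rewrite !mule_ge0.
Qed.

(** A zero integral would make the integrand vanish almost everywhere, yet it is positive off the
    origin. This gives the positivity of [a1], through [Kgamma], and of the thermal energy. *)
Lemma maxwellian_moment_gt0 (th p : R) : 0 < th -> 0 <= p ->
  0 < \int[leb3]_v (maxwellian th v * enorm v `^ p).
Proof.
move=> th0 p0; have fi := integrable_maxwellian_moment th0 p0.
have f0 (v : V) : 0 <= maxwellian th v * enorm v `^ p.
  by rewrite mulr_ge0 ?powR_ge0 ?ltW ?maxwellian_gt0.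
rewrite lt_neqAle Rintegral_ge0 ?andbT//; apply/eqP => I0.
have mf : measurable_fun (setT : set V) (fun v : V => (maxwellian th v * enorm v `^ p)%:E).
  by apply/measurable_EFinP; exact: measurable_maxwellian_moment.
have : (\int[leb3]_v `|(maxwellian th v * enorm v `^ p)%:E| = 0)%E.
  under eq_integral do rewrite gee0_abs ?lee_fin ?f0//.
  by rewrite -(fineK (integrable_fin_num _ fi))//; congr EFin.
move=> /(ae_eq_integral_abs leb3 measurableT mf).1 H.
have c0 := @ae_coord_neq R ord0 0.
have [A [mA A0 FA]] : {ae leb3, forall v : V, False}.
  apply: filterS2 H c0 => v /= /(_ Logic.I) /(congr1 fine) /= /eqP + v0.
  rewrite mulf_eq0 gt_eqF ?maxwellian_gt0//= powR_eq0 => /andP[/eqP e0 _].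
  move: v0; suff -> : coord ord0 v = 0 by rewrite eqxx.
  have := enorm_sqr v; rewrite e0 expr0n /= /dot => /esym/eqP.
  rewrite psumr_eq0 => [/allP /(_ ord0)|i _]; last by rewrite -expr2 sqr_ge0.
  by rewrite mem_index_enum /= mulf_eq0 orbb => /(_ isT) /eqP.
have cA : torus_cell `<=` A by move=> x _; apply: FA.
have : (leb3 (torus_cell : set V) <= leb3 A)%E.
  apply: le_measure => //; rewrite inE; [exact: measurable_torus_cell|exact: mA].
by rewrite [X in (_ <= X)%E -> _]A0 (leb3_torus_cell R) lee_fin ler10.
Qed.
End gaussian.

Section change_of_variable.
Context d (T : measurableType d) (R : realType) (mu : {measure set T -> \bar R}).
Variables (s : T -> T) (c : R).
Hypothesis ms : measurable_fun setT s.
Hypothesis c0 : 0 <= c.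
Hypothesis Hs : forall f : T -> \bar R, measurable_fun setT f ->
  (forall x, 0 <= f x)%E -> (\int[mu]_x f (s x) = c%:E * \int[mu]_x f x)%E.

Lemma integrable_comp (f : T -> R) : mu.-integrable setT (EFin \o f) ->
  mu.-integrable setT (EFin \o (f \o s)).
Proof.
move=> /integrableP[mf fi]; apply/integrableP; split.
  exact: (measurableT_comp mf ms).
rewrite (Hs (f := fun x => (`|(f x)%:E|)%E))//; last exact: measurableT_comp.
by rewrite lte_mul_pinfty ?lee_fin.
Qed.

(** [Hs] concerns nonnegative functions; it is applied to the positive and negative parts, whose
    integrals are finite and can be subtracted. *)
Lemma Rintegral_comp (f : T -> R) : mu.-integrable setT (EFin \o f) ->
  \int[mu]_x f (s x) = c * \int[mu]_x f x.
Proof.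
move=> fi; have mf := measurable_int _ fi.
have fp := integrable_pos_fin_num measurableT fi.
have fn := integrable_neg_fin_num measurableT fi.
rewrite /Rintegral integralE [in RHS]integralE.
rewrite -[X in _ = X * _]/(fine c%:E) -fineM//; last by rewrite fin_numB fp.
congr fine; rewrite muleBr//; last by rewrite fin_num_adde_defr.
have mp : measurable_fun setT ((EFin \o f)^\+)%E by exact: measurable_funepos.
have mn : measurable_fun setT ((EFin \o f)^\-)%E by exact: measurable_funeneg.
rewrite -(Hs mp (funepos_ge0 _)) -(Hs mn (funeneg_ge0 _)).
by congr (_ - _)%E; apply: eq_integral => x _; rewrite ?funeposE ?funenegE.
Qed.
End change_of_variable.

Section ae_slices.
Context d1 d2 (T1 : measurableType d1) (T2 : measurableType d2) (R : realType).
Variable m1 : {sigma_finite_measure set T1 -> \bar R}.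
Variable m2 : {sigma_finite_measure set T2 -> \bar R}.

(** By Tonelli the inner integrals of |f - g| vanish almost everywhere. Uniqueness identifies two
    solutions only almost everywhere in phase space, while the local temperature is an integral over
    a slice. *)
Lemma Rintegral_slice_ae_eq (f g : T1 * T2 -> R) :
  (m1 \x m2)%E.-integrable setT (EFin \o f) -> (m1 \x m2)%E.-integrable setT (EFin \o g) ->
  {ae (m1 \x m2)%E, forall p, f p = g p} ->
  {ae m1, forall x, \int[m2]_y f (x, y) = \int[m2]_y g (x, y)}.
Proof.
move=> fi gi fg.
have mf := measurable_int _ fi; have mg := measurable_int _ gi.
have md : measurable_fun setT (fun p => (`|f p - g p|%:E)%E).
  apply/measurable_EFinP; apply: measurableT_comp => //.
  by apply: measurable_funB; exact/measurable_EFinP.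
have d0 : (\int[(m1 \x m2)%E]_p `|f p - g p|%:E = 0)%E.
  rewrite (@ae_eq_integral _ _ _ (m1 \x m2)%E _ (cst 0) _ measurableT md)//; first exact: integral0.
  by apply: filterS fg => p /= -> _; rewrite subrr normr0.
rewrite (fubini_tonelli1 )// in d0.
have a0 p : (0 <= `|f p - g p|%:E)%E by rewrite lee_fin.
have mF := @measurable_fun_fubini_tonelli_F _ _ T1 T2 R m2 _ md a0.
have F0 x : (0 <= fubini_F m2 (fun p : T1 * T2 => (`|f p - g p|%:E)%E) x)%E by exact: integral_ge0.
have dF : {ae m1, forall x, fubini_F m2 (fun p : T1 * T2 => (`|f p - g p|%:E)%E) x = 0%E}.
  have : (\int[m1]_x `|fubini_F m2 (fun p : T1 * T2 => (`|f p - g p|%:E)%E) x| = 0)%E.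
    by under eq_integral do rewrite gee0_abs//.
  move=> /(ae_eq_integral_abs m1 measurableT mF).1.
  by apply: filterS => x; exact.
apply: filterS3 dF (ae_integrable1 fi) (ae_integrable1 gi) => x dx ix jx.
apply/eqP; rewrite -subr_eq0 -RintegralB// -normr_le0 -lee_fin.
rewrite EFin_normr_Rintegral//; last first.
  have := integrableB measurableT ix jx.
  by under [X in is_true (integrable _ _ X) -> _]eq_fun do rewrite /= -EFinB.
rewrite -[X in (_ <= X)%E]dx; apply: le_abse_integral => //.
by apply/measurable_EFinP; apply: measurable_funB; apply/measurable_EFinP; [exact: (measurable_int _ ix)|exact: (measurable_int _ jx)].
Qed.
End ae_slices.

Section velocity_scaling.
Variable R : realType.
Local Notation V := (vec3 (measurableTypeR R)).
Local Notation leb33 := (leb3 \x leb3)%E.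
Local Notation W := (fun v : vec3 R => enorm v ^+ 2).
Implicit Types (k : R) (h g : vec3 R * vec3 R -> R).

Lemma enorm_sqrZ k (v : vec3 R) : enorm (k *: v) ^+ 2 = k ^+ 2 * enorm v ^+ 2.
Proof.
rewrite !enorm_sqr /dot big_distrr/=; apply: eq_bigr => i _.
by rewrite coordZ; ring.
Qed.

Lemma measurable_scale k : measurable_fun (setT : set V) (fun v : V => (k *: v : V)%R).
Proof.
have mk (i : 'I_3) : measurable_fun (setT : set V) (fun v : V => k * coord i v).
  by apply: measurable_funM => //; exact: measurable_coord.
apply: measurable_fun_pair => /=; last exact: (mk (lift ord0 (lift ord0 ord0))).
by apply: measurable_fun_pair => /=; [exact: (mk ord0)|exact: (mk (lift ord0 ord0))].
Qed.

(** Two of the three factors [k] enter the energy; the remaining one and the Jacobian k^(-3) leave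
    the factor k^(-2). *)
Let scaleE k (r : R) (v : vec3 R) : 0 < k ->
  k ^+ 3 * r * enorm v ^+ 2 = k * (r * enorm (k *: v) ^+ 2).
Proof. by move=> k0; rewrite enorm_sqrZ; ring. Qed.

Lemma scaled_moment k (f : vec3 R -> R) : 0 < k ->
  leb3.-integrable setT (fun v : V => (f v * enorm v ^+ 2)%:E) ->
  \int[leb3]_v (k ^+ 3 * f (k *: v) * enorm v ^+ 2) =
  k ^- 2 * \int[leb3]_v (f v * enorm v ^+ 2).
Proof.
move=> k0 fi; under eq_Rintegral do rewrite scaleE//.
have k3 : 0 <= k ^- 3 by rewrite invr_ge0 exprn_ge0// ltW.
have Hs := integral_leb3_scale k0.
rewrite RintegralZl//; last exact: (integrable_comp (measurable_scale k) k3 Hs fi).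
rewrite (Rintegral_comp (s := fun v : V => k *: v) (f := fun v => f v * enorm v ^+ 2) Hs fi) mulrA; congr (_ * _).
by field; rewrite gt_eqF.
Qed.

Lemma scaled_phase_moment k g : 0 < k ->
  leb33.-integrable setT (EFin \o ((fun p : V * V => g p * W p.2) \_ phase)) ->
  \int[leb6]_(p in phase) (k ^+ 3 * g (p.1, k *: p.2) * enorm p.2 ^+ 2) =
  k ^- 2 * \int[leb33]_p ((fun p : V * V => g p * W p.2) \_ phase) p.
Proof.
move=> k0 gi.
have k3 : 0 <= k ^- 3 by rewrite invr_ge0 exprn_ge0// ltW.
pose s (p : V * V) : V * V := (p.1, k *: p.2).
have ms : measurable_fun setT s.
  apply: measurable_fun_pair; first exact: measurable_fst.
  exact: (measurableT_comp (measurable_scale k) measurable_snd).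
have Hs (f : V * V -> \bar R) : measurable_fun setT f -> (forall p, 0 <= f p)%E ->
    (\int[leb33]_p f (s p) = (k ^- 3)%:E * \int[leb33]_p f p)%E.
  move=> mf f0.
  rewrite (integral_prod_map (m1 := leb3) (m2 := leb3) (s1 := id) (c1 := 1) (c2 := k ^- 3) (s2 := fun v => k *: v))//.
  - by rewrite mul1r.
  - exact: measurable_scale.
  - by move=> f' _ _; rewrite mul1e.
  - exact: integral_leb3_scale.
transitivity (\int[leb33]_p (k * ((fun p : V * V => g p * W p.2) \_ phase) (s p))).
  rewrite [LHS]Rintegral_mkcond; apply: eq_Rintegral => -[x v] _.
  rewrite !patchE /s !phaseE; case: ifP => _; first by rewrite scaleE.
  exact/esym/mulr0.
rewrite RintegralZl//; last exact: (integrable_comp ms k3 Hs gi).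
rewrite (Rintegral_comp (s := s) Hs gi) mulrA; congr (_ * _).
by field; rewrite gt_eqF.
Qed.
End velocity_scaling.

Section temperature.
Variable R : realType.
Local Notation V := (vec3 (measurableTypeR R)).
Local Notation leb33 := (leb3 \x leb3)%E.
Local Notation W := (fun v : vec3 R => enorm v ^+ 2).
Local Notation energy h := ((fun p : V * V => h p * W p.2) \_ phase).
Implicit Types (K th eps : R) (h k : vec3 R * vec3 R -> R).

Definition thermal_energy th : R := \int[leb3]_v (maxwellian th v * enorm v ^+ 2).

Lemma integrable_maxwellian_energy th : 0 < th ->
  leb3.-integrable setT (fun v : V => (maxwellian th v * enorm v ^+ 2)%:E).
Proof.
move=> th0; have := integrable_maxwellian_moment th0 (ler0n R 2).
by under [X in is_true (integrable _ _ X) -> _]eq_fun do rewrite powR_mulrn ?enorm_ge0//.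
Qed.

Lemma thermal_energy_gt0 th : 0 < th -> 0 < thermal_energy th.
Proof.
move=> th0; have := maxwellian_moment_gt0 th0 (ler0n R 2).
by under eq_Rintegral do rewrite powR_mulrn ?enorm_ge0//.
Qed.

Lemma integrable_cell_energy th : 0 < th ->
  leb33.-integrable setT (EFin \o energy (Mx th)).
Proof.
move=> th0; have mc := @measurable_torus_cell R.
have i1 : leb3.-integrable setT (EFin \o (\1_torus_cell : V -> R)).
  apply/integrableP; split; first exact/measurable_EFinP.
  under eq_integral do rewrite /= ger0_norm//.
  by rewrite integral_indic// setIT -[X in (X < _)%E]/(leb3 torus_cell) (leb3_torus_cell R) ltry.
have := integrable_tensor i1 (integrable_maxwellian_energy th0).
suff -> : (fun p : V * V => (\1_torus_cell p.1 * (maxwellian th p.2 * enorm p.2 ^+ 2))%:E) =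
    EFin \o energy (Mx th) by [].
apply/funext => -[x v] /=; rewrite patchE phaseE indicE.
by case: ifP => _; rewrite ?mul1r// mul0r.
Qed.

Lemma integral_moment h : measurable_fun (phase : set (V * V)) h ->
  leb33.-integrable setT (EFin \o energy h) ->
  \int[leb33]_p (energy h p) = \int[leb3]_(x in torus_cell) (moment h W x).
Proof.
move=> mh iH; have mc := @measurable_torus_cell R.
have im := @integrable_moment R h W iH.
rewrite /Rintegral -(integral12_prod_meas1 iH) [in RHS]integral_mkcond; congr fine.
apply: ae_eq_integral => //.
- exact: measurable_fubini_F iH.
- exact: ((measurable_restrictT _ mc).1 (measurable_int _ im)).
apply: filterS (ae_integrable1 iH) => x ix _ /=.
rewrite patchE; case: ifPn => [/set_mem cx|cx]; last first.
  by apply: integral0_eq => v _; rewrite /= (phase_mulE h W) patchE (negbTE cx) mul0r.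
rewrite (moment_cellE h W cx) fineK//; exact: integrable_fin_num ix.
Qed.

Lemma measurable_Mx th : measurable_fun (phase : set (V * V)) (Mx th).
Proof.
apply: measurable_funTS.
exact: (measurableT_comp (measurable_maxwellian th) measurable_snd).
Qed.

Lemma integral_cell_energy th : 0 < th ->
  \int[leb33]_p (energy (Mx th) p) = thermal_energy th.
Proof.
move=> th0; have mc := @measurable_torus_cell R.
rewrite (integral_moment (measurable_Mx th) (integrable_cell_energy th0)).
rewrite (_ : (fun x => moment (Mx th) W x) = cst (thermal_energy th))//.
by rewrite Rintegral_cst// [X in _ * fine X](leb3_torus_cell R) mulr1.
Qed.

(** Equality almost everywhere does not carry measurability over, so that of [h] is asked for
    separately. *)
Lemma energy_eq_ae h k : measurable_fun (phase : set (V * V)) h ->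
  eq_ae h k -> leb33.-integrable setT (EFin \o energy k) ->
  [/\ leb33.-integrable setT (EFin \o energy h),
      {ae leb3, forall x : V, torus_cell x -> moment h W x = moment k W x} &
      \int[leb33]_p (energy h p) = \int[leb33]_p (energy k p)].
Proof.
move=> mh hk ik.
have mW := @measurable_enorm_sqr R.
have mH := measurable_phase_mul mh mW.
have mK := measurable_int _ ik.
have HK : {ae leb33, forall p : V * V, energy h p = energy k p}.
  have {}hk : {ae leb33, forall p : V * V, phase p -> h p = k p} by exact: hk.
  apply: filterS hk => p hp; rewrite !patchE; case: ifPn => // /set_mem pp.
  by rewrite hp.
have ih : leb33.-integrable setT (EFin \o energy h).
  apply/integrableP; split; first exact/measurable_EFinP.
  have /integrableP[_ kf] := ik; apply: le_lt_trans kf.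
  rewrite le_eqVlt; apply/orP; left; apply/eqP; apply: ae_eq_integral => //.
  - by apply: measurableT_comp => //; exact/measurable_EFinP.
  - exact: measurableT_comp.
  - by apply: filterS HK => p /= ->.
split=> //.
  apply: filterS (Rintegral_slice_ae_eq ih ik HK) => x hx cx.
  by rewrite (moment_cellE h W cx) hx -(moment_cellE k W cx).
congr fine; apply: ae_eq_integral => //; first exact/measurable_EFinP.
by apply: filterS HK => p /= ->.
Qed.

(** Almost every x, as the slice of [h] at x has to be integrable against |v|^2 for the integral to
    split. *)
Lemma local_energy th eps K h : 0 < th -> 0 < K ->
  leb33.-integrable setT (EFin \o energy h) ->
  {ae leb3, forall x : V, torus_cell x ->
    \int[leb3]_v (K ^+ 3 * (Mx th (x, K *: v) + eps * h (x, K *: v)) * enorm v ^+ 2) =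
    K ^- 2 * (thermal_energy th + eps * moment h W x)}.
Proof.
move=> th0 K0 iH; have iM := integrable_maxwellian_energy th0.
apply: filterS (ae_integrable1 iH) => x ix cx.
have {}ix : leb3.-integrable setT (fun v : V => (h (x, v) * enorm v ^+ 2)%:E).
  move: ix; congr (integrable _ _ _); apply/funext => v /=.
  by rewrite (phase_mulE h W) patchE mem_set.
have iX := integrableZl measurableT eps ix.
have iS := integrableD measurableT iM iX.
have E v : maxwellian th v * enorm v ^+ 2 + eps * (h (x, v) * enorm v ^+ 2) =
    (maxwellian th v + eps * h (x, v)) * enorm v ^+ 2 by ring.
rewrite (scaled_moment (f := fun v => maxwellian th v + eps * h (x, v)) K0); last first.
  move: iS; congr (integrable _ _ _); apply/funext => v /=.
  by rewrite -EFinM -EFinD E.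
under eq_Rintegral do rewrite -E.
by rewrite RintegralD// RintegralZl.
Qed.

Lemma global_energy th eps K h : 0 < th -> 0 < K ->
  measurable_fun (phase : set (V * V)) h ->
  leb33.-integrable setT (EFin \o energy h) ->
  \int[leb6]_(p in phase)
     (K ^+ 3 * (Mx th (p.1, K *: p.2) + eps * h (p.1, K *: p.2)) * enorm p.2 ^+ 2) =
  K ^- 2 * (thermal_energy th + eps * \int[leb3]_(x in torus_cell) (moment h W x)).
Proof.
move=> th0 K0 mh iH; have iM := integrable_cell_energy th0.
have iX := integrableZl measurableT eps iH.
have iS := integrableD measurableT iM iX.
have E (p : V * V) : energy (Mx th) p + eps * energy h p =
    energy (fun p : V * V => Mx th p + eps * h p) p.
  rewrite !patchE; case: ifP => _; first by ring.
  by rewrite mulr0 addr0.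
rewrite (scaled_phase_moment (g := fun p => Mx th p + eps * h p) K0); last first.
  move: iS; congr (integrable _ _ _); apply/funext => p /=.
  by rewrite -EFinM -EFinD E.
under eq_Rintegral do rewrite -E.
by rewrite RintegralD// RintegralZl// integral_cell_energy// integral_moment.
Qed.
End temperature.

(** * Comparison of the velocity scale with Haff's rate *)

Section haff_rates.
Variable R : realType.
Implicit Types gamma b d eps t : R.

Lemma powRN_le (p x y : R) : 0 <= p -> 0 < x -> x <= y -> y `^ (- p) <= x `^ (- p).
Proof.
move=> p0 x0 xy; have y0 := lt_le_trans x0 xy.
by rewrite !powRN lef_pV2 ?posrE ?powR_gt0// ge0_ler_powR ?nnegrE// ltW.
Qed.

(** Factoring eps^(-2/gamma) out of the sum; the exponents of eps add up to 4/(gamma+1) + 4/(gamma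
    (gamma+1)) = 4/gamma. *)
Lemma haff_rateE gamma eps t : 0 < gamma -> 0 < eps -> 0 <= t ->
  haff_rate gamma eps t =
  (eps `^ (2 / gamma)) ^+ 2 * (1 + eps `^ (2 / gamma) * t) `^ (- (2 / (gamma + 1))).
Proof.
move=> g0 e0 t0; rewrite /haff_rate (powRN eps).
have r0 : 0 < eps `^ (2 / gamma) by rewrite powR_gt0.
have -> : (eps `^ (2 / gamma))^-1 + t = (eps `^ (2 / gamma))^-1 * (1 + eps `^ (2 / gamma) * t).
  by field; rewrite gt_eqF.
rewrite powRM ?invr_ge0 ?addr_ge0 ?mulr_ge0 ?powR_ge0// mulrA; congr (_ * _).
rewrite -powRN -powRrM -powRD; last by rewrite (gt_eqF e0) implybT.
rewrite -powR_mulrn ?powR_ge0// -powRrM; congr (_ `^ _).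
by field; rewrite !gt_eqF// addr_gt0.
Qed.

Lemma Vscale_gt0 gamma a0 th b1 eps t :
  0 < gamma -> 0 <= a1 gamma a0 th -> 0 < b1 -> 0 < eps -> 0 <= t ->
  0 < Vscale gamma a0 th b1 eps t.
Proof.
move=> g0 a10 b10 e0 t0; rewrite mulr_gt0 ?powR_gt0//.
by rewrite ltr_pwDl// mulr_ge0// mulr_ge0 ?powR_ge0// mulr_ge0// addr_ge0// ltW.
Qed.

Lemma VscaleE gamma a0 th b1 eps t :
  0 < gamma -> 0 <= a1 gamma a0 th -> 0 < b1 -> 0 < eps -> 0 <= t ->
  Vscale gamma a0 th b1 eps t ^- 2 = (eps `^ (2 / gamma)) ^+ 2 *
  (b1 + (1 + gamma) * a1 gamma a0 th * (eps `^ (2 / gamma) * t)) `^ (- (2 / (gamma + 1))).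
Proof.
move=> g0 a10 b10 e0 t0; rewrite /Vscale exprMn invfM powRN exprVn invrK; congr (_ * _).
by rewrite -powR_mulrn ?powR_ge0// -powRrM -powRN mulrA (mulrC _^-1).
Qed.

(** With y = eps^(2/gamma) t, the quantity b1 + d y lies between min(b1, d) (1 + y) and max(b1, d)
    (1 + y); the negative exponent exchanges the two bounds. The constants are free of eps and t. *)
Lemma Vscale_haff gamma a0 th b1 eps t (d := (1 + gamma) * a1 gamma a0 th) :
  0 < gamma -> 0 < a1 gamma a0 th -> 0 < b1 -> 0 < eps -> 0 <= t ->
  Num.max b1 d `^ (- (2 / (gamma + 1))) * haff_rate gamma eps t
    <= Vscale gamma a0 th b1 eps t ^- 2
    <= Num.min b1 d `^ (- (2 / (gamma + 1))) * haff_rate gamma eps t.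
Proof.
move=> g0 a10 b10 e0 t0; rewrite VscaleE// ?(ltW a10)// haff_rateE//.
have d0 : 0 < d by rewrite mulr_gt0// addr_gt0.
have p0 : 0 <= 2 / (gamma + 1) by rewrite divr_ge0// addr_ge0// ltW.
rewrite -/d; set r := eps `^ (2 / gamma).
have y0 : 0 <= r * t by rewrite mulr_ge0 ?powR_ge0.
have r2 : 0 <= r ^+ 2 by rewrite sqr_ge0.
have m0 : 0 < Num.min b1 d by rewrite lt_min b10.
have M0 : 0 < Num.max b1 d by rewrite lt_max b10.
rewrite ![_ `^ _ * (r ^+ 2 * _)]mulrCA -!powRM ?(ltW m0) ?(ltW M0) ?addr_ge0//.
apply/andP; split; apply: ler_wpM2l => //; apply: powRN_le => //.
- by rewrite ltr_pwDl// mulr_ge0// ltW.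
- by rewrite mulrDr mulr1 lerD// ?ler_wpM2r// le_max lexx ?orbT.
- by rewrite mulr_gt0// ltr_pwDl.
- by rewrite mulrDr mulr1 lerD// ?ler_wpM2r// ge_min lexx ?orbT.
Qed.
End haff_rates.

(** * The energy of the perturbation and the size of the temperatures *)

Section energy_bounds.
Variable R : realType.
Local Notation V := (vec3 (measurableTypeR R)).
Local Notation leb33 := (leb3 \x leb3)%E.
Local Notation W := (fun v : vec3 R => enorm v ^+ 2).
Local Notation energy h := ((fun p : V * V => h p * W p.2) \_ phase).
Implicit Types h k : vec3 R * vec3 R -> R.

Lemma sob_norm_measurable (m : nat) (q : R) h :
  (sob_norm m q h < +oo)%E -> measurable_fun (phase : set (V * V)) h.
Proof. by move=> /ereal_inf_lt[_ [mh _] _]. Qed.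

Lemma Rintegral_cell_le (f : vec3 R -> R) (B : R) :
  leb3.-integrable torus_cell (EFin \o f) ->
  {ae leb3, forall x : V, torus_cell x -> `|f x| <= B} ->
  `|\int[leb3]_(x in torus_cell) f x| <= B.
Proof.
move=> fi fB; have mc := @measurable_torus_cell R.
rewrite -lee_fin EFin_normr_Rintegral//.
apply: le_trans (le_abse_integral _ mc (measurable_int _ fi)) _.
have -> : (B%:E = \int[leb3]_(x in torus_cell) cst B%:E x :> \bar R)%E.
  by rewrite integral_cst// [X in (_ * X)%E](leb3_torus_cell R) mule1.
(* A negative [B] would make the cell negligible, whereas its measure is 1. *)
have [B0|B0] := leP 0 B; last first.
  have [A [mA A0 FA]] : {ae leb3, forall x : V, ~ torus_cell x}.
    by apply: filterS fB => x /[apply] h; have := le_lt_trans h B0; rewrite normr_lt0.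
  have : (leb3 (torus_cell : set V) <= leb3 A)%E.
    apply: le_measure; rewrite ?inE// => x cx; apply: FA => /=; exact.
  by rewrite [X in (_ <= X)%E -> _]A0 (leb3_torus_cell R) lee_fin ler10.
apply: ae_ge0_le_integral => //.
by apply: measurableT_comp => //; exact: (measurable_int _ fi).
Qed.

(** [k] is the solution that carries the a priori bound and [h] any solution at the same time; the
    finite norm of [h] supplies its measurability. *)
Lemma perturbation_energy (m : nat) (q N : R) h k :
  (2 <= m)%N -> 2 <= q -> 0 <= N -> (sob_norm m q k < N%:E)%E ->
  (sob_norm m q h < +oo)%E -> eq_ae h k ->
  leb33.-integrable setT (EFin \o energy h) /\
  exists U : vec3 R -> R, [/\ continuous U, torus_periodic U,
    forall x, `|U x| <= 49 * N,
    {ae leb3, forall x : V, torus_cell x -> moment h W x = U x} &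
    `|\int[leb3]_(x in torus_cell) (moment h W x)| <= 49 * N].
Proof.
move=> m2 q2 N0 kN hoo hk.
have [ik [U [cU pU bU kU]]] := sobolev_moment m2 q2 N0 kN.
have mh := sob_norm_measurable hoo.
have [ih hkm _] := energy_eq_ae mh hk ik.
have hU : {ae leb3, forall x : V, torus_cell x -> moment h W x = U x}.
  by apply: filterS2 hkm kU => x hx kx cx; rewrite hx// kx.
split=> //; exists U; split=> //.
apply: (Rintegral_cell_le (integrable_moment (W := W) ih)).
by apply: filterS hU => x hx cx; rewrite hx.
Qed.

Lemma a1_gt0 (gamma a0 th : R) : 0 < gamma -> 0 < a0 -> 0 < th ->
  0 < a1 gamma a0 th.
Proof.
move=> g0 a00 th0; rewrite mulr_gt0 ?powR_gt0 ?mulr_gt0//.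
  by apply: maxwellian_moment_gt0 => //; rewrite addr_ge0// ltW.
by rewrite invr_gt0 mulr_gt0// addr_gt0.
Qed.

Lemma tau_ge0 (gamma a0 th b1 eps t : R) : 0 < gamma -> 0 <= a1 gamma a0 th ->
  0 < b1 -> 0 < eps -> 0 <= tau gamma a0 th b1 eps t.
Proof.
move=> g0 a10 b10 e0; apply: Rintegral_ge0 => s /=; rewrite in_itv/= => /andP[s0 _].
by rewrite invr_ge0 ltW// Vscale_gt0.
Qed.

(* Here [v = V_eps ^- 2], [r] is Haff's rate and [u] the energy of [h]. *)
Lemma temperature_le (v r E cm cM eps u B : R) :
  0 <= r -> 0 <= v -> 0 < E -> cM * r <= v <= cm * r -> 0 < eps -> `|u| <= B ->
  eps * B <= E / 2 ->
  E / 2 * cM * r <= v * (E + eps * u) <= 3 * E / 2 * cm * r.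
Proof.
move=> r0 v0 E0 /andP[v1 v2] e0 uB eB.
have /andP[x1 x2] : - (E / 2) <= eps * u <= E / 2.
  rewrite -ler_norml normrM (gtr0_norm e0); apply: le_trans eB.
  by rewrite ler_pM2l.
apply/andP; split.
  apply: (@le_trans _ _ (v * (E / 2))).
    by rewrite -mulrA mulrC; apply: ler_wpM2r => //; rewrite ltW// divr_gt0.
  by apply: ler_wpM2l => //; lra.
apply: (@le_trans _ _ (v * (3 * E / 2))).
  by apply: ler_wpM2l => //; lra.
by rewrite -(mulrA _ cm) mulrC; apply: ler_wpM2l => //; rewrite ltW// divr_gt0// mulr_gt0.
Qed.
End energy_bounds.

Theorem theorem1p4 (R : realType) (gamma a0 : R) (e b : R -> R)
    (theta b1 : R) (m : nat) (q : R)
    (gamma_gt0 : 0 < gamma) (e_class : restitution_class gamma a0 e)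
    (b_kernel : angular_kernel b)
    (b_dissipation : energy_dissipation_identity gamma b)
    (theta_gt0 : 0 < theta) (b1_gt0 : 0 < b1)
    (q_ge : 3%:R + gamma <= q) (m_gt : 3%:R / 2%:R < m%:R :> R)
    (eps0 alpha0 C0 : R)
    (eps0_gt0 : 0 < eps0) (alpha0_gt0 : 0 < alpha0) (C0_gt0 : 0 < C0) :
  exists eps1 c C : R, [/\ 0 < eps1 <= eps0, 0 < c, 0 < C &
    forall Fin : R -> vec3 R * vec3 R -> R,
      initial_data theta eps0 Fin ->
      well_posed gamma a0 e b theta b1 m q eps0 alpha0 C0 Fin ->
    forall eps : R, 0 < eps < eps1 ->
      (sob_norm m q (h_init theta Fin eps) <= alpha0%:E)%E ->
    forall h : R -> vec3 R * vec3 R -> R,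
      is_solution gamma a0 e b theta b1 m q eps (h_init theta Fin eps) h ->
    (forall t : R, 0 <= t ->
      exists2 Tc : vec3 R -> R,
        is_continuous_version
          (local_temperature gamma a0 theta b1 eps h t) Tc &
        forall x : vec3 R,
          c * haff_rate gamma eps t <= Tc x <= C * haff_rate gamma eps t) /\
    (forall t : R, 0 <= t ->
      c * haff_rate gamma eps t
        <= global_temperature gamma a0 theta b1 eps h t
        <= C * haff_rate gamma eps t)].
Proof.
have a00 : 0 < a0 by case: e_class => _ [_ [_ [_ [_ [[]]]]]].
have a10 := a1_gt0 gamma_gt0 a00 theta_gt0.
have E0 := thermal_energy_gt0 theta_gt0.
set E := thermal_energy theta in E0.
set d := (1 + gamma) * a1 gamma a0 theta.
have d0 : 0 < d by rewrite mulr_gt0// addr_gt0.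
have m2 : (2 <= m)%N.
  rewrite ltnNge; apply/negP => m1.
  by have : (m%:R <= 1%:R :> R) by [rewrite ler_nat]; lra.
have q2 : 2 <= q by lra.
(* The a priori bound is by C0; the margin 1 makes it strict, as needed to extract weak derivatives
   from the infimum. *)
pose N := C0 + 1; have N0 : 0 < N by rewrite addr_gt0.
have B0 : 0 < 2 * (49 * N) by rewrite !mulr_gt0.
(* The threshold keeps eps times the energy of [h], at most 49 N, below half the thermal energy E of
   the Maxwellian. The total energy then lies between E/2 and 3E/2, and the other factors are the
   constants of [Vscale_haff]. *)
exists (Num.min eps0 (E / (2 * (49 * N)))), (E / 2 * Num.max b1 d `^ (- (2 / (gamma + 1)))),
  (3 * E / 2 * Num.min b1 d `^ (- (2 / (gamma + 1)))); split.
- by rewrite lt_min eps0_gt0 divr_gt0//= ge_min lexx.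
- by rewrite mulr_gt0 ?powR_gt0 ?divr_gt0// lt_max b1_gt0.
- by rewrite mulr_gt0 ?powR_gt0 ?divr_gt0 ?mulr_gt0// lt_min b1_gt0.
move=> Fin _ wp eps /andP[eps_gt0]; rewrite lt_min => /andP[eps_lt epsE] hin h solh.
have eN : eps * (49 * N) <= E / 2.
  move: (ltW epsE); rewrite ler_pdivlMr// => H; lra.
have eps_itv : 0 < eps < eps0 by rewrite eps_gt0.
have [k [_ uniq_k kC0]] := wp eps eps_itv hin.
have [[hoo _ _] _ _] := solh.
(* The temperature at time t involves the perturbation at the rescaled time T >= 0, where (1 +
   T)^(-1/2) <= 1 reduces the a priori bound to C0. *)
have key t : 0 <= t -> let T := tau gamma a0 theta b1 eps t in
    (leb3 \x leb3)%E.-integrable setT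
      (EFin \o ((fun p : vec3 (measurableTypeR R) * vec3 (measurableTypeR R) => h T p * enorm p.2 ^+ 2) \_ phase)) /\
    exists U : vec3 R -> R, [/\ continuous U, torus_periodic U,
    forall x, `|U x| <= 49 * N,
    {ae leb3, forall x : vec3 (measurableTypeR R), torus_cell x -> moment (h T) (fun v => enorm v ^+ 2) x = U x} &
    `|\int[leb3]_(x in torus_cell) (moment (h T) (fun v => enorm v ^+ 2) x)| <= 49 * N].
  move=> t0 T; have T0 : 0 <= T by apply: tau_ge0 => //; exact: ltW.
  apply: (perturbation_energy m2 q2 (ltW N0) _ (hoo T T0) (uniq_k h solh T T0)).
  apply: le_lt_trans (kC0 T T0) _; rewrite lte_fin /N.
  have := @powRN_le R 2^-1 1 (1 + T) _ ltr01; rewrite lerDl T0 powR1 => /(_ _ isT) T1.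
  by rewrite (@le_lt_trans _ _ C0) ?ltrDl// ler_piMr ?T1// ltW.
have rate t : 0 <= t -> 0 <= haff_rate gamma eps t by move=> t0; rewrite mulr_ge0 ?powR_ge0.
have V0 t : 0 <= t -> 0 < Vscale gamma a0 theta b1 eps t.
  by move=> t0; apply: Vscale_gt0 => //; exact: ltW.
have Vinv t : 0 <= t -> 0 <= Vscale gamma a0 theta b1 eps t ^- 2.
  by move=> t0; rewrite invr_ge0 sqr_ge0.
split=> t t0.
  have [iH [U [cU pU bU hU _]]] := key t t0.
  exists (fun x => Vscale gamma a0 theta b1 eps t ^- 2 * (E + eps * U x)).
    split.
    - move=> x; apply: cvgM; first exact: cvg_cst.
      apply: cvgD; first exact: cvg_cst.
      by apply: cvgM; [exact: cvg_cst|exact: cU].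
    - by move=> i x; rewrite pU.
    - have loc : {ae leb3, forall x : vec3 (measurableTypeR R), torus_cell x ->
          local_temperature gamma a0 theta b1 eps h t x =
          Vscale gamma a0 theta b1 eps t ^- 2 * (E + eps * U x)}.
        apply: filterS2 (local_energy eps theta_gt0 (V0 t t0) iH) hU => x Hx Ux cx.
        by rewrite -Ux// -Hx.
      exact: loc.
  move=> x; apply: (temperature_le _ _ _ _ _ (bU x) eN) => //; [exact: rate|exact: Vinv|].
  exact: Vscale_haff.
have [iH [_ [_ _ _ _ bI]]] := key t t0.
have T0 : 0 <= tau gamma a0 theta b1 eps t by apply: tau_ge0 => //; exact: ltW.
have mh := sob_norm_measurable (hoo _ T0).
rewrite /global_temperature.
have := global_energy eps theta_gt0 (V0 t t0) mh iH; rewrite /F_eps /f_eps => ->.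
apply: (temperature_le _ _ _ _ _ bI eN) => //; [exact: rate|exact: Vinv|].
exact: Vscale_haff.
Qed.
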